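(* Let $q\in\mathbb C^*$ with $q\neq 1$, and let $R$ be an irreducible root system of rank greater than $1$. If $R$ is of type $E_8$, assume moreover that the multiplicative order of $q$ is neither $11$ nor $13$. Then the affine Hecke algebra $H_q$ is not isomorphic, as a $\mathbb C$-algebra, to the group algebra $\mathbb C[W]$ of the extended affine Weyl group $W$.
   Context: Let $R$ be an irreducible root system with a fixed set of positive roots $R^+$ (and $R^-=-R^+$), Weyl group $W_0$, root lattice $Q=\mathbb ZR$ and weight lattice $X$. Let $W=W_0\ltimes X$ be the extended affine Weyl group (elements of $X$ written multiplicatively inside $W$) and $W_a=W_0\ltimes Q$ the affine Weyl group. The length function $l:W\to\mathbb N$ is given, for $w\in W_0$, $x\in X$, by $l(wx)=\sum_{\alpha\in R^+,\,w(\alpha)\in R^-}|\langle x,\alpha^\vee\rangle+1|+\sum_{\alpha\in R^+,\,w(\alpha)\in R^+}|\langle x,\alpha^\vee\rangle|$. Let $S$ be the set of elements of $W_a$ of length $1$ (simple reflections). For $q\in\mathbb C^*$, $H_q$ is the $\mathbb C$-algebra with basis $\{T_w\}_{w\in W}$ and relations $(T_r-q)(T_r+1)=0$ for $r\in S$ and $T_wT_u=T_{wu}$ whenever $l(wu)=l(w)+l(u)$. $\mathbb C[W]$ is identified with $H_1$. *)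

(* Defs.v *)
From HB Require Import structures.
From Stdlib Require Import Reals Lra Psatz ClassicalEpsilon FunctionalExtensionality.
From mathcomp Require Import all_boot all_order all_algebra.
Set Implicit Arguments. Unset Strict Implicit. Unset Printing Implicit Defensive.

Record cplx : Type := Cplx { Re : R; Im : R }.

Definition cplx_eqb (z w : cplx) : bool :=
  if Req_EM_T (Re z) (Re w) then (if Req_EM_T (Im z) (Im w) then true else false) else false.

Lemma cplx_eqP : Equality.axiom cplx_eqb.
Proof.
move=> [a b] [c d]; rewrite /cplx_eqb /=.
destruct (Req_EM_T a c) as [H1|H1]; last by constructor; case.
destruct (Req_EM_T b d) as [H2|H2]; last by constructor; case.
by subst; constructor.
Qed.
HB.instance Definition _ := hasDecEq.Build cplx cplx_eqP.

Definition cplx_find (P : pred cplx) (n : nat) : option cplx :=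
  match excluded_middle_informative (exists x, P x) with
  | left H => Some (proj1_sig (constructive_indefinite_description _ H))
  | right _ => None
  end.

Lemma cplx_find_some P n x : cplx_find P n = Some x -> P x.
Proof.
rewrite /cplx_find; case: excluded_middle_informative => // H [<-].
exact: proj2_sig (constructive_indefinite_description _ H).
Qed.
Lemma cplx_find_ex (P : pred cplx) : (exists x, P x) -> exists n, cplx_find P n.
Proof.
move=> H; exists 0%N; rewrite /cplx_find; case: excluded_middle_informative => //.
Qed.
Lemma cplx_find_ext (P Q : pred cplx) : P =1 Q -> cplx_find P =1 cplx_find Q.
Proof. by move=> /functional_extensionality ->. Qed.
HB.instance Definition _ := hasChoice.Build cplx cplx_find_some cplx_find_ex cplx_find_ext.

Local Open Scope R_scope.
Definition cadd z w := Cplx (Re z + Re w) (Im z + Im w).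
Definition copp z := Cplx (- Re z) (- Im z).
Definition czero := Cplx 0 0.
Definition cone := Cplx 1 0.
Definition cmul z w := Cplx (Re z * Re w - Im z * Im w) (Re z * Im w + Im z * Re w).
Definition cinv z := let d := Re z * Re z + Im z * Im z in Cplx (Re z / d) (- Im z / d).
Close Scope R_scope.

Lemma cplx_ext a b c d : a = c -> b = d -> Cplx a b = Cplx c d.
Proof. by move=> -> ->. Qed.

Lemma caddA : associative cadd.
Proof. move=> [a b] [c d] [e f]; apply: cplx_ext => /=; ring. Qed.
Lemma caddC : commutative cadd.
Proof. move=> [a b] [c d]; apply: cplx_ext => /=; ring. Qed.
Lemma cadd0 : left_id czero cadd.
Proof. move=> [a b]; apply: cplx_ext => /=; ring. Qed.
Lemma caddN : left_inverse czero copp cadd.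
Proof. move=> [a b]; apply: cplx_ext => /=; ring. Qed.
HB.instance Definition _ := GRing.isZmodule.Build cplx caddA caddC cadd0 caddN.

Lemma cmulA : associative cmul.
Proof. move=> [a b] [c d] [e f]; apply: cplx_ext => /=; ring. Qed.
Lemma cmulC : commutative cmul.
Proof. move=> [a b] [c d]; apply: cplx_ext => /=; ring. Qed.
Lemma cmul1 : left_id cone cmul.
Proof. move=> [a b]; apply: cplx_ext => /=; ring. Qed.
Lemma cmulDl : left_distributive cmul cadd.
Proof. move=> [a b] [c d] [e f]; apply: cplx_ext => /=; ring. Qed.
Lemma cone_neq0 : cone != czero.
Proof. apply/eqP => -[]; exact: R1_neq_R0. Qed.
HB.instance Definition _ := GRing.Zmodule_isComNzRing.Build cplx cmulA cmulC cmul1 cmulDl cone_neq0.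

Lemma cmulV (z : cplx) : z != GRing.zero -> cmul (cinv z) z = cone.
Proof.
case: z => a b /eqP Hz.
have Hd : Rplus (Rmult a a) (Rmult b b) <> R0.
  move=> H; apply: Hz; have Ha : a = R0 by nra.
  have Hb : b = R0 by nra. by rewrite Ha Hb.
rewrite /cmul /cinv /=; apply: cplx_ext => /=; field; exact: Hd.
Qed.
Lemma cinv0 : cinv GRing.zero = GRing.zero.
Proof. rewrite /cinv /=; apply: cplx_ext => /=; rewrite /Rdiv; ring. Qed.
HB.instance Definition _ := GRing.ComNzRing_isField.Build cplx cmulV cinv0.


Local Open Scope ring_scope.
Import GRing.Theory Num.Theory.

(* V = Q^n as column vectors, V^* = row vectors; <v, c> = c v.           *)
Definition pairing (n : nat) (v : 'cV[rat]_n) (c : 'rV[rat]_n) : rat := (c *m v) 0 0.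

Definition is_int (r : rat) : Prop := exists z : int, r = z%:~R.

(* A finite set of roots R (listed without repetition) together with the *)
(* coroot map alpha |-> alpha^vee (only its values on roots matter).      *)
Record rootsys (n : nat) := RootSys {
  roots : seq 'cV[rat]_n;
  coroot : 'cV[rat]_n -> 'rV[rat]_n }.

Definition refl_mx (n : nat) (R : rootsys n) (a : 'cV[rat]_n) : 'M[rat]_n :=
  1%:M - a *m coroot R a.

Definition is_root_system (n : nat) (R : rootsys n) : Prop :=
  [/\ uniq (roots R) /\ 0 \notin roots R,
      (forall v : 'cV[rat]_n, exists c : 'cV[rat]_n -> rat,
          v = \sum_(a <- roots R) c a *: a),
      (forall a, a \in roots R -> pairing a (coroot R a) = 2),
      (forall a b, a \in roots R -> b \in roots R -> refl_mx R a *m b \in roots R)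
    & (forall a b, a \in roots R -> b \in roots R -> is_int (pairing b (coroot R a)))].

Definition reduced_rs (n : nat) (R : rootsys n) : Prop :=
  forall (a : 'cV[rat]_n) (c : rat), a \in roots R -> c *: a \in roots R ->
    c = 1 \/ c = -1.

Definition irreducible_rs (n : nat) (R : rootsys n) : Prop :=
  ~ exists P : 'cV[rat]_n -> Prop,
      [/\ (exists a, a \in roots R /\ P a),
          (exists b, b \in roots R /\ ~ P b)
        & forall a b, a \in roots R -> b \in roots R -> P a -> ~ P b ->
            pairing b (coroot R a) = 0].

Definition E8root (u : 'cV[rat]_8) : Prop :=
  (exists i j : 'I_8, [/\ i != j, u i 0 = 1 \/ u i 0 = -1, u j 0 = 1 \/ u j 0 = -1
        & forall k, k != i -> k != j -> u k 0 = 0])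
  \/ ((forall i : 'I_8, u i 0 = 1/2 \/ u i 0 = -(1/2)) /\
      ~~ odd (count (fun i : 'I_8 => u i 0 < 0) (enum 'I_8))).

Definition typeE8 (n : nat) (R : rootsys n) : Prop :=
  exists M : 'M[rat]_(8, n),
    [/\ forall v w : 'cV[rat]_n, M *m v = M *m w -> v = w,
        forall a, a \in roots R -> E8root (M *m a)
      & forall u, E8root u -> exists a, a \in roots R /\ M *m a = u].

(* R^+ = roots on which the linear form f is positive (f vanishes on no root) *)
Definition positive_system (n : nat) (R : rootsys n) (f : 'rV[rat]_n) : Prop :=
  forall a, a \in roots R -> pairing a f != 0.

Definition is_pos (n : nat) (f : 'rV[rat]_n) (a : 'cV[rat]_n) : bool := 0 < pairing a f.

Definition inX (n : nat) (R : rootsys n) (x : 'cV[rat]_n) : Prop :=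
  forall a, a \in roots R -> is_int (pairing x (coroot R a)).
Definition inQ (n : nat) (R : rootsys n) (x : 'cV[rat]_n) : Prop :=
  exists c : 'cV[rat]_n -> int, x = \sum_(a <- roots R) a *~ c a.

Definition inW0 (n : nat) (R : rootsys n) (w : 'M[rat]_n) : Prop :=
  exists s : seq 'cV[rat]_n, all (mem (roots R)) s /\
    w = foldr (fun a m => refl_mx R a *m m) 1%:M s.

(* W = W_0 |x X : the pair (w, x) stands for the element  w x  (w in W_0, x in X) *)
Definition Wel (n : nat) (R : rootsys n) : Type :=
  {p : 'M[rat]_n * 'cV[rat]_n | inW0 R p.1 /\ inX R p.2}.
Definition Wlin (n : nat) (R : rootsys n) (a : Wel R) : 'M[rat]_n := (sval a).1.
Definition Wtr (n : nat) (R : rootsys n) (a : Wel R) : 'cV[rat]_n := (sval a).2.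

(* graph of the group law: (w x)(w' x') = (w w') (w'^{-1}(x) + x') *)
Definition mulW (n : nat) (R : rootsys n) (a b c : Wel R) : Prop :=
  Wlin c = Wlin a *m Wlin b /\ Wlin b *m (Wtr c - Wtr b) = Wtr a.

(* the length function l(w x) (values in N, computed in Q) *)
Definition lenW (n : nat) (R : rootsys n) (f : 'rV[rat]_n) (a : Wel R) : rat :=
  \sum_(r <- roots R | is_pos f r)
     (if is_pos f (Wlin a *m r)
      then `|pairing (Wtr a) (coroot R r)|
      else `|pairing (Wtr a) (coroot R r) + 1|).

(* S : elements of W_a = W_0 |x Q of length 1 *)
Definition simple_refl (n : nat) (R : rootsys n) (f : 'rV[rat]_n) (s : Wel R) : Prop :=
  inQ R (Wtr s) /\ lenW f s = 1.

Definition is_basis (V : lmodType cplx) (I : Type) (T : I -> V) : Prop :=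
  (forall (s : seq I) (c : I -> cplx), List.NoDup s ->
      \sum_(i <- s) c i *: T i = 0 -> forall i, List.In i s -> c i = 0)
  /\ (forall v : V, exists (s : seq I) (c : I -> cplx), v = \sum_(i <- s) c i *: T i).

Definition is_Hecke (n : nat) (R : rootsys n) (f : 'rV[rat]_n) (q : cplx)
    (A : algType cplx) (T : Wel R -> A) : Prop :=
  [/\ is_basis T,
      forall r, simple_refl f r -> (T r - q%:A) * (T r + 1) = 0
    & forall a b c, mulW a b c -> lenW f c = lenW f a + lenW f b -> T a * T b = T c].

Definition is_group_algebra (n : nat) (R : rootsys n) (B : algType cplx) (e : Wel R -> B) : Prop :=
  is_basis e /\ (forall a b c, mulW a b c -> e a * e b = e c).

Definition alg_isomorphic (A B : algType cplx) : Prop :=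
  exists phi : A -> B,
    [/\ bijective phi,
        forall x y, phi (x + y) = phi x + phi y,
        forall (c : cplx) x, phi (c *: x) = c *: phi x,
        forall x y, phi (x * y) = phi x * phi y
      & phi 1 = 1].

Definition mult_order (q : cplx) (e : nat) : Prop :=
  [/\ (0 < e)%N, q ^+ e = 1 & forall k, (0 < k < e)%N -> q ^+ k != 1].

(* Main.v *)
Require Import Defs.
From HB Require Import structures.
From Stdlib Require Import ClassicalEpsilon ProofIrrelevance.
From mathcomp Require Import complex Rstruct.
From mathcomp Require Import all_boot all_order all_algebra.
From mathcomp Require Import zify ring lra.
Import Order.TTheory GRing.Theory Num.Theory.
Local Open Scope ring_scope.
Set Implicit Arguments. Unset Strict Implicit. Unset Printing Implicit Defensive.

(** Suppose one algebra A carries both a basis T_w of the affine Hecke algebra and a basis e_w of the group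
    algebra of W.  A character h of A is cut out by the n commuting elements e_(om_i) - h(e_(om_i)) and an
    average over W0, while A is free over the finite Hecke algebra; hence h restricts to a projective module
    of the latter, and by Higman's criterion the Casimir sum of the q^-l(w) h(T_w) h(T_(w^-1)), w in W0, is
    nonzero.  For the trivial character of C[W] this gives q <> -1 and q^m <> 1, where m is the order of
    s_i s_j for a suitable edge {i, j} of the Dynkin diagram.

    The center of A acts by scalars on the modules I(t) induced from the dominant translations of H_q, so all
    simple subquotients of I(t) are linked; on the side of C[W] their X-weights then lie in a single W0-orbit.
    If the diagram has a simple edge {i, j}, choose t with t(al_i) = t(al_j) = q and generic otherwise, and let
    D be the set of minimal representatives of W0 / <s_i, s_j>.  One simple subquotient of I(t) has dimension
    at most |D|, so the orbit has at most |D| elements.  The subquotients carrying the weights s_i t and s_j t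
    have dimension at least 2|D|, so by density A has an image of dimension at least 2 (2|D|)^2 = 8 |D|^2,
    whereas |W0| times the size of the orbit, at most 6 |D|^2, bounds such images from the side of C[W].
    In types B2 and G2 a one-dimensional subquotient makes X act by scalars on all linked simple modules, which
    are therefore modules of a dihedral group, of dimension at most 2; well chosen weights of H_q give at
    least 3. *)

(** * Root systems *)

(** An isomorphism respects neither basis, so the two sides are compared only through intrinsic
    data: dimensions of modules and of images of A, and the scalars by which the center acts. When q
    is a root of unity the submodules of I(t) are hard to control; weights are followed only along
    rank one intertwiners that are certainly nonzero, which requires values of t outside 1, q, q^-1.
    The inequalities obtained from Higman's criterion are what makes the value t(al_i + al_j) = q^2
    admissible and t regular.

    The constants come from the six elements v of <s_i, s_j>. The weights of I(t) are u v t with u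
    in D. The intertwiners across the value q degenerate and group the v as {1}, {s_i, s_j s_i},
    {s_j, s_i s_j} and the longest element, of sizes 1 + 2 + 2 + 1. The first group bounds the
    orbit; the two middle ones give 2^2 + 2^2 = 8 against 6 times 1.

    In types B2 and G2 the two values t(al_i) = t(al_j) = q fix t on all roots. No parameter is left
    to make t generic, and coincidences such as q^(a+1) = 1 have to be excluded one by one, by a
    Jordan block of a translation. *)

Lemma pairingD n (x y : 'cV[rat]_n) c : pairing (x + y) c = pairing x c + pairing y c.
Proof. by rewrite /pairing mulmxDr mxE. Qed.
Lemma pairingZ n k (x : 'cV[rat]_n) c : pairing (k *: x) c = k * pairing x c.
Proof. by rewrite /pairing -scalemxAr mxE. Qed.
Lemma pairingN n (x : 'cV[rat]_n) c : pairing (- x) c = - pairing x c.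
Proof. by rewrite /pairing mulmxN mxE. Qed.
Lemma pairingB n (x y : 'cV[rat]_n) c : pairing (x - y) c = pairing x c - pairing y c.
Proof. by rewrite pairingD pairingN. Qed.
Lemma pairing0 n (c : 'rV[rat]_n) : pairing 0 c = 0.
Proof. by rewrite /pairing mulmx0 mxE. Qed.
Lemma pairing_sum n (I : Type) (s : seq I) (P : pred I) (F : I -> 'cV[rat]_n) c :
  pairing (\sum_(i <- s | P i) F i) c = \sum_(i <- s | P i) pairing (F i) c.
Proof. by apply: (big_morph (fun x => pairing x c) (fun x y => pairingD x y c)); exact: pairing0. Qed.

Lemma is_intD (r s : rat) : is_int r -> is_int s -> is_int (r + s).
Proof. by move=> [a ->] [b ->]; exists (a + b); rewrite rmorphD. Qed.
Lemma is_intM (r s : rat) : is_int r -> is_int s -> is_int (r * s).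
Proof. by move=> [a ->] [b ->]; exists (a * b); rewrite rmorphM. Qed.
Lemma is_intN (r : rat) : is_int r -> is_int (- r).
Proof. by move=> [a ->]; exists (- a); rewrite rmorphN. Qed.
Lemma is_intB (a b : rat) : is_int a -> is_int b -> is_int (a - b).
Proof. by move=> Ha Hb; apply: is_intD => //; exact: is_intN. Qed.

Lemma colmulP n (w w' : 'M[rat]_n) : (forall v : 'cV[rat]_n, w *m v = w' *m v) -> w = w'.
Proof.
move=> H; apply/matrixP => i j; have := H (delta_mx j 0); rewrite -!colE.
by move/colP/(_ i); rewrite !mxE.
Qed.

Section RootSystem.
Variables (n : nat) (R : rootsys n) (f : 'rV[rat]_n).
Hypotheses (HR : is_root_system R) (Hred : reduced_rs R) (Hpos : positive_system R f).
Local Notation rts := (Defs.roots R).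
Local Notation pr x a := (pairing x (coroot R a)).

Lemma reflE a (x : 'cV[rat]_n) : refl_mx R a *m x = x - pr x a *: a.
Proof.
rewrite /refl_mx mulmxBl mul1mx -mulmxA (mx11_scalar (coroot R a *m x)).
by rewrite mul_mx_scalar.
Qed.

Lemma roots_uniq : uniq rts. Proof. by case: HR => -[]. Qed.
Lemma root_neq0 a : a \in rts -> a != 0.
Proof. by case: HR => -[_ H0] *; apply: contraNneq H0 => <-. Qed.
Lemma pr_self a : a \in rts -> pr a a = 2. Proof. by case: HR => _ _ H _ _; exact: H. Qed.
Lemma refl_root a b : a \in rts -> b \in rts -> refl_mx R a *m b \in rts.
Proof. by case: HR => _ _ _ H _; exact: H. Qed.
Lemma pr_int a b : a \in rts -> b \in rts -> is_int (pr b a).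
Proof. by case: HR => _ _ _ _; exact. Qed.

Lemma root_ext (w w' : 'M[rat]_n) : (forall a, a \in rts -> w *m a = w' *m a) -> w = w'.
Proof.
move=> H; apply: colmulP => v; case: HR => _ /(_ v) [c ->] _ _ _.
rewrite !mulmx_sumr; rewrite [LHS]big_seq_cond [RHS]big_seq_cond.
by apply: eq_bigr => a /andP [Ha _]; rewrite -!scalemxAr H.
Qed.

Lemma oppr_root a : a \in rts -> - a \in rts.
Proof.
by move=> Ha; have := refl_root Ha Ha; rewrite reflE pr_self // scaler_nat mulr2n opprD addrA subrr add0r.
Qed.

Lemma reflK a : a \in rts -> refl_mx R a *m refl_mx R a = 1%:M.
Proof.
move=> Ha; apply: colmulP => v; rewrite -mulmxA mul1mx [X in _ *m X]reflE mulmxBr -scalemxAr.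
by rewrite !reflE pr_self // scaler_nat mulr2n opprD addrA subrr add0r scalerN opprK subrK.
Qed.

Lemma W0_1 : inW0 R 1%:M. Proof. by exists [::]. Qed.
Lemma W0_refl a : a \in rts -> inW0 R (refl_mx R a).
Proof. by move=> Ha; exists [:: a] => /=; rewrite Ha mulmx1. Qed.
Lemma W0_mul w w' : inW0 R w -> inW0 R w' -> inW0 R (w *m w').
Proof.
move=> [s [Hs ->]] [s' [Hs' ->]]; exists (s ++ s'); split; first by rewrite all_cat Hs.
elim: s Hs => [|a s IH] /=; first by rewrite mul1mx.
by case/andP=> _ /IH <-; rewrite mulmxA.
Qed.
Lemma W0_ind (P : 'M[rat]_n -> Prop) : P 1%:M ->
  (forall a w, a \in rts -> inW0 R w -> P w -> P (refl_mx R a *m w)) ->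
  forall w, inW0 R w -> P w.
Proof.
move=> P1 PS w [s [Hs ->]]; elim: s Hs => [|a s IH] //= /andP [Ha Hs].
by apply: PS => //; [exists s | exact: IH].
Qed.
Lemma W0_root w a : inW0 R w -> a \in rts -> w *m a \in rts.
Proof.
move=> Hw; elim/W0_ind: w / Hw a => [a|b w Hb _ IH a Ha]; first by rewrite mul1mx.
by rewrite -mulmxA refl_root // IH.
Qed.
Lemma W0_inv w : inW0 R w -> w \in unitmx /\ inW0 R (invmx w).
Proof.
move=> Hw; suff [w' [Hw' E]] : exists w', inW0 R w' /\ w' *m w = 1%:M.
  have [_ U] := mulmx1_unit E; split => //.
  by rewrite -(mulmxK U w') E mul1mx in Hw'.
elim/W0_ind: w / Hw => [|a w Ha _ [w' [Hw' E]]]; first by exists 1%:M; rewrite mulmx1; split=> //; exact: W0_1.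
exists (w' *m refl_mx R a); split; first by apply: W0_mul => //; exact: W0_refl.
by rewrite -mulmxA (mulmxA _ _ w) reflK // mul1mx.
Qed.
Lemma W0_unit w : inW0 R w -> w \in unitmx. Proof. by case/W0_inv. Qed.
Lemma W0_invmx w : inW0 R w -> inW0 R (invmx w). Proof. by case/W0_inv. Qed.

(** Finiteness comes from the action on the roots, which span the space. [F g] is the element of W0
    inducing the map [g] on the indices of the roots, and 1 when there is none, so that its values
    always lie in W0. *)
Lemma W0_list : exists s : seq 'M[rat]_n, uniq s /\ forall w, (w \in s) <-> inW0 R w.
Proof.
pose m := size rts.
pose P (g : {ffun 'I_m -> 'I_m}) w :=
  inW0 R w /\ forall i : 'I_m, w *m nth 0 rts i = nth 0 rts (g i).
pose F g := match excluded_middle_informative (exists w, P g w) with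
  | left H => proj1_sig (constructive_indefinite_description _ H) | right _ => 1%:M end.
have FP g w : P g w -> F g = w.
  move=> Pw; rewrite /F; case: excluded_middle_informative => [H|[]]; last by exists w.
  case: constructive_indefinite_description => w' /= [Hw' E].
  case: Pw => Hw E'; apply: root_ext => a Ha.
  have Hi : (index a rts < m)%N by rewrite index_mem.
  by have := E (Ordinal Hi); rewrite -(E' (Ordinal Hi)) /= nth_index.
have F1 g : inW0 R (F g).
  rewrite /F; case: excluded_middle_informative => [H|_]; last exact: W0_1.
  by case: constructive_indefinite_description => w' /= [].
exists (undup [seq F g | g <- enum {ffun 'I_m -> 'I_m}]); split; first exact: undup_uniq.
move=> w; rewrite mem_undup; split; first by case/mapP => g _ ->.
move=> Hw; apply/mapP.
have Hi (i : 'I_m) : (index (w *m nth 0 rts i)%R rts < m)%N.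
  by rewrite index_mem W0_root // mem_nth.
exists [ffun i => Ordinal (Hi i)]; first by rewrite mem_enum.
symmetry; apply: FP; split => // i; rewrite ffunE /= nth_index //.
by rewrite W0_root // mem_nth.
Qed.

Section WithW0.
Variable W0s : seq 'M[rat]_n.
Hypotheses (W0u : uniq W0s) (W0P : forall w, (w \in W0s) <-> inW0 R w).

(** The standard form summed over W0: invariant, and positive definite because of the summand of the
    identity. *)
Definition form (x y : 'cV[rat]_n) : rat :=
  \sum_(w <- W0s) ((w *m x)^T *m (w *m y)) 0 0.

Lemma formC x y : form x y = form y x.
Proof.
apply: eq_bigr => w _; rewrite mxE [RHS]mxE; apply: eq_bigr => k _.
by rewrite mxE [in RHS]mxE mulrC.
Qed.
Lemma formDl x y z : form (x + y) z = form x z + form y z.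
Proof. by rewrite /form -big_split; apply: eq_bigr => w _; rewrite mulmxDr linearD mulmxDl mxE. Qed.
Lemma formZl k x z : form (k *: x) z = k * form x z.
Proof.
rewrite /form mulr_sumr; apply: eq_bigr => w _.
by rewrite -scalemxAr linearZ -scalemxAl mxE.
Qed.
Lemma formNl x z : form (- x) z = - form x z.
Proof. by rewrite -scaleN1r formZl mulN1r. Qed.
Lemma formDr x y z : form z (x + y) = form z x + form z y.
Proof. by rewrite !(formC z) formDl. Qed.
Lemma formZr k x z : form z (k *: x) = k * form z x.
Proof. by rewrite !(formC z) formZl. Qed.
Lemma formNr x z : form z (- x) = - form z x.
Proof. by rewrite !(formC z) formNl. Qed.
Lemma form0l x : form 0 x = 0. Proof. by rewrite -(scale0r 0) formZl mul0r. Qed.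
Lemma form_suml (I : Type) (s : seq I) (P : pred I) F y :
  form (\sum_(i <- s | P i) F i) y = \sum_(i <- s | P i) form (F i) y.
Proof. by apply: (big_morph (fun x => form x y) (fun x z => formDl x z y)); exact: form0l. Qed.
Lemma form_sumr (I : Type) (s : seq I) (P : pred I) F y :
  form y (\sum_(i <- s | P i) F i) = \sum_(i <- s | P i) form y (F i).
Proof. by rewrite formC form_suml; apply: eq_bigr => i _; exact: formC. Qed.

Lemma W0s_mulr v : inW0 R v -> perm_eq [seq w *m v | w <- W0s] W0s.
Proof.
move=> Hv; have Uv := W0_unit Hv; apply: uniq_perm => //.
  by rewrite map_inj_uniq // => a b /(congr1 (mulmx^~ (invmx v))); rewrite !mulmxK.
move=> w; apply/mapP/idP => [[u /W0P Hu ->]|/W0P Hw].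
  by apply/W0P; exact: W0_mul.
by exists (w *m invmx v); rewrite ?mulmxKV //; apply/W0P/W0_mul => //; exact: W0_invmx.
Qed.
Lemma W0s_mull v : inW0 R v -> perm_eq [seq v *m w | w <- W0s] W0s.
Proof.
move=> Hv; have Uv := W0_unit Hv; apply: uniq_perm => //.
  by rewrite map_inj_uniq // => a b /(congr1 (mulmx (invmx v))); rewrite !mulKmx.
move=> w; apply/mapP/idP => [[u /W0P Hu ->]|/W0P Hw].
  by apply/W0P; exact: W0_mul.
by exists (invmx v *m w); rewrite ?mulKVmx //; apply/W0P/W0_mul => //; exact: W0_invmx.
Qed.

Lemma form_inv v x y : inW0 R v -> form (v *m x) (v *m y) = form x y.
Proof.
move=> Hv; rewrite /form -[RHS](perm_big _ (W0s_mulr Hv)) big_map.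
by apply: eq_bigr => w _; rewrite !mulmxA.
Qed.

Lemma form_ge (x : 'cV[rat]_n) : \sum_i x i 0 ^+ 2 <= form x x.
Proof.
have sq (y : 'cV[rat]_n) : (y^T *m y) 0 0 = \sum_i y i 0 ^+ 2.
  by rewrite mxE; apply: eq_bigr => i _; rewrite mxE expr2.
have M1 : 1%:M \in W0s by apply/W0P; exact: W0_1.
rewrite /form (big_rem _ M1) /= mul1mx sq lerDl.
by apply: sumr_ge0 => w _; rewrite sq; apply: sumr_ge0 => i _; exact: sqr_ge0.
Qed.
Lemma form_ge0 x : 0 <= form x x.
Proof. by apply: le_trans (form_ge x); apply: sumr_ge0 => i _; exact: sqr_ge0. Qed.
Lemma form_eq0 x : form x x = 0 -> x = 0.
Proof.
move=> H; have := form_ge x; rewrite H => Hle.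
apply/colP => i; rewrite mxE; apply/eqP; rewrite -sqrf_eq0 eq_le sqr_ge0 andbT.
apply: le_trans Hle; rewrite (bigD1 i) //= lerDl.
by apply: sumr_ge0 => j _; exact: sqr_ge0.
Qed.
Lemma form_gt0 x : x != 0 -> 0 < form x x.
Proof. by move=> Hx; rewrite lt_def form_ge0 andbT; apply: contra_neq Hx; exact: form_eq0. Qed.
Lemma form_root_gt0 a : a \in rts -> 0 < form a a.
Proof. by move=> Ha; apply/form_gt0/root_neq0. Qed.

(** The reflection in [a] is an isometry that negates [a]. Equivariance and oddness of the coroot
    map, [pr_inv] and [pr_opp], are deduced from this expression of coroots by the form. *)
Lemma pr_form x a : a \in rts -> pr x a * form a a = 2 * form a x.
Proof.
move=> Ha; have E : form (refl_mx R a *m a) (refl_mx R a *m x) = form a x by exact/form_inv/W0_refl.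
move: E; rewrite !reflE pr_self // scaler_nat mulr2n opprD addrA subrr add0r.
rewrite formNl formDr formNr formZr => E; lra.
Qed.

Lemma pr_formE x a : a \in rts -> pr x a = 2 * form a x / form a a.
Proof. by move=> Ha; rewrite -pr_form // mulfK // gt_eqF // form_root_gt0. Qed.

Lemma pr_inv w x a : inW0 R w -> a \in rts -> pr (w *m x) (w *m a) = pr x a.
Proof. by move=> Hw Ha; rewrite !pr_formE ?W0_root // !form_inv. Qed.

Lemma pr_opp x a : a \in rts -> pr x (- a) = - pr x a.
Proof. by move=> Ha; rewrite !pr_formE ?oppr_root // !formNl formNr opprK mulrN mulNr. Qed.

Lemma refl_conj w a : inW0 R w -> a \in rts ->
  refl_mx R (w *m a) = w *m refl_mx R a *m invmx w.
Proof.
move=> Hw Ha; apply: colmulP => v; have Uw := W0_unit Hw.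
rewrite -!mulmxA reflE -{1 2}(mulKVmx Uw v) pr_inv // reflE mulmxBr.
by rewrite -scalemxAr.
Qed.
Lemma form_cs a b : b != 0 -> (forall t, a != t *: b) ->
  form a b ^+ 2 < form a a * form b b.
Proof.
move=> Hb Hab; have Hbb := form_gt0 Hb.
pose t := form a b / form b b.
have := @form_gt0 (a - t *: b); rewrite subr_eq0 Hab => /(_ isT).
have Et : t * form b b = form a b by rewrite /t mulfVK // gt_eqF.
rewrite formDl !formDr !formNl !formNr !formZl !formZr (formC b a).
move=> H; have : 0 < (form a a - t * form a b) * form b b.
  by rewrite mulr_gt0 //; move: H; rewrite Et; lra.
by rewrite mulrBl -mulrA (mulrC (form a b)) mulrA Et; lra.
Qed.

Definition pos : seq 'cV[rat]_n := [seq r <- rts | is_pos f r].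

Lemma pos_rts r : r \in pos -> r \in rts. Proof. by rewrite mem_filter => /andP []. Qed.
Lemma posP r : r \in rts -> (r \in pos) = (0 < pairing r f).
Proof. by move=> H; rewrite mem_filter H andbT. Qed.
Lemma pos_gt0 r : r \in pos -> 0 < pairing r f.
Proof. by rewrite mem_filter => /andP []. Qed.
Lemma pos_uniq : uniq pos. Proof. exact/filter_uniq/roots_uniq. Qed.
Lemma posN r : r \in rts -> (- r \in pos) = (r \notin pos).
Proof.
move=> Hr; rewrite !posP ?oppr_root // pairingN oppr_gt0 -leNgt.
by rewrite le_eqVlt (negbTE (Hpos Hr)).
Qed.
Lemma pos_or r : r \in rts -> r \in pos \/ - r \in pos.
Proof. by move=> Hr; rewrite posN //; case: (r \in pos); [left|right]. Qed.
Lemma pos_nopp r : r \in pos -> - r \notin pos.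
Proof. by move=> Hr; rewrite posN ?Hr // pos_rts. Qed.

Lemma root_prop a b t : a \in rts -> b \in rts -> a = t *: b -> a = b \/ a = - b.
Proof.
move=> Ha Hb E; case: (Hred Hb (c := t)); rewrite -?E // => Et; subst t.
  by left; rewrite E scale1r.
by right; rewrite E scaleN1r.
Qed.

Definition simples : seq 'cV[rat]_n :=
  [seq a <- pos | ~~ has (fun b => a - b \in pos) pos].

Lemma simple_pos a : a \in simples -> a \in pos.
Proof. by rewrite mem_filter => /andP []. Qed.
Lemma simple_indec a b : a \in simples -> b \in pos -> a - b \notin pos.
Proof.
rewrite mem_filter => /andP [Ha _] Hb; apply: contra Ha => H.
by apply/hasP; exists b.
Qed.

(** Heights [pairing r f] are rational and do not support an induction by themselves; it runs on the
    number of positive roots of smaller height. *)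
Lemma pos_decomp r : r \in pos -> exists k : 'cV[rat]_n -> nat,
  r = \sum_(a <- simples) (k a)%:R *: a.
Proof.
have [m] := ubnP (count (fun b => pairing b f < pairing r f) pos).
elim: m r => // m IH r Hm Hr.
have [Hs|] := boolP (r \in simples).
  exists (fun a => (a == r) : nat).
  have us : uniq simples by exact/filter_uniq/pos_uniq.
  rewrite (bigD1_seq r) //= eqxx scale1r big1 ?addr0 //.
  by move=> a /negbTE ->; rewrite scale0r.
rewrite mem_filter Hr andbT negbK => /hasP [b Hb Hrb].
have dec c : c \in pos -> pairing c f < pairing r f ->
    (count (fun b => (pairing b f < pairing c f)%R) pos < m)%N.
  move=> Hc Hlt; rewrite ltnS in Hm; apply: leq_trans Hm.
  rewrite -!size_filter; apply: (@leq_trans (size (c :: [seq b <- pos | pairing b f < pairing c f]))) => //.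
  apply: uniq_leq_size => /=.
    by rewrite mem_filter ltxx /= filter_uniq // pos_uniq.
  move=> d; rewrite inE => /orP [/eqP ->|]; first by rewrite mem_filter Hlt Hc.
  by rewrite mem_filter => /andP [Hd Hdp]; rewrite mem_filter Hdp (lt_trans Hd Hlt).
have [k1 E1] : exists k : 'cV[rat]_n -> nat, b = \sum_(a <- simples) (k a)%:R *: a.
  by apply: IH => //; apply: dec => //; have := pos_gt0 Hrb; rewrite pairingB subr_gt0.
have [k2 E2] : exists k : 'cV[rat]_n -> nat, r - b = \sum_(a <- simples) (k a)%:R *: a.
  by apply: IH => //; apply: dec => //; have := pos_gt0 Hb; rewrite pairingB => ?; lra.
exists (fun a => k1 a + k2 a)%N.
rewrite -[LHS](subrK b) addrC {1}E1 E2 -big_split; apply: eq_bigr => a _.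
by rewrite natrD scalerDl.
Qed.

(** At an acute angle both Cartan integers are positive, with product below 4 by Cauchy-Schwarz, so
    one of them is 1. The corresponding reflection yields the difference of the two roots, against
    indecomposability. *)
Lemma simple_obtuse a b : a \in simples -> b \in simples -> a != b -> form a b <= 0.
Proof.
move=> Sa Sb Hab; rewrite leNgt; apply/negP => Hf.
have Pa := simple_pos Sa; have Pb := simple_pos Sb.
have Ra := pos_rts Pa; have Rb := pos_rts Pb.
have np t : a != t *: b.
  apply/eqP => E; case: (root_prop Ra Rb E) => E'; first by rewrite E' eqxx in Hab.
  by have := pos_nopp Pb; rewrite -E' Pa.
have CS := form_cs (root_neq0 Rb) np.
have Ha := form_root_gt0 Ra; have Hb := form_root_gt0 Rb.
have [z1 E1] := pr_int Rb Ra; have [z2 E2] := pr_int Ra Rb.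
have F1 := pr_form a Rb; have F2 := pr_form b Ra.
rewrite E1 (formC b a) in F1; rewrite E2 in F2.
have z1p : 0 < z1.
  rewrite -(ltr0z rat) -(pmulr_lgt0 _ Hb) F1; lra.
have z2p : 0 < z2.
  rewrite -(ltr0z rat) -(pmulr_lgt0 _ Ha) F2; lra.
have zz : z1 * z2 < 4.
  rewrite -(ltr_int rat) rmorphM /= -(ltr_pM2r Ha) -(ltr_pM2r Hb).
  have -> : z1%:~R * z2%:~R * form a a * form b b = (z1%:~R * form b b) * (z2%:~R * form a a) :> rat by ring.
  rewrite F1 F2; move: CS; rewrite expr2; lra.
have : z1 = 1 \/ z2 = 1 by nia.
have cl x y : x \in simples -> y \in simples -> pr x y = 1 -> False.
  move=> Sx Sy E; have Px := simple_pos Sx; have Py := simple_pos Sy.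
  have := refl_root (pos_rts Py) (pos_rts Px); rewrite reflE E scale1r.
  case/pos_or => H; first by have := simple_indec Sx Py; rewrite H.
  by have := simple_indec Sy Px; rewrite -opprB H.
case=> Ez; [apply: (cl a b) => // | apply: (cl b a) => //]; first by rewrite E1 Ez.
by rewrite E2 Ez.
Qed.

(** Separating the coefficients by sign writes one vector [v] as a nonnegative combination of two
    disjoint sets of simple roots. Obtuseness makes [v] isotropic, hence zero, while [f] is positive
    on every simple root. *)
Lemma simples_indep (c : 'cV[rat]_n -> rat) :
  \sum_(a <- simples) c a *: a = 0 -> forall a, a \in simples -> c a = 0.
Proof.
move=> E.
pose v := \sum_(a <- simples | 0 < c a) c a *: a.
have Ev : v = \sum_(a <- simples | ~~ (0 < c a)) (- c a) *: a.
  move: E; rewrite (bigID (fun a => 0 < c a)) /= -/v => /eqP; rewrite addr_eq0 => /eqP ->.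
  by rewrite -sumrN; apply: eq_bigr => a _; rewrite scaleNr.
have v0 : v = 0.
  apply: form_eq0; apply/eqP; rewrite eq_le form_ge0 andbT.
  rewrite {1}/v form_suml; rewrite Ev big_seq_cond; apply: sumr_le0 => a /andP [Sa Ha].
  rewrite form_sumr big_seq_cond; apply: sumr_le0 => b /andP [Sb Hb].
  rewrite formZl formZr; have : form a b <= 0.
    by apply: simple_obtuse => //; apply/eqP => Eab; rewrite -Eab Ha in Hb.
  rewrite -leNgt in Hb; move=> Hf.
  by apply: mulr_ge0_le0; [exact: ltW | apply: mulr_ge0_le0 => //; rewrite oppr_ge0].
have H1 : forall a, a \in simples -> ~~ (0 < c a).
  move=> a Sa; apply/negP => Ha; have : pairing v f = 0 by rewrite v0 pairing0.
  rewrite /v pairing_sum => /eqP; rewrite big_seq_cond psumr_eq0 => [|b /andP [Sb Hb]].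
    move/allP/(_ a Sa); rewrite Sa Ha /= pairingZ mulf_eq0.
    by rewrite gt_eqF //= gt_eqF //; exact/pos_gt0/simple_pos.
  by rewrite pairingZ mulr_ge0 // ltW //; exact/pos_gt0/simple_pos.
move=> a Sa; have Ha := H1 a Sa; apply/eqP; rewrite eq_le leNgt Ha /= leNgt; apply/negP => Hc.
have : pairing v f = 0 by rewrite v0 pairing0.
rewrite Ev pairing_sum => /eqP; rewrite big_seq_cond psumr_eq0 => [|b /andP [Sb Hb]].
  move/allP/(_ a Sa); rewrite Sa Ha /= pairingZ mulf_eq0 oppr_eq0.
  by rewrite lt_eqF //= gt_eqF //; exact/pos_gt0/simple_pos.
by rewrite pairingZ mulr_ge0 //; [rewrite oppr_ge0 leNgt | rewrite ltW //; exact/pos_gt0/simple_pos].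
Qed.

Definition is_base (al : 'I_n -> 'cV[rat]_n) : Prop :=
  [/\ forall i, al i \in pos,
      forall v : 'cV[rat]_n, exists c, v = \sum_i c i *: al i,
      forall c, \sum_i c i *: al i = 0 -> forall i, c i = 0
    & forall r, r \in pos -> exists k : 'I_n -> nat, r = \sum_i (k i)%:R *: al i].

Lemma base_exists : exists al, is_base al.
Proof.
pose m := size simples.
pose M : 'M[rat]_(m, n) := \matrix_(i, j) nth 0 simples i j 0.
have sumE (c : 'I_m -> rat) : (\row_i c i *m M)^T = \sum_i c i *: nth 0 simples i.
  apply/colP => j; rewrite !mxE summxE; apply: eq_bigr => i _; by rewrite !mxE.
have big2 (c : 'I_m -> rat) (c' : 'cV[rat]_n -> rat) :
    (forall i : 'I_m, c' (nth 0 simples i) = c i) ->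
    \sum_(a <- simples) c' a *: a = \sum_i c i *: nth 0 simples i.
  by move=> H; rewrite (big_nth 0) big_mkord; apply: eq_bigr => i _; rewrite H.
have uS : uniq simples by exact/filter_uniq/pos_uniq.
have ind (c : 'I_m -> rat) : \sum_i c i *: nth 0 simples i = 0 -> forall i, c i = 0.
  move=> E i.
  pose c' a := if insub (index a simples) is Some j then c j else 0.
  have Hc' (j : 'I_m) : c' (nth 0 simples j) = c j.
    rewrite /c' index_uniq //; case: insubP => [k _ Ek|]; last by rewrite ltn_ord.
    by congr c; apply: val_inj.
  rewrite -Hc'; apply: simples_indep; last exact: mem_nth.
  by rewrite (big2 c).
have sp (v : 'cV[rat]_n) : exists c : 'I_m -> rat, v = \sum_i c i *: nth 0 simples i.
  have spr r : r \in rts -> exists c : 'cV[rat]_n -> rat, r = \sum_(a <- simples) c a *: a.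
    case/pos_or => /pos_decomp [k E]; first by exists (fun a => (k a)%:R).
    exists (fun a => - (k a)%:R); rewrite -[LHS]opprK E -sumrN.
    by apply: eq_bigr => a _; rewrite scaleNr.
  have [d E] : exists d : 'cV[rat]_n -> rat, v = \sum_(a <- simples) d a *: a.
    case: HR => _ /(_ v) [e ->] _ _ _.
    suff H s : {subset s <= rts} -> exists d : 'cV[rat]_n -> rat,
        \sum_(a <- s) e a *: a = \sum_(a <- simples) d a *: a by exact: H.
    elim: s => [|r s IH] Hs.
      by exists (fun=> 0); rewrite big_nil big1 // => a _; rewrite scale0r.
    have [d E] : exists d : 'cV[rat]_n -> rat,
        \sum_(a <- s) e a *: a = \sum_(a <- simples) d a *: a.
      by apply: IH => a Ha; apply: Hs; rewrite inE Ha orbT.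
    have [d' E'] := spr r (Hs r (mem_head _ _)).
    exists (fun a => e r * d' a + d a); rewrite big_cons E E' scaler_sumr -big_split.
    by apply: eq_bigr => a _; rewrite scalerDl scalerA.
  by exists (fun i => d (nth 0 simples i)); rewrite E (big2 (fun i => d (nth 0 simples i))).
have Hm : m = n.
  have rf : row_free M.
    rewrite -kermx_eq0; apply/eqP/row_matrixP => i; rewrite row0.
    have /sub_kermxP : (row i (kermx M) <= kermx M)%MS by exact: row_sub.
    move=> E; apply/rowP => j; rewrite [RHS]mxE.
    apply: (ind (fun j => row i (kermx M) 0 j)); rewrite -sumE.
    by apply/eqP; rewrite -trmx0 (inj_eq trmx_inj) -E; apply/eqP; congr mulmx; apply/rowP => k; rewrite mxE.
  have rfu : row_full M.
    rewrite -sub1mx; apply/row_subP => i; have [c E] := sp (row i 1%:M)^T.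
    apply/submxP; exists (\row_i c i); apply: trmx_inj; rewrite sumE -E //.
  by move: rf rfu; rewrite /row_free /row_full => /eqP -> /eqP.
move: (esym Hm) => {}Hm.
exists (fun i => nth 0 simples i).
have ci (c : 'I_n -> rat) : \sum_i c i *: nth 0 simples i =
    \sum_(j < m) c (cast_ord (esym Hm) j) *: nth 0 simples j.
  by rewrite (reindex (cast_ord (esym Hm))) //=; exists (cast_ord Hm) => i _; rewrite (cast_ordK, cast_ordKV).
split.
- by move=> i; apply/simple_pos/mem_nth; rewrite -/m -Hm.
- move=> v; have [c E] := sp v; exists (fun i => c (cast_ord Hm i)).
  by rewrite ci E; apply: eq_bigr => i _; rewrite cast_ordKV.
- move=> c; rewrite ci => /ind H i; have := H (cast_ord Hm i); by rewrite cast_ordK.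
move=> r /pos_decomp [k ->]; exists (fun i => k (nth 0 simples i)).
rewrite (ci (fun i => (k (nth 0 simples i))%:R)) /=.
by rewrite (big2 (fun j => (k (nth 0 simples j))%:R)).
Qed.

End WithW0.
End RootSystem.

Lemma seq_argmax (T : eqType) (s : seq T) (F : T -> rat) :
  s != [::] -> exists2 x, x \in s & forall y, y \in s -> F y <= F x.
Proof.
elim: s => // a [|b s] IH _.
  by exists a; rewrite ?mem_head // => y; rewrite in_cons in_nil orbF => /eqP ->.
have [//|x Hx Hm] := IH _.
have [Hle|Hlt] := lerP (F a) (F x).
  by exists x; [rewrite in_cons Hx orbT | move=> y; rewrite in_cons => /orP [/eqP -> //|]; exact: Hm].
exists a; first exact: mem_head.
by move=> y; rewrite in_cons => /orP [/eqP -> //|] /Hm H; apply: le_trans H (ltW Hlt).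
Qed.

Record based (n : nat) (R : rootsys n) (f : 'rV[rat]_n) (W0s : seq 'M[rat]_n)
    (al : 'I_n -> 'cV[rat]_n) : Prop := Based {
  b_rs : is_root_system R;
  b_red : reduced_rs R;
  b_irr : irreducible_rs R;
  b_pos : positive_system R f;
  b_uniq : uniq W0s;
  b_W0 : forall w, (w \in W0s) <-> inW0 R w;
  b_base : is_base R f al }.

(** * Representations and density *)

Section Representations.
Variables (F : fieldType) (A : algType F).
Implicit Types (d : nat) (a b : A).

(* Left modules are written on row vectors, so products are reversed. *)
Definition is_rep d (r : A -> 'M[F]_d) : Prop :=
  [/\ r 1 = 1%:M, forall a b, r (a + b) = r a + r b, forall k a, r (k *: a) = k *: r a
    & forall a b, r (a * b) = r b *m r a].

Definition irred d (r : A -> 'M[F]_d) : Prop :=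
  (0 < d)%N /\ forall v x : 'rV[F]_d, v != 0 -> exists a, x = v *m r a.

Definition stable d (r : A -> 'M[F]_d) (U : 'M[F]_d) : Prop :=
  forall (x : 'rV[F]_d) a, (x <= U)%MS -> (x *m r a <= U)%MS.

Lemma max_measure (T : Type) (Q : T -> Prop) (m : T -> nat) (b : nat) t0 :
  Q t0 -> (forall t, Q t -> (m t <= b)%N) -> exists t, Q t /\ forall t', Q t' -> (m t' <= m t)%N.
Proof.
move=> H0 Hb; have [k] := ubnP (b - m t0); elim: k t0 H0 => // k IH t0 H0 Hk.
have [[t [Ht Hlt]]|Hno] := excluded_middle_informative (exists t, Q t /\ (m t0 < m t)%N).
  by apply: (IH t Ht); have := Hb _ Ht; lia.
exists t0; split=> // t Ht; rewrite leqNgt; apply/negP => Hlt; apply: Hno; by exists t.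
Qed.

(** The matrix is one of largest rank among those whose row space satisfies [P]. *)
Lemma subspace_mx d (P : 'rV[F]_d -> Prop) : P 0 -> (forall x y, P x -> P y -> P (x + y)) ->
  (forall k x, P x -> P (k *: x)) -> exists U : 'M[F]_d, forall x : 'rV[F]_d, P x <-> (x <= U)%MS.
Proof.
move=> P0 PD PZ.
have [|U|U [HU Hmax]] := @max_measure 'M[F]_d (fun U => forall x : 'rV_d, (x <= U)%MS -> P x)
   (fun U => \rank U) d 0.
- by move=> x; rewrite submx0 => /eqP ->.
- by move=> _; exact: rank_leq_row.
exists U => x; split; last exact: HU.
move=> Px; have H : (\rank (U + x)%MS <= \rank U)%N.
  rewrite -(genmxE (U + x)%MS); apply: Hmax => y; rewrite genmxE => /sub_addsmxP [[u1 u2] /= ->].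
  apply: PD; first by apply: HU; exact: submxMl.
  by rewrite [u2]mx11_scalar mul_scalar_mx; exact: PZ.
have E : (U :=: U + x)%MS by apply/eqmxP; rewrite -(geq_leqif (mxrank_leqif_eq (addsmxSl U x))).
by rewrite E addsmxSr.
Qed.

Section Rep.
Variables (d : nat) (r : A -> 'M[F]_d).
Hypothesis Hr : is_rep r.
Lemma rep1 : r 1 = 1%:M. Proof. by case: Hr. Qed.
Lemma repD a b : r (a + b) = r a + r b. Proof. by case: Hr. Qed.
Lemma repZ k a : r (k *: a) = k *: r a. Proof. by case: Hr. Qed.
Lemma repM a b : r (a * b) = r b *m r a. Proof. by case: Hr. Qed.
Lemma rep0 : r 0 = 0. Proof. by rewrite -(scale0r 1) repZ scale0r. Qed.
Lemma repB a b : r (a - b) = r a - r b.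
Proof. by rewrite repD -scaleN1r repZ scaleN1r. Qed.
Lemma rep_sum I (s : seq I) (g : I -> A) : r (\sum_(i <- s) g i) = \sum_(i <- s) r (g i).
Proof. by elim/big_rec2: _ => [|i x y _ <-]; rewrite ?rep0 ?repD. Qed.
Lemma rep_scal k : r k%:A = k%:M. Proof. by rewrite repZ rep1 scalemx1. Qed.
End Rep.

(* The simple module is (U0 + A v) / U with U maximal among the submodules containing U0 but not v. *)
Lemma simple_subquotient d (r : A -> 'M[F]_d) (U0 : 'M[F]_d) (v : 'rV[F]_d) :
  is_rep r -> stable r U0 -> ~~ (v <= U0)%MS ->
  exists d' (r' : A -> 'M[F]_d') (p : 'M[F]_(d, d')),
    [/\ is_rep r' /\ irred r', (d' + \rank U0 <= d)%N, v *m p != 0,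
        forall a, v *m r a *m p = v *m p *m r' a & forall x : 'rV[F]_d, (x <= U0)%MS -> x *m p = 0].
Proof.
move=> Hr S0 v0.
have [|U _|U [[SU UU vU] Umax]] := @max_measure 'M[F]_d
  (fun U => [/\ stable r U, (U0 <= U)%MS & ~~ (v <= U)%MS]) (fun U => \rank U) d U0.
- by split.
- exact: rank_leq_row.
have cyc (x : 'rV[F]_d) : exists S : 'M[F]_d, stable r S /\
    forall y : 'rV[F]_d, (y <= S)%MS <-> exists a (u : 'rV[F]_d), (u <= U)%MS /\ y = x *m r a + u.
  have [|y z [a [u [Hu ->]]] [b [w [Hw ->]]]|k y [a [u [Hu ->]]]|S HS] :=
    @subspace_mx d (fun y => exists a u, (u <= U)%MS /\ y = x *m r a + u).
  - by exists 0, 0; rewrite sub0mx (rep0 Hr) mulmx0 addr0.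
  - by exists (a + b), (u + w); rewrite addmx_sub // (repD Hr) mulmxDr addrACA.
  - by exists (k *: a), (k *: u); rewrite scalemx_sub // (repZ Hr) -scalemxAr scalerDr.
  exists S; split; last by move=> y; split=> [/HS|/HS].
  move=> y a /HS [b [u [Hu ->]]]; apply/HS; exists (a * b), (u *m r a).
  by rewrite (repM Hr) mulmxA mulmxDl; split=> //; exact: SU.
have [S [SS HS]] := cyc v.
pose K := cokermx U; pose B := row_base (S *m K).
have KP (x : 'rV[F]_d) : (x <= U)%MS = (x *m K == 0) by rewrite submxE.
have US : (U <= S)%MS.
  apply/row_subP => i; apply/HS; exists 0, (row i U).
  by rewrite row_sub (rep0 Hr) mulmx0 add0r.
have vS : (v <= S)%MS by apply/HS; exists 1, 0; rewrite sub0mx (rep1 Hr) mulmx1 addr0.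
have Bf : row_free B := row_base_free _.
pose D := B *m pinvmx (S *m K).
have DE : D *m S *m K = B by rewrite -mulmxA mulmxKpV // eq_row_base.
have xB (x : 'rV[F]_d) : (x <= S)%MS -> x *m K *m pinvmx B *m B = x *m K.
  by move=> xS; rewrite mulmxKpV // eq_row_base submxMr.
pose p := K *m pinvmx B; pose r' a := D *m S *m r a *m p.
have lift (y : 'rV[F]_(\rank (S *m K))) : exists2 x : 'rV[F]_d, (x <= S)%MS & y = x *m p.
  exists (y *m (D *m S)); first by rewrite mulmxA submxMl.
  by rewrite /p mulmxA -(mulmxA y) DE mulmxKp.
have kerp (x : 'rV[F]_d) : (x <= S)%MS -> x *m p = 0 -> (x <= U)%MS.
  by move=> xS H; rewrite KP -(xB _ xS) -(mulmxA x) H mul0mx.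
have Up (x : 'rV[F]_d) : (x <= U)%MS -> x *m p = 0.
  by rewrite KP => /eqP H; rewrite /p mulmxA H mul0mx.
have inter (x : 'rV[F]_d) a : (x <= S)%MS -> x *m r a *m p = x *m p *m r' a.
  move=> xS; rewrite /r' !mulmxA; apply/eqP; rewrite -subr_eq0 -!mulmxBl; apply/eqP/Up/SU.
  rewrite KP mulmxBl subr_eq0 -(mulmxA _ S) -(mulmxA _ D) (mulmxA D) DE.
  by rewrite /p mulmxA xB.
have Hr' : is_rep r'.
  split=> [|a b|k a|a b].
  - by rewrite /r' (rep1 Hr) mulmx1 /p mulmxA DE mulmxVp.
  - by rewrite /r' (repD Hr) mulmxDr mulmxDl.
  - by rewrite /r' (repZ Hr) -scalemxAr -scalemxAl.
  apply/row_matrixP => i; rewrite !rowE; have [x xS ->] := lift (delta_mx 0 i).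
  by rewrite mulmxA -!inter ?(repM Hr) ?mulmxA //; exact: SS.
have vp : v *m p != 0 by apply: contra vU => /eqP; exact: kerp.
exists _, r', p; split; first split=> //.
- split.
    rewrite lt0n mxrank_eq0; apply: contra vU => /eqP H.
    by have /submxP [x ->] := vS; rewrite KP -mulmxA H mulmx0.
  move=> y z; have [x xS ->] := lift y; have [x' x'S ->] := lift z => y0.
  have xU : ~~ (x <= U)%MS by apply: contra y0 => /Up ->.
  have [S' [SS' HS']] := cyc x.
  have US' : (U <= S')%MS.
    apply/row_subP => i; apply/HS'; exists 0, (row i U).
    by rewrite row_sub (rep0 Hr) mulmx0 add0r.
  have : (v <= S')%MS.
    apply/idPn => vS'; have := Umax S' (And3 SS' (submx_trans UU US') vS').
    rewrite leqNgt => /negP; apply; have : (U < S')%MS.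
      rewrite ltmxE US' /=; apply: contra xU => H; apply: submx_trans H.
      by apply/HS'; exists 1, 0; rewrite sub0mx (rep1 Hr) mulmx1 addr0.
    by rewrite ltmxErank => /andP [].
  move=> /HS' [a [u [uU Ev]]]; have /HS [b [w [wU Ex']]] := x'S.
  exists (b * a); rewrite -inter // Ex' Ev mulmxDl (Up _ wU) addr0 !mulmxDl.
  by rewrite (Up _ (SU _ _ uU)) addr0 (repM Hr) !mulmxA.
- apply: leq_trans (leq_add (mxrankM_maxr _ _) (mxrankS UU)) _.
  by rewrite mxrank_coker subnK // rank_leq_row.
- by [].
- by move=> a; exact: inter.
- by move=> x xU; apply: Up; exact: submx_trans UU.
Qed.

Section Weights.
Variables (I : finType) (th : I -> A).

Definition wvec d (r : A -> 'M[F]_d) (c : {ffun I -> F}) (v : 'rV[F]_d) : Prop :=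
  forall i, v *m r (th i) = c i *: v.

(** Lagrange interpolation: [a] is a product of factors (th i - c i) / (c0 i - c i), one for each
    [c] in [L] other than [c0]. It is chosen before any representation, so the same element can be
    evaluated in several modules at once. *)
Lemma weight_projector (L : seq {ffun I -> F}) (c0 : {ffun I -> F}) : exists a (g : {ffun I -> F} -> F),
  [/\ forall b, (forall i, th i * b = b * th i) -> a * b = b * a,
      forall d (r : A -> 'M[F]_d) c v, is_rep r -> wvec r c v -> v *m r a = g c *: v,
      g c0 = 1 & forall c, c \in L -> c != c0 -> g c = 0].
Proof.
elim: L => [|c L [a [g [Ha1 Ha2 g1 g0]]]].
  exists 1, (fun=> 1); split=> // [b _|d r c v Hr _]; first by rewrite mul1r mulr1.
  by rewrite (rep1 Hr) mulmx1 scale1r.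
have [Ec|Nc] := eqVneq c c0.
  exists a, g; split=> // c'; rewrite inE => /orP [/eqP -> /eqP //|]; exact: g0.
have [i Hi] : exists i, c i != c0 i.
  apply/existsP; rewrite -negb_forall; apply: contra Nc => /forallP H.
  by apply/eqP/ffunP => i; apply/eqP.
have U : c0 i - c i != 0 by rewrite subr_eq0 eq_sym.
exists (a * ((c0 i - c i)^-1 *: (th i - (c i)%:A))), (fun c' : {ffun I -> F} => (c0 i - c i)^-1 * (c' i - c i) * g c').
split.
- move=> b Hb; rewrite -mulrA -(scalerAl _ _ b) mulrBl Hb -scalerAl mul1r.
  rewrite [RHS]mulrA -(Ha1 b Hb) -[RHS]mulrA; congr (_ * _).
  by rewrite -scalerAr mulrBr -scalerAr mulr1.
- move=> d r c' v Hr Hv; rewrite (repM Hr) mulmxA (repZ Hr) (repB Hr) (rep_scal Hr).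
  rewrite -scalemxAr mulmxBr Hv mul_mx_scalar -scalerBl scalerA -scalemxAl (Ha2 _ _ _ _ Hr Hv).
  by rewrite scalerA.
- by rewrite g1 mulr1 mulVf.
move=> c'; rewrite inE => /orP [/eqP -> _|H1 H2]; first by rewrite subrr mulr0 mul0r.
by rewrite (g0 _ H1 H2) mulr0.
Qed.

Lemma weights_free d (r : A -> 'M[F]_d) (L : seq {ffun I -> F}) (V : {ffun I -> F} -> 'rV[F]_d) :
  is_rep r -> uniq L -> (forall c, c \in L -> V c != 0 /\ wvec r c (V c)) ->
  row_free (\matrix_(k < size L) V (nth [ffun=> 0] L k)).
Proof.
move=> Hr Lu HV; apply/inj_row_free => u Hu; apply/rowP => k; rewrite mxE.
set ck := nth [ffun=> 0] L k; have ckL : ck \in L by apply: mem_nth.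
have [a [g [_ Ha g1 g0]]] := weight_projector L ck.
move: Hu; rewrite mulmx_sum_row => /(congr1 (mulmx^~ (r a))); rewrite mul0mx mulmx_suml.
rewrite (bigD1 k) //= [X in _ + X]big1 ?addr0 => [|j Hj].
  have [V0 Vw] := HV _ ckL.
  rewrite rowK -scalemxAl (Ha _ _ _ _ Hr Vw) g1 scale1r => /eqP.
  by rewrite scaler_eq0 (negbTE V0) orbF => /eqP.
have jL : nth [ffun=> 0] L j \in L by apply: mem_nth.
rewrite rowK -scalemxAl (Ha _ _ _ _ Hr (proj2 (HV _ jL))) g0 ?scale0r ?scaler0 //.
by rewrite /ck nth_uniq.
Qed.

Lemma weights_leq d (r : A -> 'M[F]_d) (L : seq {ffun I -> F}) (V : {ffun I -> F} -> 'rV[F]_d) :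
  is_rep r -> uniq L -> (forall c, c \in L -> V c != 0 /\ wvec r c (V c)) -> (size L <= d)%N.
Proof.
by move=> Hr Lu HV; have := weights_free Hr Lu HV; rewrite /row_free => /eqP <-; exact: rank_leq_col.
Qed.
End Weights.

Lemma central_scalar d (r : A -> 'M[F]_d) (v : 'rV[F]_d) z k : is_rep r -> (forall x, exists a, x = v *m r a) ->
  (forall a, z * a = a * z) -> v *m r z = k *: v -> r z = k%:M.
Proof.
move=> Hr Hcyc Hz E; apply/row_matrixP => i; rewrite !rowE; have [a ->] := Hcyc (delta_mx 0 i).
by rewrite -mulmxA -(repM Hr) Hz (repM Hr) mulmxA E -scalemxAl mul_mx_scalar.
Qed.

(* A rank one element makes the image of any two-sided ideal containing it the full matrix algebra. *)
Lemma density d (r : A -> 'M[F]_d) (K : A -> Prop) e (c : 'cV[F]_d) (w : 'rV[F]_d) :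
  is_rep r -> irred r -> K 0 -> (forall a b, K a -> K b -> K (a + b)) ->
  (forall a b, K a -> K (b * a)) -> (forall a b, K a -> K (a * b)) ->
  K e -> r e = c *m w -> c *m w != 0 -> forall X, exists2 a, K a & r a = X.
Proof.
move=> Hr [d0 Hirr] K0 KD KL KR Ke Ee cw0.
have w0 : w != 0 by apply: contra cw0 => /eqP ->; rewrite mulmx0.
have c0 : c != 0 by apply: contra cw0 => /eqP ->; rewrite mul0mx.
have [|x y [a ->] [b ->]|k x [a ->]|U HU] := @subspace_mx d (fun x => exists a, x = (r a *m c)^T).
- by exists 0; rewrite (rep0 Hr) mul0mx trmx0.
- by exists (a + b); rewrite (repD Hr) mulmxDl linearD.
- by exists (k *: a); rewrite (repZ Hr) -scalemxAl linearZ.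
(* A nonzero row orthogonal to all the columns [r a *m c] generates every coordinate row, so all
   coordinates of [c] would vanish. *)
have Ufull : row_full U.
  apply/idPn => H.
  have /rowV0Pn [y /sub_kermxP yU y0] : kermx U^T != 0 by rewrite kermx_eq0 /row_free mxrank_tr.
  move/eqP: c0; apply; apply/row_matrixP => i; rewrite row0 rowE.
  have [a ->] := Hirr y (delta_mx 0 i) y0.
  have /submxP [x Ex] : ((r a *m c)^T <= U)%MS by apply/HU; exists a.
  by apply: trmx_inj; rewrite -mulmxA trmx_mul Ex trmx0 -mulmxA -[U in _ *m (U *m _)]trmxK -trmx_mul yU trmx0 mulmx0.
move=> X.
have colP (x : 'cV[F]_d) : exists a, r a *m c = x.
  have /HU [a Ea] : (x^T <= U)%MS by apply: submx_full.
  by exists a; apply: trmx_inj; rewrite Ea.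
have -> : X = \sum_i delta_mx i 0 *m row i X.
  apply/matrixP => i j; rewrite summxE (bigD1 i) //= big1 => [|k Hk].
    by rewrite addr0 mxE big_ord1 !mxE !eqxx mul1r.
  by rewrite mxE big_ord1 !mxE eq_sym (negbTE Hk) mul0r.
elim/big_rec: _ => [|i Y _ [a Ka <-]]; first by exists 0; rewrite ?(rep0 Hr).
have [a1 <-] := colP (delta_mx i 0); have [b1 ->] := Hirr w (row i X) w0.
exists (b1 * e * a1 + a); first by apply: KD => //; apply/KR/KL.
by rewrite (repD Hr) !(repM Hr) Ee !mulmxA.
Qed.

(** Besides eigenvectors, operators with image in a line pass to the subquotient: [r' a] has rank at
    most one, and when it is nonzero its image carries the weight of the line. This provides the
    rank one element for [density] and decides which simple subquotient contains which weight. *)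
Lemma simple_quotient d (r : A -> 'M[F]_d) (U0 : 'M[F]_d) (v : 'rV[F]_d) :
  is_rep r -> stable r U0 -> ~~ (v <= U0)%MS ->
  exists d' (r' : A -> 'M[F]_d') (v' : 'rV[F]_d'),
    [/\ is_rep r' /\ irred r', (d' + \rank U0 <= d)%N, v' != 0,
        forall a l, (v *m r a - l *: v <= U0)%MS -> v' *m r' a = l *: v'
      & forall a (u : 'rV[F]_d), (forall x : 'rV[F]_d, exists k, x *m r a = k *: u) ->
        (exists (c : 'cV[F]_d') (w : 'rV[F]_d'), r' a = c *m w) /\
        forall (I : finType) (th : I -> A) t, wvec th r t u -> r' a != 0 ->
          exists2 y : 'rV[F]_d', y != 0 & wvec th r' t y].
Proof.
move=> Hr HU Hv; have [d' [r' [p [[Hr' Ir'] Hd v0 Hi HU0]]]] := simple_subquotient Hr HU Hv.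
exists d', r', (v *m p); split=> //.
  move=> a l H; rewrite -Hi; apply/eqP; rewrite -subr_eq0 scalemxAl -mulmxBl; apply/eqP; exact: HU0.
move=> a u Hu; have Hb i : exists b, delta_mx 0 i = v *m p *m r' b by exact: (proj2 Ir').
have row_a b : v *m p *m r' b *m r' a = v *m r b *m r a *m p.
  by rewrite -mulmxA -(repM Hr') -Hi (repM Hr) !mulmxA.
split.
  have Hk i : exists k, delta_mx 0 i *m r' a = k *: (u *m p).
    by have [b ->] := Hb i; have [k E] := Hu (v *m r b); exists k; rewrite row_a E scalemxAl.
  pose k i := sval (constructive_indefinite_description _ (Hk i)).
  have kP i : delta_mx 0 i *m r' a = k i *: (u *m p) by rewrite /k; case: constructive_indefinite_description.
  exists (\col_i k i), (u *m p); apply/row_matrixP => i.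
  by rewrite [LHS]rowE kP row_mul [row i _]mx11_scalar mul_scalar_mx !mxE.
move=> I th t Ht ra; have [i ri] : exists i, row i (r' a) != 0.
  apply/existsP; rewrite -negb_forall; apply: contra ra => /forallP H.
  by apply/eqP/row_matrixP => i; rewrite row0; apply/eqP.
exists (row i (r' a)) => // j; rewrite rowE; have [b ->] := Hb i; have [k E] := Hu (v *m r b).
have E' : v *m p *m r' b *m r' a *m r' (th j) = v *m r b *m r a *m r (th j) *m p.
  by rewrite -!mulmxA -!(repM Hr') mulmxA -Hi !(repM Hr) !mulmxA.
by rewrite E' row_a E -!scalemxAl (Ht j) -scalemxAl !scalerA mulrC.
Qed.

Lemma spanned_leq m (I : finType) (g : I -> 'rV[F]_m) :
  (forall x : 'rV[F]_m, exists u : I -> F, x = \sum_i u i *: g i) -> (m <= #|I|)%N.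
Proof.
move=> H; have E : row_full (\matrix_(i < #|I|) g (enum_val i)).
  rewrite -sub1mx; apply/row_subP => j; have [u ->] := H (row j 1%:M).
  apply: summx_sub => i _; apply: scalemx_sub.
  by rewrite -[g i](_ : row (enum_rank i) (\matrix_(i < #|I|) g (enum_val i)) = _) ?row_sub // rowK enum_rankK.
by move: E; rewrite /row_full => /eqP <-; exact: rank_leq_row.
Qed.
End Representations.

(** * Complex numbers *)

Definition to_complex (z : cplx) : complex Rdefinitions.R := Complex (Defs.Re z) (Defs.Im z).
Lemma to_complex_zmod : zmod_morphism to_complex.
Proof. by move=> [a b] [c d]; apply/eqP; rewrite eq_complex /=; apply/andP; split; apply/eqP. Qed.
HB.instance Definition _ := GRing.isZmodMorphism.Build _ _ to_complex to_complex_zmod.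
Lemma to_complex_monoid : monoid_morphism to_complex.
Proof. by split=> // -[a b] [c d]. Qed.
HB.instance Definition _ := GRing.isMonoidMorphism.Build _ _ to_complex to_complex_monoid.

Lemma cplx_root (p : {poly cplx}) : size p != 1%N -> exists x, root p x.
Proof.
move=> sp; have /closed_rootP [z] : size (map_poly to_complex p) != 1%N by rewrite size_map_poly.
have -> : z = to_complex (Cplx (complex.Re z) (complex.Im z)) by case: z.
rewrite fmorph_root => H; by exists (Cplx (complex.Re z) (complex.Im z)).
Qed.

Definition invertible (A : algType cplx) (a : A) : Prop := exists b, a * b = 1 /\ b * a = 1.

Section Invertible.
Variable A : algType cplx.
Implicit Types a b : A.
Lemma invertible1 : invertible (1 : A). Proof. by exists 1; rewrite mulr1. Qed.
Lemma invertibleM a b : invertible a -> invertible b -> invertible (a * b).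
Proof.
move=> [a' [H1 H2]] [b' [H3 H4]]; exists (b' * a'); split.
  by rewrite mulrA -(mulrA a) H3 mulr1.
by rewrite mulrA -(mulrA b') H2 mulr1.
Qed.
Lemma invertible_factor a b : invertible (a * b) -> a * b = b * a -> invertible a.
Proof.
move=> [c [H1 H2]] Hc; exists (b * c); rewrite mulrA H1; split=> //.
have E : c * b = b * c.
  by rewrite -[LHS]mulr1 -H1 !mulrA -(mulrA c b a) -Hc H2 mul1r.
by rewrite -E -mulrA -Hc H2.
Qed.
Lemma invertible_linv a b c : a * b = 1 -> c * a = 1 -> b = c.
Proof. by move=> H1 H2; rewrite -[b]mul1r -H2 -mulrA H1 mulr1. Qed.
End Invertible.

Section LinearExtension.
Variables (V U : lmodType cplx) (I : Type) (T : I -> V).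

Lemma eq_big_In (W : lmodType cplx) (s : seq I) (F G : I -> W) :
  (forall i, List.In i s -> F i = G i) -> \sum_(i <- s) F i = \sum_(i <- s) G i.
Proof.
elim: s => [|i s IH] H; first by rewrite !big_nil.
by rewrite !big_cons H ?IH //; [move=> j Hj; apply: H; right|left].
Qed.

(** [is_basis] only speaks of families without repetition. Equal indices are collected uniformly in
    [W] and [h], so that one and the same collection applies to the basis vectors and to their
    prescribed images. *)
Lemma collect_terms (l : seq (cplx * I)) : exists (s : seq I) (c : I -> cplx), List.NoDup s /\
  forall (W : lmodType cplx) (h : I -> W), \sum_(p <- l) p.1 *: h p.2 = \sum_(i <- s) c i *: h i.
Proof.
elim: l => [|[k i] l [s [c [Hs E]]]].
  by exists [::], (fun=> 0); split=> [|W h]; [constructor | rewrite !big_nil].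
pose c' j := (if excluded_middle_informative (j = i) then k else 0) + c j.
have [His|His] := excluded_middle_informative (List.In i s); last first.
  pose c0 j := if excluded_middle_informative (j = i) then k else c j.
  have c0i : c0 i = k by rewrite /c0; case: excluded_middle_informative.
  exists (i :: s), c0; split=> [|W h]; first by constructor.
  rewrite !big_cons E c0i /=; congr (_ + _); apply: eq_big_In => j Hj; rewrite /c0.
  by case: excluded_middle_informative => // Ej; case: His; rewrite -Ej.
have ci : c' i = k + c i by rewrite /c'; case: excluded_middle_informative.
exists s, c'; split=> // W h; rewrite big_cons E /=.
have [s1 [s2 Es]] := List.in_split _ _ His; rewrite Es in Hs *.
have Hn := List.NoDup_remove_2 _ _ _ Hs.
have Eq t : (forall j, List.In j t -> List.In j (s1 ++ s2)) ->
    \sum_(j <- t) c' j *: h j = \sum_(j <- t) c j *: h j.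
  move=> Ht; apply: eq_big_In => j /Ht Hj; rewrite /c'.
  destruct (excluded_middle_informative (j = i)) as [Ej|]; last by rewrite add0r.
  by exfalso; apply: Hn; rewrite -Ej.
rewrite !big_cat !big_cons /= !Eq; last 2 first.
- by move=> j Hj; apply: List.in_or_app; right.
- by move=> j Hj; apply: List.in_or_app; left.
by rewrite ci scalerDl -(addrA (k *: h i)) addrCA [RHS]addrCA; congr (_ + _); rewrite addrCA.
Qed.

Lemma linear_extension (g : I -> U) : is_basis T -> exists h : V -> U,
  [/\ forall x y, h (x + y) = h x + h y, forall k x, h (k *: x) = k *: h x & forall i, h (T i) = g i].
Proof.
move=> [free sp].
have key (l : seq (cplx * I)) : \sum_(p <- l) p.1 *: T p.2 = 0 -> \sum_(p <- l) p.1 *: g p.2 = 0.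
  have [s [c [Hs E]]] := collect_terms l; rewrite !E => H0.
  rewrite (@eq_big_In _ s (fun i => c i *: g i) (fun=> 0)) ?big1 // => i Hi.
  by rewrite (free _ _ Hs H0 i Hi) scale0r.
have ex x : exists l : seq (cplx * I), x = \sum_(p <- l) p.1 *: T p.2.
  have [s [c ->]] := sp x; exists [seq (c i, i) | i <- s]; by rewrite big_map.
pose l x := sval (constructive_indefinite_description _ (ex x)).
have lE x : x = \sum_(p <- l x) p.1 *: T p.2 by rewrite /l; case: constructive_indefinite_description.
pose h x := \sum_(p <- l x) p.1 *: g p.2.
have hE m x : x = \sum_(p <- m) p.1 *: T p.2 -> h x = \sum_(p <- m) p.1 *: g p.2.
  move=> Ex; apply/eqP; rewrite -subr_eq0; apply/eqP.
  have := @key (l x ++ [seq (- p.1, p.2) | p <- m]); rewrite !big_cat !big_map /= -lE {1}Ex.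
  have neg (W : lmodType cplx) (f : I -> W) : \sum_(p <- m) - p.1 *: f p.2 = - \sum_(p <- m) p.1 *: f p.2.
    by rewrite -sumrN; apply: eq_bigr => p _; rewrite scaleNr.
  by rewrite !neg subrr => ->.
exists h; split.
- by move=> x y; rewrite (hE (l x ++ l y)) big_cat -?lE.
- move=> k x; rewrite (hE [seq (k * p.1, p.2) | p <- l x]) big_map /=.
    by rewrite scaler_sumr; apply: eq_bigr => p _; rewrite scalerA.
  by rewrite {1}(lE x) scaler_sumr; apply: eq_bigr => p _; rewrite scalerA.
by move=> i; rewrite (hE [:: (1, i)]) big_seq1 scale1r.
Qed.
End LinearExtension.

(** A character of the weight lattice, that is, a point of the complex torus with character lattice
    [X]; values off [X] are unconstrained. *)
Definition tchar (n : nat) (R : rootsys n) (g : 'cV[rat]_n -> cplx) : Prop :=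
  (forall x y, inX R x -> inX R y -> g (x + y) = g x * g y) /\ forall x, inX R x -> g x != 0.

Lemma Re_natr (k : nat) : Defs.Re (k%:R : cplx) = Raxioms.INR k.
Proof.
elim: k => // k IH; rewrite mulrSr RIneq.S_INR -IH; reflexivity.
Qed.
Lemma cplx_natr_inj (k l : nat) : k%:R = l%:R :> cplx -> k = l.
Proof. by move=> /(congr1 Defs.Re); rewrite !Re_natr => /RIneq.INR_eq. Qed.
Lemma cplx_natr_neq0 k : k.+1%:R != 0 :> cplx.
Proof. by apply/eqP => /(@cplx_natr_inj k.+1 0). Qed.

Lemma poly_natr_neq0 (p : {poly cplx}) : p != 0 -> exists k : nat, p.[k.+1%:R] != 0.
Proof.
move=> p0; apply: Classical_Prop.NNPP => Hno.
have Hr : all (root p) [seq (k.+1%:R : cplx) | k <- iota 0 (size p)].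
  apply/allP => x /mapP [k _ ->]; apply/rootP/eqP; apply: contraT => Hk; by case: Hno; exists k.
have Hu : uniq [seq (k.+1%:R : cplx) | k <- iota 0 (size p)].
  by rewrite map_inj_uniq ?iota_uniq // => k l /cplx_natr_inj [].
by have := max_poly_roots p0 Hr Hu; rewrite size_map size_iota ltnn.
Qed.

Lemma binomial_poly_neq0 (a b : cplx) m : a != 0 -> (0 < m)%N -> a *: 'X^m - b%:P != 0.
Proof.
move=> a0 m0; apply: contra a0 => /eqP /(congr1 (fun p : {poly cplx} => p`_m)) /eqP.
by rewrite coefB coefZ coefXn coefC eqxx mulr1 coef0 gtn_eqF // subr0.
Qed.

(** Pairings are rational numbers that happen to be integers; [numq] reads off the integer. *)
Definition zexp (s : cplx) (r : rat) : cplx := s ^ numq r.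
Lemma zexp_int s z : zexp s z%:~R = s ^ z. Proof. by rewrite /zexp numq_int. Qed.
Lemma zexpD s a b : s != 0 -> is_int a -> is_int b -> zexp s (a + b) = zexp s a * zexp s b.
Proof. by move=> s0 [z ->] [z' ->]; rewrite -rmorphD !zexp_int expfzDr. Qed.
Lemma zexp_neq0 s a : s != 0 -> zexp s a != 0. Proof. exact: expfz_neq0. Qed.
Lemma zexp_nat s (k : nat) : zexp s k%:R = s ^+ k.
Proof. by rewrite -[k%:R]/(k%:~R) zexp_int. Qed.
Lemma zexp1 a : zexp 1 a = 1. Proof. by rewrite /zexp exp1rz. Qed.

Lemma mx_eigenvector d (M : 'M[cplx]_d) : (0 < d)%N -> exists k (v : 'rV[cplx]_d), v != 0 /\ v *m M = k *: v.
Proof.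
move=> d0; have [|k] := @cplx_root (char_poly M).
  by rewrite size_char_poly; case: d M d0.
by rewrite -eigenvalue_root_char => /eigenvalueP [v Hv v0]; exists k, v.
Qed.

Lemma common_eigenvector d (I : eqType) (M : I -> 'M[cplx]_d) (s : seq I) : (0 < d)%N ->
  (forall i j, M i *m M j = M j *m M i) ->
  exists (k : I -> cplx) (v : 'rV[cplx]_d), v != 0 /\ forall i, i \in s -> v *m M i = k i *: v.
Proof.
move=> d0 HM; elim: s => [|j s [k [v [v0 Hv]]]].
  by exists (fun=> 0), (delta_mx 0 (Ordinal d0)); split=> //; apply/eqP => /rowP /(_ (Ordinal d0)) /eqP; rewrite !mxE !eqxx oner_eq0.
have [|x y Hx Hy i Hi|a x Hx i Hi|U HU] := @subspace_mx _ d (fun x => forall i, i \in s -> x *m M i = k i *: x).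
- by move=> i _; rewrite mul0mx scaler0.
- by rewrite mulmxDl Hx // Hy // scalerDr.
- by rewrite -scalemxAl Hx // !scalerA mulrC.
pose B := row_base U; have BU : (B :=: U)%MS by exact: eq_row_base.
have BM : (B *m M j <= B)%MS.
  apply/row_subP => l; rewrite row_mul BU; apply/HU => i Hi.
  have /HU H : (row l B <= U)%MS by rewrite -BU row_sub.
  by rewrite -mulmxA -HM mulmxA H // scalemxAl.
have [|l [w [w0 Hw]]] := @mx_eigenvector _ (B *m M j *m pinvmx B).
  rewrite lt0n mxrank_eq0; apply: contra v0 => /eqP U0; rewrite -submx0 -U0.
  exact/HU.
exists (fun i => if i == j then l else k i), (w *m B); split=> [|i].
  by rewrite mulmx_free_eq0 // row_base_free.
rewrite inE; case: eqP => [-> _|_ /= Hi].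
  by rewrite -mulmxA -(mulmxKpV BM) mulmxA Hw scalemxAl.
have /HU -> // : (w *m B <= U)%MS by rewrite -BU submxMl.
Qed.

(** Each condition is the nonvanishing at [s] of a nonzero binomial, after clearing a negative
    exponent. The product of these polynomials is nonzero at some positive integer. *)
Lemma generic_power (l : seq (cplx * cplx * rat)) :
  (forall p, p \in l -> [/\ p.1.1 != 0, p.1.2 != 0, is_int p.2 & p.2 != 0]) ->
  exists s : cplx, s != 0 /\ forall p, p \in l -> p.1.1 * zexp s p.2 != p.1.2.
Proof.
move=> Hl.
pose P (p : cplx * cplx * rat) : {poly cplx} := if 0 < p.2 then p.1.1 *: 'X^(`|numq p.2|%N) - p.1.2%:P
  else p.1.2 *: 'X^(`|numq p.2|%N) - p.1.1%:P.
have P0 : \prod_(p <- l) P p != 0.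
  rewrite prodf_seq_neq0; apply/allP => p Hp; have [a0 b0 [m Em] z0] := Hl _ Hp; apply/implyP => _.
  have m0 : (0 < `|m|)%N by move: z0; rewrite Em intr_eq0; lia.
  by rewrite /P Em numq_int; case: ifP => _; apply: binomial_poly_neq0.
have [k] := poly_natr_neq0 P0; set s := _%:R; rewrite horner_prod prodf_seq_neq0 => /allP Hs.
have s0 : s != 0 by exact: cplx_natr_neq0.
exists s; split=> // p Hp; have [a0 b0 [m Em] z0] := Hl _ Hp.
have := Hs _ Hp; rewrite /= /P Em zexp_int numq_int ltr0z.
case: ltrP => Hm; rewrite hornerD hornerN hornerC hornerZ hornerXn subr_eq0; apply: contra => /eqP E.
  by rewrite -E; apply/eqP; congr (_ * _); rewrite -{2}(gtz0_abs Hm).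
have -> : p.1.1 = p.1.2 * s ^+ `|m|.
  rewrite -E -mulrA; have -> : m = - (`|m|%N : int) by lia.
  by rewrite -exprnN abszN mulVf ?mulr1 // expf_neq0.
by [].
Qed.

(** The numerical end of the case of a simple edge: (4D)^2 <= 6 D^2 is absurd, and so is (2D)^2 +
    (2D)^2 <= 6 D^2 in [pair_count]. *)
Lemma single_count (d D N O : nat) : (0 < D)%N -> (2 * D + 2 * D <= d)%N -> (N <= D * 6)%N -> (O <= D)%N ->
  (d * d <= N * O)%N -> False.
Proof.
move=> D0 Hd HN HO H; have := leq_trans (leq_mul Hd Hd) (leq_trans H (leq_mul HN HO)); clear Hd HN HO H; nia.
Qed.
Lemma pair_count (d2 d3 D N O : nat) : (0 < D)%N -> (2 * D <= d2)%N -> (2 * D <= d3)%N -> (N <= D * 6)%N -> (O <= D)%N ->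
  (d2 * d2 + d3 * d3 <= N * O)%N -> False.
Proof.
move=> D0 H2 H3 HN HO H.
have := leq_trans (leq_add (leq_mul H2 H2) (leq_mul H3 H3)) (leq_trans H (leq_mul HN HO)); clear H2 H3 HN HO H; nia.
Qed.

Section Elements.
Variables (n : nat) (R : rootsys n) (A : algType cplx) (T : Wel R -> A).
(** The member of the family indexed by [w x]. The value 0 outside W keeps membership proofs out of
    the formulas. *)
Definition elt (w : 'M[rat]_n) (x : 'cV[rat]_n) : A :=
  match excluded_middle_informative (inW0 R w /\ inX R x) with
  | left h => T (exist _ (w, x) h) | right _ => 0 end.

Lemma elt_E (a : Wel R) : T a = elt (Wlin a) (Wtr a).
Proof.
case: a => -[w x] H; rewrite /elt /Wlin /Wtr /=.
case: excluded_middle_informative => [H'|[]//]; congr T; congr exist; exact: proof_irrelevance.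
Qed.
Lemma elt_ex w x : inW0 R w -> inX R x -> exists a : Wel R, [/\ Wlin a = w, Wtr a = x & elt w x = T a].
Proof.
move=> Hw Hx; exists (exist _ (w, x) (conj Hw Hx)); split=> //.
by rewrite elt_E.
Qed.
End Elements.

(** * The finite Weyl group and lengths *)

Section AffineHeckeAlgebra.
Variables (n : nat) (R : rootsys n) (f : 'rV[rat]_n) (W0s : seq 'M[rat]_n).
Variable al : 'I_n -> 'cV[rat]_n.
Hypothesis D : based R f W0s al.
Local Notation rts := (Defs.roots R).
Local Notation pos := (pos R f).
Local Notation pr x a := (pairing x (coroot R a)).
Local Notation form := (form W0s).
Let HR := b_rs D.
Let Hred := b_red D.
Let Hpos := b_pos D.
Let W0u := b_uniq D.
Let W0P := b_W0 D.

Definition sr (i : 'I_n) : 'M[rat]_n := refl_mx R (al i).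

Lemma al_pos i : al i \in pos. Proof. by case: (b_base D). Qed.
Lemma al_root i : al i \in rts. Proof. exact/pos_rts/al_pos. Qed.
Lemma W0_sr i : inW0 R (sr i). Proof. exact/W0_refl/al_root. Qed.
Lemma srE i x : sr i *m x = x - pr x (al i) *: al i. Proof. exact: reflE. Qed.
Lemma sr_al i : sr i *m al i = - al i.
Proof. by rewrite srE (pr_self HR) ?al_root // scaler_nat mulr2n opprD addrA subrr add0r. Qed.
Lemma srK i : sr i *m sr i = 1%:M. Proof. exact/(reflK HR)/al_root. Qed.
Lemma srKl i (w : 'M[rat]_n) : sr i *m (sr i *m w) = w. Proof. by rewrite mulmxA srK mul1mx. Qed.
Lemma srKr i (w : 'M[rat]_n) : (w *m sr i) *m sr i = w. Proof. by rewrite -mulmxA srK mulmx1. Qed.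
Lemma srKv i (x : 'cV[rat]_n) : sr i *m (sr i *m x) = x. Proof. by rewrite mulmxA srK mul1mx. Qed.
Lemma invmx_sr i : invmx (sr i) = sr i.
Proof. by have U := W0_unit HR (W0_sr i); rewrite -[RHS](mulKmx U) srK mulmx1. Qed.
Lemma invmxM (w w' : 'M[rat]_n) : inW0 R w -> inW0 R w' -> invmx (w *m w') = invmx w' *m invmx w.
Proof.
move=> Hw Hw'; have U := W0_unit HR Hw; have U' := W0_unit HR Hw'.
have UU : w *m w' \in unitmx by rewrite unitmx_mul U.
by rewrite -[RHS](mulmxK UU) (mulmxA _ w w') -(mulmxA _ _ w) mulVmx // mulmx1 mulVmx // mul1mx.
Qed.

(** * Coordinates in the simple roots and generation of W0 by simple reflections *)

Definition Amx : 'M[rat]_n := \matrix_(i, j) al j i 0.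
Definition co (i : 'I_n) (v : 'cV[rat]_n) : rat := (invmx Amx *m v) i 0.

Lemma AmxE (c : 'cV[rat]_n) : Amx *m c = \sum_i c i 0 *: al i.
Proof.
apply/colP => j; rewrite mxE summxE; apply: eq_bigr => i _; by rewrite !mxE mulrC.
Qed.
Lemma Amx_unit : Amx \in unitmx.
Proof.
rewrite -unitmx_tr -row_free_unit -kermx_eq0; apply/eqP/row_matrixP => i; rewrite row0.
have /sub_kermxP E : (row i (kermx Amx^T) <= kermx Amx^T)%MS by exact: row_sub.
case: (b_base D) => _ _ Hi _; apply/rowP => j; rewrite [RHS]mxE.
have := Hi (fun j => row i (kermx Amx^T) 0 j); apply.
have := congr1 trmx E; rewrite trmx_mul trmxK trmx0 AmxE => E2; rewrite -[RHS]E2.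
by apply: eq_bigr => k _; rewrite [in RHS]mxE.
Qed.
Lemma coE v : v = \sum_i co i v *: al i.
Proof. by rewrite -AmxE mulKVmx // Amx_unit. Qed.
Lemma coD i x y : co i (x + y) = co i x + co i y. Proof. by rewrite /co mulmxDr mxE. Qed.
Lemma coZ i k x : co i (k *: x) = k * co i x. Proof. by rewrite /co -scalemxAr mxE. Qed.
Lemma coN i x : co i (- x) = - co i x. Proof. by rewrite -scaleN1r coZ mulN1r. Qed.
Lemma coB i x y : co i (x - y) = co i x - co i y. Proof. by rewrite coD coN. Qed.
Lemma co0 i : co i 0 = 0. Proof. by rewrite /co mulmx0 mxE. Qed.
Lemma co_al i j : co i (al j) = (i == j)%:R.
Proof.
have -> : al j = Amx *m delta_mx j 0 by rewrite -colE; apply/colP => k; rewrite !mxE.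
by rewrite /co mulKmx ?Amx_unit // !mxE eqxx andbT.
Qed.
Lemma co_sum i (c : 'I_n -> rat) : co i (\sum_j c j *: al j) = c i.
Proof.
rewrite (big_morph (co i) (coD i) (co0 i)) (bigD1 i) //= coZ co_al eqxx mulr1 big1 ?addr0 //.
by move=> j Hj; rewrite coZ co_al eq_sym (negbTE Hj) mulr0.
Qed.
Lemma co_inj x y : (forall i, co i x = co i y) -> x = y.
Proof. by move=> H; rewrite (coE x) (coE y); apply: eq_bigr => i _; rewrite H. Qed.

Lemma pos_co r i : r \in pos -> exists k : nat, co i r = k%:R.
Proof. by case: (b_base D) => _ _ _ H /H [k ->]; exists (k i); rewrite co_sum. Qed.
Lemma pos_co_ge0 r i : r \in pos -> 0 <= co i r.
Proof. by move=> /(pos_co i) [k ->]; rewrite ler0n. Qed.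
Lemma co_gt0_pos r i : r \in rts -> 0 < co i r -> r \in pos.
Proof.
move=> Hr Hc; case: (pos_or HR Hpos Hr) => // /(pos_co_ge0 i).
by rewrite coN oppr_ge0 leNgt Hc.
Qed.
Lemma pos_comb2 r (a b : 'cV[rat]_n) k l : r \in rts -> a \in pos -> b \in pos ->
  0 <= k -> 0 <= l -> r = k *: a + l *: b -> r \in pos.
Proof.
move=> Hr Ha Hb Hk Hl E; rewrite posP // E lt_def; apply/andP; split.
  by rewrite -E; exact: Hpos.
by rewrite pairingD !pairingZ addr_ge0 // mulr_ge0 // ltW //; [exact: pos_gt0 Ha | exact: pos_gt0 Hb].
Qed.

(** The reflection changes only the coordinate at [al i], and since the system is reduced, [r] has a
    positive coordinate elsewhere. *)
Lemma sr_pos i r : r \in pos -> r != al i -> sr i *m r \in pos.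
Proof.
move=> Hr Hne; have Rr := pos_rts Hr.
have Rs : sr i *m r \in rts by apply: (W0_root HR) => //; exact: W0_sr.
have [j Hj Hc] : exists2 j, j != i & 0 < co j r.
  apply: Classical_Prop.NNPP => Hno.
  have E : r = co i r *: al i.
    rewrite {1}(coE r) (bigD1 i) //= big1 ?addr0 // => j Hj.
    suff -> : co j r = 0 by rewrite scale0r.
    apply/eqP; rewrite eq_le pos_co_ge0 // andbT leNgt; apply/negP => Hc.
    by apply: Hno; exists j.
  case: (root_prop Hred Rr (al_root i) E) => E'; first by rewrite E' eqxx in Hne.
  by have := pos_nopp HR Hpos (al_pos i); rewrite -E' Hr.
apply: (@co_gt0_pos _ j) => //.
by rewrite srE coB coZ co_al (negbTE Hj) mulr0 subr0.
Qed.

Definition ht (r : 'cV[rat]_n) : rat := \sum_i co i r.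
Lemma ht_sr i r : ht (sr i *m r) = ht r - pr r (al i).
Proof.
have E1 : \sum_(j < n) (j == i)%:R = 1 :> rat.
  by rewrite (bigD1 i) //= eqxx big1 ?addr0 // => j /negbTE ->.
rewrite /ht -[X in _ - X]mulr1 -E1 mulr_sumr -sumrB; apply: eq_bigr => j _.
by rewrite srE coB coZ co_al.
Qed.

Definition gen (w : 'M[rat]_n) : Prop :=
  exists s : seq 'I_n, w = foldr (fun i m => sr i *m m) 1%:M s.

Lemma gen_W0 w : gen w -> inW0 R w.
Proof.
case=> s ->; elim: s => [|i s IH] /=; first exact: W0_1.
by apply: W0_mul => //; exact: W0_sr.
Qed.
Lemma gen_sr i : gen (sr i).
Proof. by exists [:: i]; rewrite /= mulmx1. Qed.
Lemma genM w w' : gen w -> gen w' -> gen (w *m w').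
Proof.
move=> [s ->] [s' ->]; exists (s ++ s'); elim: s => [|i s IH] /=; first by rewrite mul1mx.
by rewrite -mulmxA IH.
Qed.
Lemma genV w : gen w -> gen (invmx w).
Proof.
case=> s ->; elim: s => [|i s IH] /=; first by rewrite invmx1; exists [::].
have Hg : inW0 R (foldr (fun i m => sr i *m m) 1%:M s) by apply: gen_W0; exists s.
by rewrite (invmxM (W0_sr i) Hg) invmx_sr; apply: genM => //; exact: gen_sr.
Qed.

Lemma pos_pr_gt0 r : r \in pos -> exists i, 0 < pr r (al i).
Proof.
move=> Hr; apply: Classical_Prop.NNPP => Hno.
have := form_root_gt0 HR W0P (pos_rts Hr); rewrite ltNge => /negP; apply.
rewrite {2}(coE r) form_sumr; apply: sumr_le0 => i _.
rewrite formZr; apply: mulr_ge0_le0; first exact: pos_co_ge0.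
rewrite leNgt; apply/negP => Hf; apply: Hno; exists i.
rewrite (pr_formE HR W0u W0P) ?al_root // formC.
by rewrite divr_gt0 ?mulr_gt0 // (form_root_gt0 HR W0P) // al_root.
Qed.

(** Some simple coroot is positive on [r]; reflecting in it lowers the height and keeps the root
    positive, unless [r] is that simple root. *)
Lemma pos_conj r : r \in pos -> exists w i, gen w /\ r = w *m al i.
Proof.
have [m] := ubnP (count (fun b => ht b < ht r) pos).
elim: m r => // m IH r; rewrite ltnS => Hm Hr.
have [i Hi] := pos_pr_gt0 Hr.
have [->|Hne] := eqVneq r (al i).
  by exists 1%:M, i; rewrite mul1mx; split => //; exists [::].
have Hs := sr_pos Hr Hne.
have Hlt : ht (sr i *m r) < ht r by rewrite ht_sr; lra.
have [|w [j [Hw E]]] := IH _ _ Hs.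
  apply: leq_trans Hm; rewrite -!size_filter.
  apply: (@leq_trans (size ((sr i *m r) :: [seq b <- pos | ht b < ht (sr i *m r)]))) => //.
  apply: uniq_leq_size => /=.
    by rewrite mem_filter ltxx /= filter_uniq // (pos_uniq _ HR).
  move=> d; rewrite inE => /orP [/eqP ->|]; first by rewrite mem_filter Hlt Hs.
  by rewrite mem_filter => /andP [Hd Hdp]; rewrite mem_filter Hdp (lt_trans Hd Hlt).
exists (sr i *m w), j; split; last by rewrite -mulmxA -E srKv.
by apply: genM => //; exact: gen_sr.
Qed.

Lemma root_conj r : r \in rts -> exists w i, gen w /\ r = w *m al i.
Proof.
move=> Hr; case: (pos_or HR Hpos Hr) => [/pos_conj //|/pos_conj [w [i [Hw E]]]].
exists (w *m sr i), i; split; first by apply: genM => //; exact: gen_sr.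
by rewrite -mulmxA sr_al mulmxN -E opprK.
Qed.

Lemma W0_gen w : inW0 R w -> gen w.
Proof.
move=> Hw; elim/W0_ind: w / Hw => [|a w Ha _ Hg]; first by exists [::].
apply: genM => //; have [v [i [Hv ->]]] := root_conj Ha.
rewrite (refl_conj HR W0u W0P) ?al_root //; last exact: gen_W0.
by apply: genM (genV Hv); apply: genM => //; exact: gen_sr.
Qed.

Lemma W0_inds (P : 'M[rat]_n -> Prop) : P 1%:M ->
  (forall i w, inW0 R w -> P w -> P (sr i *m w)) -> forall w, inW0 R w -> P w.
Proof.
move=> P1 PS w /W0_gen [s ->]; elim: s => [|i s IH] //=; apply: PS => //.
by apply: gen_W0; exists s.
Qed.

Lemma W0_rootD w r : inW0 R w -> r \in rts -> w *m r \in rts.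
Proof. by move=> Hw Hr; apply: (W0_root HR). Qed.
Lemma prD_inv w x a : inW0 R w -> a \in rts -> pr (w *m x) (w *m a) = pr x a.
Proof. exact: (pr_inv HR W0u W0P). Qed.
Lemma mem_posN r : r \in rts -> (- r \in pos) = (r \notin pos).
Proof. exact: (posN HR Hpos). Qed.
Lemma mulmx_posN (w : 'M[rat]_n) r : inW0 R w -> r \in rts -> (w *m - r \in pos) = (w *m r \notin pos).
Proof. by move=> Hw Hr; rewrite mulmxN mem_posN // W0_rootD. Qed.
Lemma pr_sr i x r : r \in rts -> pr (sr i *m x) r = pr x (sr i *m r).
Proof.
move=> Hr; rewrite -(prD_inv _ (W0_sr i)) ?(W0_rootD (W0_sr i)) //.
by rewrite srKv // .
Qed.

(** * Length and the exchange condition in W0 *)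

Definition l0 (w : 'M[rat]_n) : nat := count (fun r => w *m r \notin pos) pos.

Lemma sr_perm i : perm_eq [seq sr i *m r | r <- rem (al i) pos] (rem (al i) pos).
Proof.
have up : uniq pos by exact: (pos_uniq _ HR).
have inj : injective (mulmx (sr i) : 'cV[rat]_n -> 'cV[rat]_n).
  by move=> x y E; rewrite -(srKv i x) E srKv.
have main r : r \in rem (al i) pos -> sr i *m r \in rem (al i) pos.
  rewrite !(mem_rem_uniq _ up) !inE => /andP [Hne Hr]; rewrite sr_pos // andbT.
  apply: contraNneq Hne => E; have Hp := sr_pos Hr.
  have := mem_posN (al_root i); rewrite al_pos // => Hn.
  by move: Hr; rewrite -(srKv i r) E sr_al // Hn.
apply: uniq_perm; rewrite ?(map_inj_uniq inj) ?rem_uniq // => r.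
apply/mapP/idP => [[r' Hr' ->]|Hr]; first exact: main.
by exists (sr i *m r); [exact: main | rewrite srKv].
Qed.

Lemma pos_remE i : perm_eq pos (al i :: rem (al i) pos).
Proof. exact/perm_to_rem/al_pos. Qed.

Lemma l0_mulr w i : inW0 R w -> w *m al i \in pos -> l0 (w *m sr i) = (l0 w).+1.
Proof.
move=> Hw Hp; rewrite /l0 !(permP (pos_remE i)) /= Hp -mulmxA sr_al // mulmx_posN ?al_root // Hp.
rewrite add1n add0n -(permP (sr_perm i)) count_map.
by congr _.+1; apply: eq_in_count => r _ /=; rewrite -mulmxA srKv.
Qed.
Lemma l0_mulrN w i : inW0 R w -> w *m al i \notin pos -> l0 w = (l0 (w *m sr i)).+1.
Proof.
move=> Hw Hp; have Hws : inW0 R (w *m sr i) by apply: W0_mul => //; exact: W0_sr.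
rewrite -{1}(srKr i w) (@l0_mulr _ i Hws) //.
by rewrite -mulmxA sr_al mulmx_posN // al_root.
Qed.

Lemma l0_inv w : inW0 R w -> l0 (invmx w) = l0 w.
Proof.
suff H w' : inW0 R w' -> (l0 (invmx w') <= l0 w')%N.
  move=> Hw; apply/eqP; rewrite eqn_leq H //=.
  by have := H _ (W0_invmx HR Hw); rewrite invmxK.
move=> Hw; have U := W0_unit HR Hw; rewrite /l0 -!size_filter.
rewrite -(size_map (fun r : 'cV[rat]_n => - (invmx w' *m r))); apply: uniq_leq_size.
  rewrite map_inj_uniq; first exact/filter_uniq/(pos_uniq _ HR).
  by move=> x y /oppr_inj E; rewrite -(mulKVmx U x) E mulKVmx.
move=> y /mapP [r]; rewrite mem_filter => /andP [Hn Hr] ->.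
have Rr := pos_rts Hr; have Rw : invmx w' *m r \in rts by apply: W0_rootD => //; exact: W0_invmx.
rewrite mem_filter mulmxN mulKVmx // !mem_posN // Hn andbT negbK.
by rewrite Hr.
Qed.

Lemma l0_1 : l0 1%:M = 0%N.
Proof. by apply/eqP; rewrite /l0 eqn0Ngt -has_count; apply/hasPn => r Hr; rewrite mul1mx negbK. Qed.

(** Apply the letters from the right. Just before the letter s_j at which [al i] first turns
    negative, the suffix w sends [al i] to [al j]; hence w s_i = s_j w and the letter s_j
    cancels. *)
Lemma exchange (s : seq 'I_n) i :
  foldr (fun i m => sr i *m m) 1%:M s *m al i \notin pos ->
  exists s', (size s').+1 = size s /\
    foldr (fun i m => sr i *m m) 1%:M s *m sr i = foldr (fun i m => sr i *m m) 1%:M s'.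
Proof.
elim: s => [|j s IH] /=; first by rewrite mul1mx al_pos.
set w := foldr _ _ s in IH *.
have Hw : inW0 R w by apply: gen_W0; exists s.
rewrite -mulmxA => Hn.
have [Hp|/IH [s' [E1 E2]]] := boolP (w *m al i \in pos); last first.
  by exists (j :: s') => /=; rewrite E1 -mulmxA E2.
exists s; split=> //.
have E : w *m al i = al j.
  by apply/eqP; apply: contraNT Hn => /(sr_pos Hp).
have := refl_conj HR W0u W0P Hw (al_root i); rewrite E => Ej.
have Ew : w *m sr i = sr j *m w by rewrite /sr Ej mulmxKV // (W0_unit HR Hw).
by rewrite -mulmxA Ew srKl.
Qed.

Lemma l0_eq0 w : inW0 R w -> (forall i, w *m al i \in pos) -> w = 1%:M.
Proof.
move=> /W0_gen [s ->]; have [m] := ubnP (size s).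
elim: m s => // m IH s; rewrite ltnS => Hm Hp.
case/lastP: s Hm Hp => [//|s i]; rewrite size_rcons => Hm Hp.
have E : foldr (fun i m => sr i *m m) 1%:M (rcons s i) = foldr (fun i m => sr i *m m) 1%:M s *m sr i.
  elim: s {Hm Hp} => [|j s IHs] /=; first by rewrite mul1mx mulmx1.
  by rewrite IHs mulmxA.
have Hs : inW0 R (foldr (fun i m => sr i *m m) 1%:M s) by apply: gen_W0; exists s.
have := Hp i; rewrite E -mulmxA sr_al mulmx_posN ?al_root // => /exchange [s' [E1 E2]].
rewrite E2; apply: IH; last by move=> j; rewrite -E2 -E.
by apply: leq_trans Hm; rewrite -E1.
Qed.

Lemma W0_neq1 w : inW0 R w -> w != 1%:M -> exists i, w *m al i \notin pos.
Proof.
move=> Hw Hne; apply: Classical_Prop.NNPP => Hno; move/eqP: Hne; apply.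
apply: l0_eq0 => // i; apply: contraT => Hn; by case: Hno; exists i.
Qed.

Lemma W0_indr (P : 'M[rat]_n -> Prop) : P 1%:M ->
  (forall w i, inW0 R w -> w *m al i \in pos -> P w -> P (w *m sr i)) ->
  forall w, inW0 R w -> P w.
Proof.
move=> P1 PS w; have [m] := ubnP (l0 w); elim: m w => // m IH w; rewrite ltnS => Hm Hw.
have [->//|/(W0_neq1 Hw) [i Hi]] := eqVneq w 1%:M.
have Hws : inW0 R (w *m sr i) by apply: W0_mul => //; exact: W0_sr.
rewrite -(srKr i w); apply: PS => //; first by rewrite -mulmxA sr_al mulmx_posN // al_root.
by apply: IH => //; rewrite -(l0_mulrN Hw Hi).
Qed.

Lemma l0_mull w i : inW0 R w -> invmx w *m al i \in pos -> l0 (sr i *m w) = (l0 w).+1.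
Proof.
move=> Hw Hp; have Hsw : inW0 R (sr i *m w) by apply: W0_mul => //; exact: W0_sr.
by rewrite -l0_inv // (invmxM (W0_sr i) Hw) invmx_sr l0_mulr ?l0_inv //; exact: W0_invmx.
Qed.

Lemma l0_mullN w i : inW0 R w -> invmx w *m al i \notin pos -> l0 w = (l0 (sr i *m w)).+1.
Proof.
move=> Hw Hp; have Hsw : inW0 R (sr i *m w) by apply: W0_mul => //; exact: W0_sr.
by rewrite -(l0_inv Hsw) (invmxM (W0_sr i) Hw) invmx_sr -l0_mulrN ?l0_inv //; exact: W0_invmx.
Qed.

Lemma W0_indl (P : 'M[rat]_n -> Prop) : P 1%:M ->
  (forall w i, inW0 R w -> invmx w *m al i \in pos -> P w -> P (sr i *m w)) ->
  forall w, inW0 R w -> P w.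
Proof.
move=> P1 PS w Hw; rewrite -(invmxK w).
elim/W0_indr: (invmx w) / (W0_invmx HR Hw) => [|v i Hv Hp IH]; first by rewrite invmx1.
rewrite (invmxM Hv (W0_sr i)) invmx_sr; apply: PS => //; first exact: W0_invmx.
by rewrite invmxK.
Qed.

(** * Weights, dominance and the length function on W *)

Lemma inX_al x : inX R x <-> forall i, is_int (pr x (al i)).
Proof.
split=> [H i|H a /root_conj [w [i [/gen_W0 Hw ->]]]]; first exact/H/al_root.
have HH : forall i, is_int (pr (invmx w *m x) (al i)).
  elim/W0_inds: (invmx w) / (W0_invmx HR Hw) => [|j v _ IH] k; first by rewrite mul1mx.
  rewrite -mulmxA srE pairingB pairingZ; apply: is_intD => //; apply: is_intN; apply: is_intM => //.
  by apply: (pr_int HR); exact: al_root.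
by have := HH i; rewrite -(prD_inv _ Hw) ?al_root // mulKVmx // (W0_unit HR Hw).
Qed.

Lemma inX0 : inX R 0. Proof. by move=> a _; rewrite pairing0; exists 0. Qed.
Lemma inXD x y : inX R x -> inX R y -> inX R (x + y).
Proof. by move=> Hx Hy a Ha; rewrite pairingD; apply: is_intD; [exact: Hx | exact: Hy]. Qed.
Lemma inXN x : inX R x -> inX R (- x).
Proof. by move=> Hx a Ha; rewrite pairingN; apply: is_intN; exact: Hx. Qed.
Lemma inXB x y : inX R x -> inX R y -> inX R (x - y).
Proof. by move=> Hx Hy; apply: inXD => //; exact: inXN. Qed.
Lemma inXMn x k : inX R x -> inX R (x *+ k).
Proof. by move=> Hx; elim: k => [|k IH]; rewrite ?mulr0n ?mulrS; [exact: inX0 | exact: inXD]. Qed.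
Lemma inX_root a : a \in rts -> inX R a.
Proof. by move=> Ha b Hb; exact: (pr_int HR). Qed.
Lemma inX_al1 i : inX R (al i). Proof. exact/inX_root/al_root. Qed.
Lemma inX_W0 w x : inW0 R w -> inX R x -> inX R (w *m x).
Proof.
move=> Hw Hx a Ha; have Hi := W0_invmx HR Hw.
rewrite -(prD_inv _ Hi Ha) mulKmx ?(W0_unit HR Hw) //.
by apply: Hx; exact: W0_rootD.
Qed.

Definition Cmx : 'M[rat]_n := \matrix_(i, j) coroot R (al i) 0 j.
Definition om (i : 'I_n) : 'cV[rat]_n := col i (invmx Cmx).

Lemma CmxE x i : (Cmx *m x) i 0 = pr x (al i).
Proof. by rewrite /pairing !mxE; apply: eq_bigr => j _; rewrite !mxE. Qed.
Lemma pr_al_inj x : (forall i, pr x (al i) = 0) -> x = 0.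
Proof.
move=> H; apply: (form_eq0 W0P); rewrite {2}(coE x) form_sumr big1 // => i _.
rewrite formZr formC; have := pr_form HR W0u W0P x (al_root i).
rewrite H mul0r => /esym/eqP; rewrite mulf_eq0 => /orP [//|/eqP ->]; by rewrite mulr0.
Qed.
Lemma Cmx_unit : Cmx \in unitmx.
Proof.
rewrite -unitmx_tr -row_free_unit -kermx_eq0; apply/eqP/row_matrixP => i; rewrite row0.
have /sub_kermxP E : (row i (kermx Cmx^T) <= kermx Cmx^T)%MS by exact: row_sub.
apply: trmx_inj; rewrite trmx0; apply: pr_al_inj => j; rewrite -CmxE.
by have := congr1 trmx E; rewrite trmx_mul trmxK => ->; rewrite trmx0 mxE.
Qed.
Lemma pr_om i j : pr (om i) (al j) = (i == j)%:R.
Proof. by rewrite -CmxE /om colE mulmxA mulmxV ?Cmx_unit // mul1mx mxE eqxx andbT eq_sym. Qed.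
Lemma omE x : x = \sum_i pr x (al i) *: om i.
Proof.
apply/eqP; rewrite -subr_eq0; apply/eqP/pr_al_inj => j.
rewrite pairingB pairing_sum (bigD1 j) //= pairingZ pr_om eqxx mulr1 big1 ?addr0 ?subrr //.
by move=> i /negbTE Hi; rewrite pairingZ pr_om Hi mulr0.
Qed.
Lemma om_X i : inX R (om i).
Proof. by apply/inX_al => j; rewrite pr_om; exists (i == j)%:R; case: (i == j). Qed.

Definition dom (x : 'cV[rat]_n) : Prop := forall i, 0 <= pr x (al i).
Lemma domD x y : dom x -> dom y -> dom (x + y).
Proof. by move=> Hx Hy i; rewrite pairingD addr_ge0. Qed.
Lemma dom0 : dom 0. Proof. by move=> i; rewrite pairing0. Qed.
Lemma dom_om i : dom (om i). Proof. by move=> j; rewrite pr_om ler0n. Qed.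
Lemma dom_pos x r : dom x -> r \in pos -> 0 <= pr x r.
Proof.
move=> Hx Hr; have Rr := pos_rts Hr.
suff H : 0 <= form r x.
  by rewrite (pr_formE HR W0u W0P) // divr_ge0 ?mulr_ge0 // ltW // (form_root_gt0 HR W0P).
rewrite (coE r) form_suml sumr_ge0 // => i _; rewrite formZl mulr_ge0 ?pos_co_ge0 //.
have Fi := form_root_gt0 HR W0P (al_root i).
have := Hx i; rewrite (pr_formE HR W0u W0P) ?al_root // pmulr_lge0 ?invr_gt0 //.
by rewrite pmulr_rge0.
Qed.

(** The pairing with 2 rho^vee; on dominant weights it is the length of the translation. *)
Definition delta (x : 'cV[rat]_n) : rat := \sum_(r <- pos) pr x r.
Lemma deltaD x y : delta (x + y) = delta x + delta y.
Proof. by rewrite /delta -big_split; apply: eq_bigr => r _; rewrite pairingD. Qed.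
Lemma deltaZ k x : delta (k *: x) = k * delta x.
Proof. by rewrite /delta mulr_sumr; apply: eq_bigr => r _; rewrite pairingZ. Qed.
Lemma delta_al i : delta (al i) = 2.
Proof.
rewrite /delta (perm_big _ (pos_remE i)) big_cons /= (pr_self HR) ?al_root //.
set S := \sum_(_ <- _) _; suff -> : S = 0 by rewrite addr0.
have E : S = - S.
  rewrite {1}/S -(perm_big _ (sr_perm i)) big_map -sumrN big_seq [RHS]big_seq; apply: eq_bigr => r Hr.
  have Rr : r \in rts by apply/pos_rts/(mem_rem Hr).
  by rewrite -pr_sr // sr_al pairingN.
lra.
Qed.
Lemma delta_sr i x : delta (sr i *m x) = delta x - 2 * pr x (al i).
Proof. by rewrite srE -scaleNr deltaD deltaZ delta_al mulNr mulrC. Qed.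
Lemma delta_int x : inX R x -> is_int (delta x).
Proof.
move=> Hx; rewrite /delta big_seq; apply: (big_ind is_int); first by exists 0.
  exact: is_intD.
by move=> r /pos_rts; exact: Hx.
Qed.
Lemma delta_dom x : dom x -> 0 <= delta x.
Proof. by move=> Hx; rewrite /delta big_seq sumr_ge0 // => r; exact: dom_pos. Qed.

Definition Lw (w : 'M[rat]_n) (x : 'cV[rat]_n) : rat :=
  \sum_(r <- pos) (if w *m r \in pos then `|pr x r| else `|pr x r + 1|).

Lemma is_posE r : r \in rts -> is_pos f r = (r \in pos).
Proof. by move=> Hr; rewrite mem_filter Hr andbT. Qed.

Lemma lenWE (a : Wel R) : lenW f a = Lw (Wlin a) (Wtr a).
Proof.
rewrite /lenW /Lw /pos big_filter [LHS]big_seq_cond [RHS]big_seq_cond.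
apply: eq_bigr => r /andP [Hr _].
have -> : is_pos f (Wlin a *m r) = (Wlin a *m r \in pos); last by [].
by rewrite is_posE // W0_rootD //; case: a => -[w x] /= [].
Qed.

Lemma Lw_dom w x : dom x -> Lw w x = (l0 w)%:R + delta x.
Proof.
move=> Hx; rewrite /Lw /delta /l0 -sum1_count natr_sum [X in _ = X + _]big_mkcond -big_split /=.
rewrite big_seq [RHS]big_seq; apply: eq_bigr => r Hr.
have H0 := dom_pos Hx Hr; case: ifP => _ /=; first by rewrite add0r ger0_norm.
by rewrite ger0_norm ?addr_ge0 // addrC.
Qed.
Lemma delta0 : delta 0 = 0.
Proof. by rewrite -(scale0r (0 : 'cV[rat]_n)) deltaZ mul0r. Qed.
Lemma Lw_0 w : Lw w 0 = (l0 w)%:R.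
Proof. by rewrite (Lw_dom w dom0) delta0 addr0. Qed.
Lemma Lw_1 x : dom x -> Lw 1%:M x = delta x.
Proof. by move=> Hx; rewrite (Lw_dom _ Hx) l0_1 add0r. Qed.

Definition sgp (v : 'M[rat]_n) (r : 'cV[rat]_n) := if v *m r \in pos then v *m r else - (v *m r).

Lemma sgp_perm v : inW0 R v -> perm_eq [seq sgp v r | r <- pos] pos.
Proof.
move=> Hv; have up : uniq pos by exact: (pos_uniq _ HR).
have U := W0_unit HR Hv.
have key u : inW0 R u -> {in pos, forall r, sgp u r \in pos}.
  move=> Hu r Hr; rewrite /sgp; case: ifP => // /negbT Hn.
  by rewrite mem_posN // W0_rootD // (pos_rts Hr).
have can u r : inW0 R u -> r \in pos -> sgp (invmx u) (sgp u r) = r.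
  move=> Hu Hr; have Uu := W0_unit HR Hu; have Rr := pos_rts Hr; rewrite {2}/sgp; case: ifP => _.
    by rewrite /sgp mulKmx // Hr.
  by rewrite /sgp mulmxN mulKmx // mem_posN // Hr /= opprK.
apply: uniq_perm => //.
  rewrite map_inj_in_uniq // => x y Hx Hy E; by rewrite -(can v x) // E can.
move=> r; apply/mapP/idP => [[r' Hr' ->]|Hr]; first exact: key.
have Hi := W0_invmx HR Hv.
by exists (sgp (invmx v) r); [exact: key | rewrite -{1}(invmxK v) can].
Qed.

(* v carries y to the dominant chamber and is as short as possible *)
Definition straight (v : 'M[rat]_n) (y : 'cV[rat]_n) : Prop :=
  inW0 R v /\ forall r, r \in pos -> (v *m r \notin pos) = (pr y r < 0).

(** Where [v] turns a root negative, integrality gives k = <y, r^vee> <= -1 and |k + 1| = |k| - 1.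
    So a summand grows by one exactly at the inversions of [u], and [v y] is the shortest element of
    its coset W0 v y. *)
Lemma straight_mul u v y : inX R y -> straight v y -> inW0 R u ->
  Lw (u *m v) y = (l0 u)%:R + Lw v y.
Proof.
move=> HX [Hv Hs] Hu; apply/eqP; rewrite -subr_eq; apply/eqP.
rewrite /Lw -sumrB /l0 -sum1_count natr_sum [RHS]big_mkcond -[RHS](perm_big _ (sgp_perm Hv)) big_map /=.
rewrite big_seq [RHS]big_seq; apply: eq_bigr => r Hr.
have Rr := pos_rts Hr; have Rv : v *m r \in rts by exact: W0_rootD.
have := Hs r Hr; rewrite /sgp -mulmxA; case Hp: (v *m r \in pos) => /=.
  move/esym => /negbT; rewrite -leNgt => H0; case: ifP => _ /=; first by rewrite subrr.
  by rewrite !ger0_norm ?addr_ge0 // addrC addKr.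
move/esym => H0; rewrite mulmx_posN // negbK.
have [z Ez] := HX r Rr; rewrite Ez in H0 *.
have Hz : z <= -1 by move: H0; rewrite ltrz0; lia.
have Hz1 : z%:~R + 1 <= 0 :> rat by rewrite -(rmorphD intr z 1) lerz0; lia.
have Hz2 : z%:~R <= 0 :> rat by exact: ltW.
case: ifP => _ /=; rewrite ?(ler0_norm Hz1) ?(ler0_norm Hz2); lra.
Qed.

Lemma straight_dom v y : inX R y -> straight v y -> dom (v *m y) /\ Lw v y + (l0 v)%:R = delta (v *m y).
Proof.
move=> HX [Hv Hs].
have key r : r \in pos -> pr (v *m y) (sgp v r) = `|pr y r|.
  move=> Hr; have Rr := pos_rts Hr; have Rv : v *m r \in rts by exact: W0_rootD.
  have := Hs r Hr; rewrite /sgp; case Hp: (v *m r \in pos) => /= /esym H0; last first.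
    by rewrite (pr_opp HR W0u W0P) // prD_inv // ltr0_norm.
  by rewrite prD_inv // ger0_norm // leNgt H0.
split.
  move=> i; have : al i \in [seq sgp v r | r <- pos] by rewrite (perm_mem (sgp_perm Hv)) al_pos.
  by case/mapP => r Hr ->; rewrite key.
rewrite /delta -(perm_big _ (sgp_perm Hv)) big_map /Lw /l0 -sum1_count natr_sum [X in _ + X]big_mkcond.
rewrite -big_split /= big_seq [RHS]big_seq; apply: eq_bigr => r Hr.
rewrite key //; have := Hs r Hr; case Hp: (v *m r \in pos) => /= /esym H0; first by rewrite addr0.
have [z Ez] := HX r (pos_rts Hr); rewrite Ez in H0 *.
have Hz : z <= -1 by move: H0; rewrite ltrz0; lia.
have Hz1 : z%:~R + 1 <= 0 :> rat by rewrite -(rmorphD intr z 1) lerz0; lia.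
have Hz2 : z%:~R <= 0 :> rat by exact: ltW.
rewrite ?(ler0_norm Hz1) ?(ler0_norm Hz2); lra.
Qed.

Lemma straight_ex y : exists v, straight v y.
Proof.
have [m] := ubnP (count (fun r => pr y r < 0) pos).
elim: m y => // m IH y; rewrite ltnS => Hm.
have [[i Hi]|Hno] := excluded_middle_informative (exists i, pr y (al i) < 0); last first.
  exists 1%:M; split; first exact: W0_1.
  move=> r Hr; rewrite mul1mx Hr /=; apply/esym/negbTE; rewrite -leNgt; apply: dom_pos => // i.
  rewrite leNgt; apply/negP => H; by apply: Hno; exists i.
have E1 : count (fun r => pr y r < 0) pos = (count (fun r => (pr (sr i *m y) r < 0)%R) pos).+1.
  rewrite !(permP (pos_remE i)) /= Hi pr_sr ?al_root // sr_al.
  rewrite (pr_opp HR W0u W0P) ?al_root // oppr_lt0 ltNge (ltW Hi) add0n add1n.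
  rewrite -(permP (sr_perm i)) count_map; congr _.+1.
  apply: eq_in_count => r /mem_rem Hr /=; rewrite -pr_sr //; exact: pos_rts Hr.
have [|v [Hv Hs]] := IH (sr i *m y); first by rewrite -E1.
exists (v *m sr i); split; first by apply: W0_mul => //; exact: W0_sr.
move=> r Hr; rewrite -mulmxA; have Rr := pos_rts Hr.
have Rsr : sr i *m r \in rts by apply: W0_rootD => //; exact: W0_sr.
have [->|Hne] := eqVneq r (al i); last by rewrite Hs ?sr_pos // pr_sr // srKv.
rewrite Hi sr_al mulmx_posN ?al_root // Hs ?al_pos // pr_sr ?al_root // sr_al.
by rewrite (pr_opp HR W0u W0P) ?al_root // oppr_lt0 ltNge (ltW Hi).
Qed.

Lemma straight_om i : straight (sr i) (sr i *m om i).
Proof.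
split; first exact: W0_sr.
move=> r Hr; have Rr := pos_rts Hr; rewrite pr_sr //.
have [->|Hne] := eqVneq r (al i).
  by rewrite sr_al mem_posN ?al_root // al_pos (pr_opp HR W0u W0P) ?al_root // pr_om eqxx.
rewrite sr_pos //=; apply/esym/negbTE; rewrite -leNgt; apply: dom_pos; first exact: dom_om.
exact: sr_pos.
Qed.

Lemma l0_sr i : l0 (sr i) = 1%N.
Proof.
have -> : sr i = 1%:M *m sr i by rewrite mul1mx.
by rewrite l0_mulr ?l0_1 //; [exact: W0_1 | rewrite mul1mx al_pos].
Qed.

(* dominant root of minimal length, whose affine reflection is simple *)
Lemma dominant_short_root : (0 < n)%N -> exists g, [/\ g \in pos, dom g
  & forall r, r \in pos -> r != g -> 0 <= pr g r < 2].
Proof.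
move=> n0.
have r0 : [seq - form r r | r <- rts] != [::].
  by have := al_root (Ordinal n0); case: (rts).
have [a Ha Hmin] : exists2 a, a \in rts & forall r, r \in rts -> form a a <= form r r.
  have [|a Ha Hm] := @seq_argmax _ rts (fun r => - form r r); first by apply: contraNneq r0 => ->.
  by exists a => // r /Hm; rewrite lerN2.
pose short := [seq r <- rts | form r r == form a a].
have [|g Hg Hmax] := @seq_argmax _ short ht.
  by rewrite -has_filter; apply/hasP; exists a.
move: (Hg); rewrite mem_filter => /andP [/eqP Eg Rg].
have dg : dom g.
  move=> i; rewrite leNgt; apply/negP => Hi.
  have : sr i *m g \in short.
    by rewrite mem_filter (form_inv HR W0u W0P) ?Eg ?eqxx ?W0_rootD //; exact: W0_sr.
  by move/Hmax; rewrite ht_sr; lra.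
have pg : g \in pos.
  case: (pos_or HR Hpos Rg) => // Hn; have := dom_pos dg Hn.
  by rewrite (pr_opp HR W0u W0P) // (pr_self HR).
exists g; split => // r Hr Hne; have Rr := pos_rts Hr; rewrite dom_pos //=.
have Fr := form_root_gt0 HR W0P Rr.
have np t : r != t *: g.
  apply/eqP => E; case: (root_prop Hred Rr Rg E) => E'; first by rewrite E' eqxx in Hne.
  by have := pos_nopp HR Hpos pg; rewrite -E' Hr.
have CS := form_cs W0P (root_neq0 HR Rg) np.
have Hle : form g g <= form r r by rewrite Eg; exact: Hmin.
rewrite (pr_formE HR W0u W0P) // ltr_pdivrMr // ltr_pM2l // ltNge; apply/negP => Hge.
have : form r r * form r r <= form r g ^+ 2 by rewrite expr2; apply: ler_pM => //; exact: ltW.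
have : form r r * form g g <= form r r * form r r by rewrite ler_wpM2l // ltW.
lra.
Qed.

Section Gamma.
Variable g : 'cV[rat]_n.
Hypotheses (gp : g \in pos) (gd : dom g) (gs : forall r, r \in pos -> r != g -> 0 <= pr g r < 2).
Let gr : g \in rts := pos_rts gp.

(** Integrality leaves the values 0 and 1. At 0 the reflection fixes [r]; at 1 it sends [r] to a
    root whose coroot is -1 on the dominant [g], hence to a negative root. *)
Lemma gamma_pr r : r \in pos -> r != g ->
  pr g r = (refl_mx R g *m r \notin pos)%:R.
Proof.
move=> Hr Hne; have Rr := pos_rts Hr; have [z Ez] := pr_int HR Rr gr.
have := gs Hr Hne; rewrite Ez ler0z => /andP [H1 H2].
have H3 : (z < 2)%R by move: H2; rewrite -(ltr_int rat).
have Wg := W0_refl gr.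
have [E0|E1] : z = 0 \/ z = 1 by lia.
  have F0 : pr r g = 0.
    have := pr_form HR W0u W0P g Rr; rewrite Ez E0 mul0r => E.
    have := pr_form HR W0u W0P r gr; rewrite formC => E'.
    have Fg := form_root_gt0 HR W0P gr.
    by apply/eqP; rewrite -(inj_eq (mulIf (lt0r_neq0 Fg))) mul0r E' -E.
  by rewrite reflE F0 scale0r subr0 Hr E0.
rewrite E1; case Hp: (_ \in pos) => //=; have := dom_pos gd Hp.
have := prD_inv g Wg Rr; rewrite reflE (pr_self HR) // scaler_nat mulr2n opprD addrA subrr add0r.
by rewrite pairingN Ez E1 => /eqP; rewrite eqr_oppLR => /eqP ->.
Qed.

Lemma gamma_neg : refl_mx R g *m g \notin pos.
Proof. by rewrite reflE (pr_self HR) // scaler_nat mulr2n opprD addrA subrr add0r mem_posN // gp. Qed.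

Lemma Lw_gamma0 : Lw (refl_mx R g) (- g) = 1.
Proof.
rewrite /Lw (bigD1_seq g) ?(pos_uniq _ HR) //= (negbTE gamma_neg) pairingN (pr_self HR) //.
have -> : `|- 2 + 1 : rat| = 1 by [].
rewrite big_seq_cond big1 ?addr0 // => r /andP [Hr Hne].
by rewrite pairingN gamma_pr //; case: (_ \in pos); rewrite /= ?oppr0 ?normr0 // addrC subrr normr0.
Qed.
Lemma delta_gamma : delta g = 1 + (l0 (refl_mx R g))%:R.
Proof.
rewrite /l0 -sum1_count natr_sum [X in _ = _ + X]big_mkcond [X in _ = _ + X](bigD1_seq g) ?(pos_uniq _ HR) //= gamma_neg addrA.
rewrite /delta (bigD1_seq g) ?(pos_uniq _ HR) //= (pr_self HR) //; congr (_ + _).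
rewrite big_seq_cond [RHS]big_seq_cond; apply: eq_bigr => r /andP [Hr Hne].
by rewrite gamma_pr //; case: (_ \notin _).
Qed.
End Gamma.

Lemma pr_form_eq0 a b : a \in rts -> (pr b a == 0) = (form a b == 0).
Proof.
move=> Ha; have Fa := form_root_gt0 HR W0P Ha.
by rewrite (pr_formE HR W0u W0P) // !mulf_eq0 invr_eq0 (gt_eqF Fa) orbF.
Qed.

(** Connectedness of the Dynkin diagram. Otherwise every root is supported either in [K] or off [K],
    since a simple reflection from one side pairs to zero with roots of the other, and this splits
    the root system. *)
Lemma conn_closed (K : pred 'I_n) : (exists i, K i) ->
  (forall i j, K i -> pr (al i) (al j) != 0 -> K j) -> forall i, K i.
Proof.
move=> [i0 K0] Kc i1; apply: contraT => K1; exfalso.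
pose inK r := forall j, ~~ K j -> co j r = 0.
pose inN r := forall j, K j -> co j r = 0.
have orth i j : K i -> ~~ K j -> form (al i) (al j) = 0.
  move=> Ki Kj; apply/eqP; rewrite formC -pr_form_eq0 ?al_root //.
  by apply: contraNT Kj => /Kc; apply.
have split r : r \in rts -> inK r \/ inN r.
  case/root_conj => w [i [/gen_W0 Hw ->]].
  elim/W0_inds: w / Hw => [|k w Hw IH].
    rewrite mul1mx; case Ki: (K i); [left|right] => j Kj; rewrite co_al;
    by case: eqP Kj => // ->; rewrite Ki.
  rewrite -mulmxA srE; set r' := w *m al i in IH *.
  have Rr' : r' \in rts by apply: W0_rootD => //; exact: al_root.
  have cs j : j != k -> co j (r' - pr r' (al k) *: al k) = co j r'.
    by move=> Hj; rewrite coB coZ co_al (negbTE Hj) mulr0 subr0.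
  case: IH => H; [left|right] => j Kj; (have [Ej|Hj] := eqVneq j k; last by rewrite cs // H).
    suff -> : pr r' (al k) = 0 by rewrite scale0r subr0 H.
    apply/eqP; rewrite pr_form_eq0 ?al_root // (coE r') form_sumr big1 // => l _.
    rewrite formZr; case Kl: (K l); last by rewrite H ?Kl // mul0r.
    by rewrite formC orth ?mulr0 // -Ej.
  suff -> : pr r' (al k) = 0 by rewrite scale0r subr0 H.
  apply/eqP; rewrite pr_form_eq0 ?al_root // (coE r') form_sumr big1 // => l _.
  rewrite formZr; case Kl: (K l); first by rewrite H ?Kl // mul0r.
  by rewrite orth ?mulr0 // ?Kl // -Ej.
case: (b_irr D); exists inK; split.
- exists (al i0); split; first exact: al_root.
  by move=> j Kj; rewrite co_al; case: eqP Kj => // ->; rewrite K0.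
- exists (al i1); split; first exact: al_root.
  by move/(_ i1 K1); rewrite co_al eqxx => /eqP; rewrite oner_eq0.
move=> a b Ra Rb Ha Hb; have [//|Hb'] := split b Rb.
apply/eqP; rewrite pr_form_eq0 // (coE a) form_suml big1 // => k _; rewrite formZl (coE b) form_sumr.
case Kk: (K k); last by rewrite Ha ?Kk // mul0r.
rewrite big1 ?mulr0 // => l _; rewrite formZr; case Kl: (K l); first by rewrite Hb' // mul0r.
by rewrite orth ?mulr0 // Kl.
Qed.

Lemma cartan i j : i != j -> exists k : nat, pr (al j) (al i) = - k%:R.
Proof.
move=> Hij; have Rs : sr i *m al j \in rts by apply: W0_rootD; [exact: W0_sr | exact: al_root].
have Hp : sr i *m al j \in pos.
  apply: sr_pos; rewrite ?al_pos //; apply/eqP => E; have := co_al i j.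
  by rewrite E co_al eqxx (negbTE Hij) => /eqP; rewrite oner_eq0.
have [k E] := pos_co i Hp; exists k; move: E.
by rewrite srE coB coZ !co_al eqxx (negbTE Hij) mulr1 sub0r => <-; rewrite opprK.
Qed.

Lemma form_al_le0 i j : i != j -> form (al i) (al j) <= 0.
Proof.
move=> Hij; have [k E] := cartan Hij; have := pr_form HR W0u W0P (al j) (al_root i).
have Fi := form_root_gt0 HR W0P (al_root i); rewrite E => E2.
have : 2 * form (al i) (al j) <= 0 by rewrite -E2 mulNr oppr_le0 mulr_ge0 // ltW.
by rewrite pmulr_rle0.
Qed.

Lemma al_np i j t : i != j -> al i != t *: al j.
Proof.
move=> Hij; apply: contra_neq (oner_neq0 rat) => E.
by rewrite -[1]/(true%:R) -(eqxx i) -co_al E coZ co_al (negbTE Hij) mulr0.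
Qed.

Lemma cartan_prod i j (a b : nat) : i != j -> pr (al j) (al i) = - a%:R -> pr (al i) (al j) = - b%:R ->
  [/\ (a * b < 4)%N, (a == 0)%N = (b == 0)%N
    & 4 * form (al i) (al j) ^+ 2 = (a * b)%:R * (form (al i) (al i) * form (al j) (al j))].
Proof.
move=> Hij Ea Eb.
have Fa := pr_form HR W0u W0P (al j) (al_root i); have Fb := pr_form HR W0u W0P (al i) (al_root j).
rewrite Ea in Fa; rewrite Eb (formC W0s (al j)) in Fb.
have Fi := form_root_gt0 HR W0P (al_root i); have Fj := form_root_gt0 HR W0P (al_root j).
have E : 4 * form (al i) (al j) ^+ 2 = (a * b)%:R * (form (al i) (al i) * form (al j) (al j)).
  have -> : 4 * form (al i) (al j) ^+ 2 = (2 * form (al i) (al j)) * (2 * form (al i) (al j)) by ring.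
  by rewrite -{1}Fa -Fb natrM; ring.
split=> //.
  have CS := form_cs W0P (root_neq0 HR (al_root j)) (fun t => al_np t Hij).
  rewrite -(ltr_nat rat) -(ltr_pM2r (mulr_gt0 Fi Fj)) -E; lra.
have := pr_form_eq0 (al j) (al_root i); have := pr_form_eq0 (al i) (al_root j).
by rewrite formC Ea Eb !oppr_eq0 !pnatr_eq0 => <- ->.
Qed.

Lemma adjacent_ex i : (1 < n)%N -> exists2 j, j != i & pr (al i) (al j) != 0.
Proof.
move=> n1; apply: Classical_Prop.NNPP => Hno.
have H : forall k, pred1 i k.
  apply: conn_closed; first by exists i => /=.
  move=> k j /= /eqP -> Hj; apply/eqP; apply: Classical_Prop.NNPP => Hne.
  by apply: Hno; exists j => //; apply/eqP.
have /eqP E0 := H (Ordinal (ltnW n1)); have /eqP := H (Ordinal n1).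
by rewrite -E0 => /(congr1 val).
Qed.

(** Two multiple edges cannot meet at a vertex. By connectedness, a multiple edge is therefore
    either the whole diagram or adjacent to a simple edge. *)
Lemma cartan_pair : (1 < n)%N -> exists i j (a b : nat),
  [/\ i != j, pr (al j) (al i) = - a%:R, pr (al i) (al j) = - b%:R
    & (a = 1 /\ b = 1)%N \/ ((forall k, k = i \/ k = j) /\ b = 1 /\ (a = 2 \/ a = 3))%N].
Proof.
move=> n1.
have [j Hj Hadj] := adjacent_ex (Ordinal (ltnW n1)) n1; set i := Ordinal _ in Hj Hadj.
have Hij : i != j by rewrite eq_sym.
have [a Ea] := cartan Hij; have [b Eb] := cartan Hj.
have [Hab E0 Fab] := cartan_prod Hij Ea Eb.
have b0 : (b != 0)%N by move: Hadj; rewrite Eb oppr_eq0 pnatr_eq0.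
have a0 : (a != 0)%N by rewrite E0.
have [/eqP Eab|Nab] := boolP (a * b == 1)%N.
  by exists i, j, a, b; split=> //; left; split; nia.
have [Hall|Hk] := excluded_middle_informative (forall k, k = i \/ k = j).
  have [E|E] : (b = 1 /\ (a = 2 \/ a = 3) \/ a = 1 /\ (b = 2 \/ b = 3))%N by nia.
    by exists i, j, a, b; split=> //; right.
  exists j, i, b, a; split=> //; right; split=> // k; by case: (Hall k); [right|left].
have [p [p' [k [Hp [Hk1 [Hk2 Hpk]]]]]] : exists p p' k, [/\ (p = i /\ p' = j) \/ (p = j /\ p' = i),
    k != p, k != p' & pr (al p) (al k) != 0].
  apply: Classical_Prop.NNPP => Hno; apply: Hk => k0.
  have : pred2 i j k0.
    apply: conn_closed; first by exists i; apply/orP; left; exact/eqP.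
    move=> p k /= Hp Hpk; apply: contraT; rewrite negb_or => /andP [Hki Hkj]; exfalso; apply: Hno.
    case/orP: Hp => /eqP E; subst p; [exists i, j, k | exists j, i, k]; split=> //; by [left | right].
  by case/orP => /eqP; [left|right].
have Hpk' : p != k by rewrite eq_sym.
have [c Ec] := cartan Hpk'; have [d Ed] := cartan Hk1.
have [Hcd E0' Fcd] := cartan_prod Hpk' Ec Ed.
have d0 : (d != 0)%N by move: Hpk; rewrite Ed oppr_eq0 pnatr_eq0.
have [/eqP Ecd|Ncd] := boolP (c * d == 1)%N.
  by exists p, k, c, d; split=> //; left; split; nia.
exfalso.
have Fpp' : 4 * form (al p) (al p') ^+ 2 = (a * b)%:R * (form (al p) (al p) * form (al p') (al p')).
  by case: Hp => -[-> ->] //; rewrite formC Fab; ring.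
have Hpp' : p != p' by case: Hp => -[-> ->].
have c0 : (c != 0)%N by rewrite E0'.
have ab2 : 2 <= (a * b)%:R :> rat by rewrite (ler_nat _ 2); nia.
have cd2 : 2 <= (c * d)%:R :> rat by rewrite (ler_nat _ 2); nia.
have x0 := form_root_gt0 HR W0P (al_root p'); have y0 := form_root_gt0 HR W0P (al_root p).
have z0 := form_root_gt0 HR W0P (al_root k).
set x := form (al p') (al p') in x0 Fpp'; set y := form (al p) (al p) in y0 Fpp' Fcd.
set z := form (al k) (al k) in z0 Fcd.
have u0 := form_al_le0 Hpp'; have v0 := form_al_le0 Hpk'.
have t0 : form (al p') (al k) <= 0 by apply: form_al_le0; rewrite eq_sym.
set u := form (al p) (al p') in u0 Fpp'; set v := form (al p) (al k) in v0 Fcd.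
set t := form (al p') (al k) in t0.
(* [V] is [al p] minus its projections to the lines of [al p'] and [al k]. Multiple edges make each
   projection at least half of the norm, and [t] is nonpositive, so the norm of [V] is at most 0. *)
pose V := al p - (u / x) *: al p' - (v / z) *: al k.
have V0 : V != 0.
  apply: contra_neq (oner_neq0 rat) => E; have := co0 p; rewrite -E /V !coB !coZ !co_al eqxx.
  by rewrite (negbTE Hpp') (negbTE Hpk') !mulr0 !subr0.
have := form_gt0 W0P V0; rewrite ltNge => /negP; apply.
have -> : form V V = y - u ^+ 2 / x - v ^+ 2 / z + 2 * (u * v * t / (x * z)).
  rewrite /V !(formDl, formDr, formNl, formNr, formZl, formZr).
  rewrite (formC W0s (al p') (al p)) (formC W0s (al k) (al p)) (formC W0s (al k) (al p')).
  rewrite -/x -/y -/z -/u -/v -/t; field; by rewrite !gt_eqF.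
have H1 : y / 2 <= u ^+ 2 / x.
  rewrite ler_pdivlMr // -(ler_pM2l (_ : 0 < 4)) // Fpp'.
  have : 2 * (y * x) <= (a * b)%:R * (y * x) by rewrite ler_pM2r // mulr_gt0.
  lra.
have H2 : y / 2 <= v ^+ 2 / z.
  rewrite ler_pdivlMr // -(ler_pM2l (_ : 0 < 4)) // Fcd.
  have : 2 * (y * z) <= (c * d)%:R * (y * z) by rewrite ler_pM2r // mulr_gt0.
  lra.
have H3 : u * v * t / (x * z) <= 0.
  have Huv : 0 <= u * v by exact: mulr_le0.
  have : 0 <= u * v * (- t) / (x * z).
    by apply: divr_ge0; apply: mulr_ge0; rewrite ?oppr_ge0 // ltW.
  by rewrite mulrN mulNr oppr_ge0.
lra.
Qed.

Definition rho : 'cV[rat]_n := \sum_i om i.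
Lemma rho_X : inX R rho.
Proof. by rewrite /rho; apply: (big_ind (inX R)); [exact: inX0 | exact: inXD | move=> i _; exact: om_X]. Qed.
Lemma rho_al i : pr rho (al i) = 1.
Proof.
rewrite /rho pairing_sum (bigD1 i) //= pr_om eqxx big1 ?addr0 // => j /negbTE Hj.
by rewrite pr_om Hj.
Qed.
Lemma rho_dom : dom rho. Proof. by move=> i; rewrite rho_al. Qed.
Lemma rho_pos r : r \in pos -> 0 < pr rho r.
Proof.
move=> Hr; have Rr := pos_rts Hr; rewrite lt_def (dom_pos rho_dom Hr) andbT.
apply/eqP; rewrite /rho pairing_sum => /eqP; rewrite psumr_eq0 => [|i _]; last exact: dom_pos (dom_om i) Hr.
move=> /allP H0; have : pr r r = 0.
  rewrite {1}(omE r) pairing_sum big1 // => i _; rewrite pairingZ.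
  by have /eqP -> := H0 i (mem_index_enum _); rewrite mulr0.
by rewrite (pr_self HR).
Qed.
(** Each lengthening step by s_i on the left subtracts a positive multiple of [al i]. The strict
    drop separates a character from its W0-translates in the family t s^delta. *)
Lemma delta_rho w : inW0 R w -> w = 1%:M \/ delta (w *m rho) < delta rho.
Proof.
move=> Hw; elim/W0_indl: w / Hw => [|w i Hw Hp IH]; [by left | right].
have Hi := W0_invmx HR Hw.
have E : pr (w *m rho) (al i) = pr rho (invmx w *m al i).
  by rewrite -(prD_inv _ Hi) ?al_root // mulKmx // (W0_unit HR Hw).
rewrite -mulmxA delta_sr E; have := rho_pos Hp.
by case: IH => [->|]; rewrite ?mul1mx; lra.
Qed.

(** * The affine Hecke algebra *)

Variables (q : cplx) (A : algType cplx) (T : Wel R -> A).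
Hypotheses (q0 : q != 0) (n0 : (0 < n)%N) (HT : is_Hecke f q T).

Local Notation TT := (elt T).
Lemma TT_mul w x w' x' : inW0 R w -> inX R x -> inW0 R w' -> inX R x' ->
  Lw (w *m w') (invmx w' *m x + x') = Lw w x + Lw w' x' ->
  TT w x * TT w' x' = TT (w *m w') (invmx w' *m x + x').
Proof.
move=> Hw Hx Hw' Hx' E.
have [a [a1 a2 ->]] := elt_ex T Hw Hx; have [b [b1 b2 ->]] := elt_ex T Hw' Hx'.
have Xc := inXD (inX_W0 (W0_invmx HR Hw') Hx) Hx'.
have [c [c1 c2 ->]] := elt_ex T (W0_mul Hw Hw') Xc.
case: HT => _ _; apply; last by rewrite !lenWE a1 a2 b1 b2 c1 c2.
by rewrite /mulW c1 a1 b1 c2 b2 a2 addrK mulKVmx // (W0_unit HR Hw').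
Qed.

Definition Tw w := TT w 0.
Definition Tx x := TT 1%:M x.
Definition Ti i := Tw (sr i).

(** The length condition gives that [Tx 0] fixes every basis element from the left; expanding the
    unit of A in the basis identifies the two. *)
Lemma Tx0 : Tx 0 = 1.
Proof.
have H b : Tx 0 * T b = T b.
  rewrite elt_E; have [Hw Hx] : inW0 R (Wlin b) /\ inX R (Wtr b) by case: b => -[].
  rewrite TT_mul ?mul1mx ?mulmx0 ?add0r //; [exact: W0_1 | exact: inX0 |].
  by rewrite Lw_0 l0_1 add0r.
case: HT => -[_ sp] _ _; have [s [c E]] := sp 1.
rewrite -[LHS]mulr1 E mulr_sumr; apply: eq_bigr => i _.
by rewrite -scalerAr H.
Qed.
Lemma Tw1 : Tw 1%:M = 1. Proof. exact: Tx0. Qed.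

Lemma Tw_mulr w i : inW0 R w -> w *m al i \in pos -> Tw w * Ti i = Tw (w *m sr i).
Proof.
move=> Hw Hp; rewrite /Ti /Tw TT_mul ?mulmx0 ?addr0 //; try exact: inX0; try exact: W0_sr.
by rewrite !Lw_0 l0_mulr // l0_sr -addn1 natrD.
Qed.
Lemma Tw_mull w i : inW0 R w -> invmx w *m al i \in pos -> Ti i * Tw w = Tw (sr i *m w).
Proof.
move=> Hw Hp; rewrite /Ti /Tw TT_mul ?mulmx0 ?addr0 //; try exact: inX0; try exact: W0_sr.
by rewrite !Lw_0 l0_mull // l0_sr -addn1 natrD addrC.
Qed.

Lemma quadratic w x : inW0 R w -> inX R x -> inQ R x -> Lw w x = 1 ->
  TT w x * TT w x = (q - 1) *: TT w x + q%:A.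
Proof.
move=> Hw Hx HQ HL; have [a [a1 a2 ->]] := elt_ex T Hw Hx.
case: HT => _ H _; have := H a; rewrite /simple_refl lenWE a1 a2 => /(_ (conj HQ HL)) E.
apply/eqP; rewrite -subr_eq0 -E mulrDr mulr1 mulrBl -scalerAl mul1r scalerBl scale1r.
by rewrite opprD opprB !addrA; apply/eqP; congr (_ - _); rewrite addrAC.
Qed.

Lemma inQ0 : inQ R 0.
Proof. by exists (fun=> 0); rewrite big1 // => a _; rewrite mulr0z. Qed.

Lemma Ti2 i : Ti i * Ti i = (q - 1) *: Ti i + q%:A.
Proof. by apply: quadratic; [exact: W0_sr | exact: inX0 | exact: inQ0 | rewrite Lw_0 l0_sr]. Qed.

Definition qinv (t : A) : A := q^-1 *: (t - (q - 1)%:A).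

Lemma qinvP (t : A) : t * t = (q - 1) *: t + q%:A -> t * qinv t = 1 /\ qinv t * t = 1.
Proof.
move=> E; rewrite /qinv -scalerAl -scalerAr mulrBr mulrBl -scalerAl -scalerAr mulr1 mul1r E.
by rewrite addrAC subrr add0r scalerA mulVf // scale1r.
Qed.
Definition Tv i := qinv (Ti i).
Lemma TiTv i : Ti i * Tv i = 1. Proof. by case: (qinvP (Ti2 i)). Qed.
Lemma TvTi i : Tv i * Ti i = 1. Proof. by case: (qinvP (Ti2 i)). Qed.
Lemma Ti_unit i : invertible (Ti i). Proof. by exists (Tv i); rewrite TiTv TvTi. Qed.
Lemma Ti_Tv i : Ti i = q *: Tv i + (q - 1)%:A.
Proof. by rewrite /Tv /qinv scalerA mulfV // scale1r subrK. Qed.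

Lemma Tw_unit w : inW0 R w -> invertible (Tw w).
Proof.
move=> Hw; elim/W0_indr: w / Hw => [|w i Hw Hp IH]; first by rewrite Tw1; exact: invertible1.
by rewrite -Tw_mulr //; apply: invertibleM => //; exact: Ti_unit.
Qed.

Lemma Tw_mulrN w i : inW0 R w -> w *m al i \notin pos ->
  Tw w * Ti i = (q - 1) *: Tw w + q *: Tw (w *m sr i).
Proof.
move=> Hw Hn; have Hws : inW0 R (w *m sr i) by apply: W0_mul => //; exact: W0_sr.
have Hp : (w *m sr i) *m al i \in pos by rewrite -mulmxA sr_al mulmx_posN // al_root.
have E : Tw w = Tw (w *m sr i) * Ti i by rewrite Tw_mulr // srKr.
by rewrite {1}E -mulrA Ti2 mulrDr -!scalerAr mulr1 -E.
Qed.
Lemma Tw_mullN w i : inW0 R w -> invmx w *m al i \notin pos ->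
  Ti i * Tw w = (q - 1) *: Tw w + q *: Tw (sr i *m w).
Proof.
move=> Hw Hn; have Hsw : inW0 R (sr i *m w) by apply: W0_mul => //; exact: W0_sr.
have Hp : invmx (sr i *m w) *m al i \in pos.
  rewrite (invmxM (W0_sr i) Hw) invmx_sr -mulmxA sr_al mulmx_posN ?al_root //; exact: W0_invmx.
have E : Tw w = Ti i * Tw (sr i *m w) by rewrite Tw_mull // srKl.
by rewrite {1}E mulrA Ti2 mulrDl -!scalerAl mul1r -E.
Qed.

Lemma Tw_Tx w x : inW0 R w -> inX R x -> dom x -> Tw w * Tx x = TT w x.
Proof.
move=> Hw Hx Hd; rewrite /Tw /Tx TT_mul ?mulmx0 ?add0r ?mulmx1 //; try exact: inX0; try exact: W0_1.
by rewrite Lw_0 !Lw_dom // l0_1 add0r.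
Qed.
Lemma Tx_add x y : inX R x -> dom x -> inX R y -> dom y -> Tx x * Tx y = Tx (x + y).
Proof.
move=> Hx dx Hy dy; rewrite /Tx TT_mul ?invmx1 ?mul1mx //; try exact: W0_1.
by rewrite !Lw_1 ?deltaD //; exact: domD.
Qed.
Lemma Tx_comm x y : inX R x -> dom x -> inX R y -> dom y -> Tx x * Tx y = Tx y * Tx x.
Proof. by move=> *; rewrite !Tx_add // addrC. Qed.
Lemma Tx_Ti x i : inX R x -> dom x -> pr x (al i) = 0 -> Tx x * Ti i = Ti i * Tx x.
Proof.
move=> Hx dx E0; rewrite [RHS]Tw_Tx //; last exact: W0_sr.
rewrite /Tx /Ti /Tw TT_mul ?invmx_sr ?mul1mx ?addr0 //; try exact: inX0; try exact: W0_sr; try exact: W0_1.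
  by rewrite srE E0 scale0r subr0.
by rewrite srE E0 scale0r subr0 Lw_0 !Lw_dom // l0_1 add0r addrC.
Qed.

Lemma TT_straight v y : inX R y -> straight v y -> TT v y * Tw (invmx v) = Tx (v *m y).
Proof.
move=> Hy Hs; have [Hv _] := Hs; have U := W0_unit HR Hv; have Hi := W0_invmx HR Hv.
rewrite /Tw TT_mul ?invmxK ?mulmxV ?addr0 //; try exact: inX0.
have [Hd E] := straight_dom Hy Hs.
by rewrite Lw_0 l0_inv // E Lw_1.
Qed.
Lemma TT_decomp u v y : inW0 R u -> inX R y -> straight v y -> Tw u * TT v y = TT (u *m v) y.
Proof.
move=> Hu Hy Hs; have [Hv _] := Hs.
rewrite /Tw TT_mul ?mulmx0 ?add0r //; try exact: inX0.
by rewrite straight_mul // Lw_0.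
Qed.

(* The translation by om i + sr i (om i); it commutes with Ti i. *)
Definition ym i : 'cV[rat]_n := om i + om i - al i.
Lemma ym_X i : inX R (ym i).
Proof. by apply: inXB; [apply: inXD; exact: om_X | exact: inX_al1]. Qed.
Lemma ym_pr i j : i != j -> pr (ym i) (al j) = - pr (al i) (al j).
Proof. by move=> Hij; rewrite pairingB pairingD !pr_om (negbTE Hij) addr0 sub0r. Qed.
Lemma ym_pr0 i : pr (ym i) (al i) = 0.
Proof. by rewrite pairingB pairingD !pr_om eqxx (pr_self HR) ?al_root. Qed.
Lemma ym_dom i : dom (ym i).
Proof.
move=> j; have [<-|Hij] := eqVneq i j; first by rewrite ym_pr0.
rewrite ym_pr //; have [|k ->] := @cartan j i; first by rewrite eq_sym.
by rewrite opprK ler0n.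
Qed.

(** By straightness of s_i(om i), T_(om i) T_i^-1 is itself a basis element, and lengths add in its
    square. This is the Bernstein relation for [om i] without inverses of translations. *)
Lemma Tom_Tv2 i : Tx (om i) * Tv i * Tx (om i) * Tv i = Tx (ym i).
Proof.
set y := sr i *m om i; have Xy : inX R y by apply: inX_W0; [exact: W0_sr | exact: om_X].
have E : TT (sr i) y * Ti i = Tx (om i).
  by have := TT_straight Xy (straight_om i); rewrite invmx_sr srKv.
have -> : Tx (om i) * Tv i = TT (sr i) y by rewrite -E -mulrA TiTv mulr1.
rewrite -mulrA -{1}E -(mulrA _ (Ti i)) TiTv mulr1.
have Ey : sr i *m y + y = ym i.
  by rewrite /y srKv srE pr_om eqxx scale1r addrA.
rewrite TT_mul ?invmx_sr ?srK ?Ey //; try exact: W0_sr.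
have [_ EL] := straight_dom Xy (straight_om i).
rewrite Lw_1; last exact: ym_dom.
move: EL; rewrite srKv l0_sr /ym !deltaD -scaleN1r deltaZ delta_al => <-; ring.
Qed.
Lemma TomTvTom i : Tx (om i) * Tv i * Tx (om i) = Ti i * Tx (ym i).
Proof.
rewrite -Tx_Ti; try first [exact: ym_X|exact: ym_dom|exact: ym_pr0].
by rewrite -Tom_Tv2 -(mulrA (_ * _ * _) (Tv i)) TvTi mulr1.
Qed.

Lemma Tx_unit_part x y : inX R x -> dom x -> inX R y -> dom y -> dom (y - x) ->
  invertible (Tx y) -> invertible (Tx x).
Proof.
move=> Xx dx Xy dy d; have Xd : inX R (y - x) by exact: inXB.
rewrite -{1}(subrK x y) addrC -Tx_add // => H.
by apply: (invertible_factor H); rewrite Tx_comm.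
Qed.

Lemma dom_sub_om x i : inX R x -> dom x -> pr x (al i) != 0 -> dom (x - om i).
Proof.
move=> Xx dx Hne j; rewrite pairingB pr_om; have := dx j; case: eqP => [<-|_]; last by rewrite subr0.
move=> H0; have [z Ez] := Xx _ (al_root i); move: H0 Hne; rewrite Ez ler0z intr_eq0 => H1 H2.
by rewrite -(rmorphB intr z 1) ler0z; lia.
Qed.

(** For the dominant short root [g], [Tx g] is the product of an affine simple reflection and of
    [Tw (refl_mx R g)], both invertible. Some [om i] splits off from [g], and commuting factors of
    an invertible element are invertible. The property then passes to the neighbours j of i, because
    the dominant weight [ym i] contains [om j]. *)
Lemma Tom_unit i : invertible (Tx (om i)).
Proof.
pose K i : bool := if excluded_middle_informative (invertible (Tx (om i))) then true else false.
have KP j : K j <-> invertible (Tx (om j)).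
  by rewrite /K; case: excluded_middle_informative.
apply/KP; apply: conn_closed => {i}.
  have [g [gp gd gs]] := dominant_short_root n0.
  have gr := pos_rts gp; have Xg := inX_root gr; have Wg := W0_refl gr.
  have E : TT (refl_mx R g) (- g) * Tw (refl_mx R g) = Tx g.
    have Vg : invmx (refl_mx R g) = refl_mx R g.
      by rewrite -[RHS](mulKmx (W0_unit HR Wg)) (reflK HR) // mulmx1.
    have Eg : refl_mx R g *m - g = g.
      by rewrite mulmxN reflE (pr_self HR) // scaler_nat mulr2n opprB addrK.
    rewrite /Tw TT_mul ?(reflK HR) ?Vg ?addr0 ?Eg //; try exact: inX0; try exact: inXN.
    by rewrite Lw_gamma0 // Lw_0 Lw_1 // delta_gamma.
  have Ug : invertible (Tx g).
    rewrite -E; apply: invertibleM; last exact: Tw_unit.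
    have Q : inQ R (- g).
      exists (fun a => if a == g then -1 else 0).
      by rewrite (bigD1_seq g) ?(roots_uniq HR) //= eqxx mulrN1z big1 ?addr0 // => a /negbTE ->; rewrite mulr0z.
    have [H1 H2] := qinvP (quadratic Wg (inXN Xg) Q (Lw_gamma0 gp gd gs)).
    by exists (qinv (TT (refl_mx R g) (- g))).
  have [i Hi] := pos_pr_gt0 gp.
  exists i; apply/KP; apply: (Tx_unit_part (y := g)) => //; [exact: om_X | exact: dom_om |].
  by apply: dom_sub_om => //; rewrite gt_eqF.
move=> i j /KP Ui Hij; apply/KP; have [<-//|Ne] := eqVneq i j.
have Uy : invertible (Tx (ym i)).
  rewrite -Tom_Tv2; have Uv : invertible (Tv i) by exists (Ti i); rewrite TiTv TvTi.
  by do !apply: invertibleM.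
apply: (Tx_unit_part (y := ym i)) => //; [exact: om_X|exact: dom_om|exact: ym_X|exact: ym_dom|].
by apply: dom_sub_om; [exact: ym_X | exact: ym_dom | rewrite ym_pr // oppr_eq0].
Qed.

Lemma inX_nat x i : inX R x -> dom x -> exists k : nat, pr x (al i) = k%:R.
Proof.
move=> Xx dx; have [z Ez] := Xx _ (al_root i); have := dx i; rewrite Ez ler0z.
by case: z {Ez} => // k _; exists k.
Qed.

Lemma dom_ind (P : 'cV[rat]_n -> Prop) : P 0 ->
  (forall x i, inX R x -> dom x -> P x -> P (om i + x)) ->
  forall x, inX R x -> dom x -> P x.
Proof.
move=> P0 PS x Xx dx.
have key (s : seq 'I_n) (k : 'I_n -> nat) :
    [/\ inX R (\sum_(i <- s) om i *+ k i), dom (\sum_(i <- s) om i *+ k i) & P (\sum_(i <- s) om i *+ k i)].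
  elim: s => [|i s [IH1 IH2 IH3]].
    by rewrite big_nil; split => //; [exact: inX0 | exact: dom0].
  rewrite big_cons; elim: (k i) => [|m [H1 H2 H3]]; first by rewrite mulr0n add0r.
  rewrite mulrS -addrA; split; [apply: inXD => //; exact: om_X | apply: domD => //; exact: dom_om |].
  exact: PS.
have kx i := constructive_indefinite_description _ (inX_nat i Xx dx).
have -> : x = \sum_i om i *+ (sval (kx i)).
  rewrite {1}(omE x); apply: eq_bigr => i _; case: (kx i) => k /= ->.
  by rewrite scaler_nat.
by case: (key (index_enum 'I_n) (fun i => sval (kx i))).
Qed.

Lemma Tx_unit x : inX R x -> dom x -> invertible (Tx x).
Proof.
move: x; apply: dom_ind => [|x i Xx dx IH]; first by rewrite Tx0; exact: invertible1.
rewrite -Tx_add //; try first [exact: om_X|exact: dom_om].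
by apply: invertibleM => //; exact: Tom_unit.
Qed.

(** * The commutative subalgebra generated by the translations *)

Inductive Theta : A -> Prop :=
| Th_sc (k : cplx) : Theta k%:A
| Th_om i : Theta (Tx (om i))
| Th_omv i b : Tx (om i) * b = 1 -> b * Tx (om i) = 1 -> Theta b
| Th_add a b : Theta a -> Theta b -> Theta (a + b)
| Th_mul a b : Theta a -> Theta b -> Theta (a * b).

Lemma Theta1 : Theta 1. Proof. by rewrite -[1]scale1r; exact: Th_sc. Qed.
Lemma ThetaZ k a : Theta a -> Theta (k *: a).
Proof. by move=> Ha; rewrite -[a]mul1r scalerAl; apply: Th_mul => //; exact: Th_sc. Qed.
Lemma Theta_Tx x : inX R x -> dom x -> Theta (Tx x).
Proof.
move: x; apply: dom_ind => [|x i Xx dx IH]; first by rewrite Tx0; exact: Theta1.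
rewrite -Tx_add //; try first [exact: om_X|exact: dom_om].
by apply: Th_mul => //; exact: Th_om.
Qed.

Lemma comm_inv (a b c : A) : a * b = 1 -> b * a = 1 -> a * c = c * a -> b * c = c * b.
Proof.
move=> H1 H2 Hc.
by rewrite -[LHS]mulr1 -H1 !mulrA -(mulrA b c a) -Hc (mulrA b) H2 mul1r.
Qed.

Lemma Theta_comm a b : Theta a -> Theta b -> a * b = b * a.
Proof.
move=> Ha Hb.
have key i : Tx (om i) * b = b * Tx (om i).
  elim: Hb => [k|j|j d H1 H2|c d _ IHc _ IHd|c d _ IHc _ IHd].
  - by rewrite -scalerAl -scalerAr mul1r mulr1.
  - by rewrite Tx_comm; try first [exact: om_X|exact: dom_om].
  - symmetry; apply: (comm_inv H1 H2).
    by rewrite Tx_comm; try first [exact: om_X|exact: dom_om].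
  - by rewrite mulrDr mulrDl IHc IHd.
  - by rewrite (mulrA _ c) IHc -(mulrA c) IHd (mulrA c).
elim: Ha => [k|j|j d H1 H2|c d _ IHc _ IHd|c d _ IHc _ IHd] //.
- by rewrite -scalerAl -scalerAr mul1r mulr1.
- exact: (comm_inv H1 H2).
- by rewrite mulrDr mulrDl IHc IHd.
- by rewrite -(mulrA c) IHd (mulrA c) IHc (mulrA b).
Qed.

Lemma Theta_clear a : Theta a -> exists y (s : seq (cplx * 'cV[rat]_n)),
  [/\ inX R y, dom y, (forall p, p \in s -> inX R p.2 /\ dom p.2)
    & a * Tx y = \sum_(p <- s) p.1 *: Tx p.2].
Proof.
elim=> [k|i|i b H1 H2|c d Hc [y [s [Xy dy Hs E]]] Hd [y' [s' [Xy' dy' Hs' E']]]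
  |c d Hc [y [s [Xy dy Hs E]]] Hd [y' [s' [Xy' dy' Hs' E']]]].
- exists 0, [:: (k, 0)]; split; [exact: inX0|exact: dom0| |by rewrite big_seq1 Tx0 mulr1].
  by move=> p; rewrite inE => /eqP ->; split; [exact: inX0|exact: dom0].
- exists 0, [:: (1, om i)]; split; [exact: inX0|exact: dom0| |by rewrite big_seq1 Tx0 mulr1 scale1r].
  by move=> p; rewrite inE => /eqP ->; split; [exact: om_X|exact: dom_om].
- exists (om i), [:: (1, 0)]; split; [exact: om_X|exact: dom_om| |by rewrite big_seq1 Tx0 H2 scale1r].
  by move=> p; rewrite inE => /eqP ->; split; [exact: inX0|exact: dom0].
- exists (y + y'), ([seq (p.1, p.2 + y') | p <- s] ++ [seq (p.1, p.2 + y) | p <- s']).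
  split; [exact: inXD|exact: domD| |].
    move=> p; rewrite mem_cat => /orP [] /mapP [p' Hp' ->] /=.
      by have [? ?] := Hs _ Hp'; split; [exact: inXD|exact: domD].
    by have [? ?] := Hs' _ Hp'; split; [exact: inXD|exact: domD].
  rewrite mulrDl big_cat !big_map /=; congr (_ + _).
    rewrite -Tx_add // mulrA E mulr_suml big_seq [RHS]big_seq.
    by apply: eq_bigr => p Hp; have [? ?] := Hs _ Hp; rewrite -scalerAl Tx_add.
  rewrite (addrC y) -Tx_add // mulrA E' mulr_suml big_seq [RHS]big_seq.
  by apply: eq_bigr => p Hp; have [? ?] := Hs' _ Hp; rewrite -scalerAl Tx_add.
exists (y' + y), [seq (p.1 * p'.1, p.2 + p'.2) | p <- s, p' <- s'].
split; [exact: inXD|exact: domD| |].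
  move=> p /allpairsP [[p1 p2] /= [H1 H2 ->]] /=.
  have [? ?] := Hs _ H1; have [? ?] := Hs' _ H2.
  by split; [exact: inXD|exact: domD].
rewrite -Tx_add // mulrA -(mulrA c) E' -(Theta_comm (Theta_Tx Xy dy)); last first.
  apply: Th_mul => //; rewrite -E'; apply: Th_mul => //; exact: Theta_Tx.
rewrite mulrA (Theta_comm (Theta_Tx Xy dy) Hc) E big_allpairs_dep mulr_suml.
rewrite big_seq [RHS]big_seq; apply: eq_bigr => p Hp; rewrite mulr_sumr.
rewrite big_seq [RHS]big_seq; apply: eq_bigr => p' Hp'.
have [? ?] := Hs _ Hp; have [? ?] := Hs' _ Hp'.
by rewrite -scalerAl -scalerAr scalerA /= Tx_add.
Qed.

Lemma Theta_inv x w : inX R x -> dom x -> Tx x * w = 1 -> w * Tx x = 1 -> Theta w.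
Proof.
move=> Xx dx; move: x Xx dx w; apply: dom_ind => [|x k Xx dx IH] w.
  by rewrite Tx0 mul1r => ->; move=> _; exact: Theta1.
rewrite -Tx_add //; try first [exact: om_X|exact: dom_om].
have [wk [K1 K2]] := Tom_unit k; have [wx [W1 W2]] := Tx_unit Xx dx => F1 F2.
have -> : w = wx * wk.
  symmetry; apply: (invertible_linv _ F2); by rewrite mulrA -(mulrA (Tx (om k))) W1 mulr1.
by apply: Th_mul; [exact: IH|exact: Th_omv K1 K2].
Qed.

(** A qualitative Bernstein relation: without explicit coefficients it already moves Theta to the
    right of the T_w. *)
Lemma Theta_Ti a i : Theta a -> exists b c, [/\ Theta b, Theta c & a * Ti i = Ti i * b + c].
Proof.
have C0 : Theta 0 by rewrite -(scale0r 1); exact: Th_sc.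
have Ey := Theta_Tx (ym_X i) (@ym_dom i).
elim=> [k|j|j v H1 H2|c d Hc [b1 [b2 [B1 B2 E]]] Hd [b1' [b2' [B1' B2' E']]]
  |c d Hc [b1 [b2 [B1 B2 E]]] Hd [b1' [b2' [B1' B2' E']]]].
- exists k%:A, 0; split; [exact: Th_sc|exact: C0|].
  by rewrite -scalerAl -scalerAr mul1r mulr1 addr0.
- have [<-|Hij] := eqVneq i j; last first.
    exists (Tx (om j)), 0; split; [exact: Th_om|exact: C0|rewrite addr0].
    by apply: Tx_Ti; [exact: om_X|exact: dom_om|rewrite pr_om eq_sym (negbTE Hij)].
  have [v [H1 H2]] := Tom_unit i; have Hv : Theta v := Th_omv H1 H2.
  exists (q *: (Tx (ym i) * v)), ((q - 1) *: Tx (om i)).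
  split; [exact/ThetaZ/Th_mul|exact/ThetaZ/Th_om|].
  rewrite {1}Ti_Tv mulrDr -!(scalerAr q) -(scalerAr (q - 1)) mulr1; congr (_ *: _ + _).
  by rewrite mulrA -TomTvTom -(mulrA (_ * _)) H1 mulr1.
- have Hv : Theta v := Th_omv H1 H2.
  have [Eij|Hij] := eqVneq i j; last first.
    exists v, 0; split=> //; rewrite addr0; apply: (comm_inv H1 H2).
    by apply: Tx_Ti; [exact: om_X|exact: dom_om|rewrite pr_om eq_sym (negbTE Hij)].
  subst j; have [u [U1 U2]] := Tx_unit (ym_X i) (@ym_dom i).
  have Hu : Theta u := Theta_inv (ym_X i) (@ym_dom i) U1 U2.
  have E1 : Tv i * Tx (om i) = Tx (ym i) * (v * Ti i).
    rewrite mulrA -(Theta_comm Hv Ey) -mulrA (Tx_Ti (ym_X i) (@ym_dom i) (ym_pr0 i)) -TomTvTom.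
    by rewrite !mulrA H2 mul1r.
  have Cu : u * Tv i = Tv i * u.
    rewrite /Tv /qinv -scalerAr -scalerAl mulrBr mulrBl -scalerAr -scalerAl mulr1 mul1r.
    by rewrite (comm_inv U1 U2 (Tx_Ti (ym_X i) (@ym_dom i) (ym_pr0 i))).
  exists (q^-1 *: (u * Tx (om i))), (- (q^-1 * (q - 1)) *: (u * Tx (om i))).
  have Huo : Theta (u * Tx (om i)) by apply: Th_mul => //; exact: Th_om.
  split; [exact: ThetaZ|exact: ThetaZ|].
  have -> : v * Ti i = Tv i * (u * Tx (om i)) by rewrite mulrA -Cu -mulrA E1 mulrA U2 mul1r.
  by rewrite {1}/Tv /qinv -scalerAl mulrBl -scalerAl mul1r scalerBr -scalerAr scalerA scaleNr.
- exists (b1 + b1'), (b2 + b2'); split; [exact: Th_add|exact: Th_add|].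
  by rewrite mulrDl E E' mulrDr addrACA.
exists (b1 * b1'), (b2 * b1' + c * b2'); split; [exact: Th_mul|by apply: Th_add; apply: Th_mul|].
by rewrite -mulrA E' mulrDr !mulrA E mulrDl -addrA.
Qed.

Inductive HTh : A -> Prop :=
| HTh_gen w a : inW0 R w -> Theta a -> HTh (Tw w * a)
| HTh_add a b : HTh a -> HTh b -> HTh (a + b).

Lemma HTh_0 : HTh 0.
Proof.
rewrite -(mulr0 (Tw 1%:M)); apply: HTh_gen; first exact: W0_1.
by rewrite -(scale0r 1); exact: Th_sc.
Qed.
Lemma HTh_mulr a b : HTh a -> Theta b -> HTh (a * b).
Proof.
move=> Ha Hb; elim: Ha => [w c Hw Hc|c d _ IHc _ IHd]; last by rewrite mulrDl; exact: HTh_add.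
by rewrite -mulrA; apply: HTh_gen => //; exact: Th_mul.
Qed.
Lemma HThZ k a : HTh a -> HTh (k *: a).
Proof. by move=> Ha; rewrite -[a]mulr1 scalerAr; apply: HTh_mulr => //; exact: Th_sc. Qed.
Lemma HTh_Ti a i : HTh a -> HTh (a * Ti i).
Proof.
elim=> [w c Hw Hc|c d _ IHc _ IHd]; last by rewrite mulrDl; exact: HTh_add.
have [b [b' [Hb Hb' E]]] := Theta_Ti i Hc; rewrite -mulrA E mulrDr mulrA.
apply: HTh_add; last exact: HTh_gen.
have Hws : inW0 R (w *m sr i) by apply: W0_mul => //; exact: W0_sr.
have [Hp|Hn] := boolP (w *m al i \in pos); first by rewrite Tw_mulr //; exact: HTh_gen.
rewrite Tw_mulrN // mulrDl -!scalerAl; apply: HTh_add; apply: HThZ; exact: HTh_gen.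
Qed.
Lemma HTh_Tw w a b : inW0 R w -> b * Tw w = 1 -> Tw w * b = 1 -> HTh a -> HTh (a * b).
Proof.
move=> Hw; elim/W0_indr: w / Hw a b => [|w i Hw Hp IH] a b E1 E2 Ha.
  by move: E1; rewrite Tw1 mulr1 => ->; rewrite mulr1.
have [c [C1 C2]] := Tw_unit Hw; rewrite -Tw_mulr // in E1 E2.
have -> : b = Tv i * c.
  apply: (invertible_linv (a := Tw w * Ti i)) => //.
  by rewrite mulrA -(mulrA (Tv i)) C2 mulr1 TvTi.
rewrite mulrA; apply: (IH _ _ C2 C1).
rewrite /Tv /qinv -scalerAr; apply: HThZ; rewrite mulrBr; apply: HTh_add; first exact: HTh_Ti.
by rewrite -scaleN1r; apply/HThZ/HTh_mulr => //; exact: Th_sc.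
Qed.
(** For [v] straight at [y], T_(w y) is T_(w v^-1) T_(v y), and the straight factor is a dominant
    translation times the inverse of T_(v^-1), which is then carried through Theta. *)
Lemma HTh_all a : HTh a.
Proof.
case: HT => -[_ sp] _ _; have [s [c ->]] := sp a.
elim: s => [|b s IH]; first by rewrite big_nil; exact: HTh_0.
rewrite big_cons; apply: HTh_add => //; apply: HThZ; rewrite elt_E.
have [Hw Hy] : inW0 R (Wlin b) /\ inX R (Wtr b) by case: b => -[].
set w := Wlin b in Hw *; set y := Wtr b in Hy *.
have [v Hs] := straight_ex y; have [Hv _] := Hs; have Uv := W0_unit HR Hv.
have Hwv : inW0 R (w *m invmx v) by apply: W0_mul => //; exact: W0_invmx.
have -> : TT w y = Tw (w *m invmx v) * TT v y by rewrite TT_decomp // mulmxKV.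
have [d [D1 D2]] := Tw_unit (W0_invmx HR Hv).
have -> : TT v y = Tx (v *m y) * d by rewrite -TT_straight // -mulrA D1 mulr1.
rewrite mulrA; apply: (HTh_Tw (W0_invmx HR Hv) D2 D1); apply: HTh_gen => //.
by have [? _] := straight_dom Hy Hs; apply: Theta_Tx => //; apply: inX_W0.
Qed.

(** The denominators are inverses of dominant translations. Clearing them leads back to the given
    basis, on which functionals can be prescribed, so directness of the sum of the T_w Theta is
    never proved separately. *)
Lemma clear_denominators a : exists y (s : seq (cplx * 'M[rat]_n * 'cV[rat]_n)),
  [/\ inX R y, dom y, (forall p, p \in s -> [/\ inW0 R p.1.2, inX R p.2 & dom p.2])
    & a * Tx y = \sum_(p <- s) p.1.1 *: TT p.1.2 p.2].
Proof.
elim: (HTh_all a) => [w b Hw Hb|c d _ [y [s [Xy dy Hs E]]] _ [y' [s' [Xy' dy' Hs' E']]]].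
  have [y [s [Xy dy Hs E]]] := Theta_clear Hb.
  exists y, [seq (p.1, w, p.2) | p <- s]; split=> //.
    by move=> p /mapP [p' Hp' ->] /=; have [? ?] := Hs _ Hp'.
  rewrite -mulrA E mulr_sumr big_map big_seq [RHS]big_seq.
  by apply: eq_bigr => p Hp; have [? ?] := Hs _ Hp; rewrite -scalerAr Tw_Tx.
exists (y + y'), ([seq (p.1, p.2 + y') | p <- s] ++ [seq (p.1, p.2 + y) | p <- s']).
have TTx w x z : inW0 R w -> inX R x -> dom x -> inX R z -> dom z ->
    TT w x * Tx z = TT w (x + z).
  by move=> Hw Xx dx Xz dz; rewrite -!Tw_Tx -?mulrA ?Tx_add //; [exact: inXD|exact: domD].
split; [exact: inXD|exact: domD| |].
  move=> p; rewrite mem_cat => /orP [] /mapP [p' Hp' ->] /=.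
    by have [? ? ?] := Hs _ Hp'; split=> //; [exact: inXD|exact: domD].
  by have [? ? ?] := Hs' _ Hp'; split=> //; [exact: inXD|exact: domD].
rewrite mulrDl big_cat !big_map /=; congr (_ + _).
  rewrite -Tx_add // mulrA E mulr_suml big_seq [RHS]big_seq.
  by apply: eq_bigr => p Hp; have [? ? ?] := Hs _ Hp; rewrite -scalerAl TTx.
rewrite (addrC y) -Tx_add // mulrA E' mulr_suml big_seq [RHS]big_seq.
by apply: eq_bigr => p Hp; have [? ? ?] := Hs' _ Hp; rewrite -scalerAl TTx.
Qed.

(** * Construction of the induced modules *)

Definition N := size W0s.
Definition eW (w : 'M[rat]_n) : 'rV[cplx]_N := \row_(i < N) (nth 1%:M W0s i == w)%:R.

Lemma eW_delta (i : 'I_N) : eW (nth 1%:M W0s i) = delta_mx 0 i.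
Proof. by apply/rowP => j; rewrite !mxE eqxx nth_uniq. Qed.
Lemma eW_ind w : inW0 R w -> exists i : 'I_N, nth 1%:M W0s i = w.
Proof.
move=> /W0P Hw; have Hi : (index w W0s < N)%N by rewrite index_mem.
by exists (Ordinal Hi); rewrite /= nth_index.
Qed.
Lemma W0_nth (i : 'I_N) : inW0 R (nth 1%:M W0s i).
Proof. by apply/W0P/mem_nth. Qed.

Definition clear (a : A) := exists s : seq (cplx * 'M[rat]_n * 'cV[rat]_n),
  (forall p, p \in s -> [/\ inW0 R p.1.2, inX R p.2 & dom p.2]) /\ a = \sum_(p <- s) p.1.1 *: TT p.1.2 p.2.

Lemma TT_Tx w x z : inW0 R w -> inX R x -> dom x -> inX R z -> dom z -> TT w x * Tx z = TT w (x + z).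
Proof. by move=> Hw Xx dx Xz dz; rewrite -!Tw_Tx -?mulrA ?Tx_add //; try first [exact: inXD|exact: domD]. Qed.

Lemma clear_Tx a z : clear a -> inX R z -> dom z -> clear (a * Tx z).
Proof.
move=> [s [Hs ->]] Xz dz; exists [seq (p.1, p.2 + z) | p <- s]; split.
  by move=> p /mapP [p' Hp' ->] /=; have [? ? ?] := Hs _ Hp'; split=> //; [exact: inXD|exact: domD].
rewrite mulr_suml big_map big_seq [RHS]big_seq; apply: eq_bigr => p Hp; have [? ? ?] := Hs _ Hp.
by rewrite -scalerAl TT_Tx.
Qed.
Lemma clearD a b : clear a -> clear b -> clear (a + b).
Proof.
move=> [s [Hs ->]] [s' [Hs' ->]]; exists (s ++ s'); split; last by rewrite big_cat.
by move=> p; rewrite mem_cat => /orP [/Hs|/Hs'].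
Qed.
Lemma clearZ k a : clear a -> clear (k *: a).
Proof.
move=> [s [Hs ->]]; exists [seq (k * p.1.1, p.1.2, p.2) | p <- s]; split.
  by move=> p /mapP [p' Hp' ->] /=; have [? ? ?] := Hs _ Hp'.
by rewrite scaler_sumr big_map; apply: eq_bigr => p _; rewrite scalerA.
Qed.
Lemma clear_ex a : exists y, [/\ inX R y, dom y & clear (a * Tx y)].
Proof. by have [y [s [Xy dy Hs E]]] := clear_denominators a; exists y; split=> //; exists s. Qed.

(** [ev a] is the vector a e_1 of the module induced from [g]. It is prescribed on T_w T_x with [x]
    dominant, set to 0 on the other basis elements, and extended by dividing by [g] after clearing
    denominators; [evE] is the independence of the denominator. *)
Lemma induced_functional g : tchar R g -> exists ev : A -> 'rV[cplx]_N,
  [/\ forall a b, ev (a + b) = ev a + ev b, forall k a, ev (k *: a) = k *: ev a,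
      forall w, inW0 R w -> ev (Tw w) = eW w
    & forall a x, inX R x -> dom x -> ev (a * Tx x) = g x *: ev a].
Proof.
move=> [gD g0].
have [evp [eD eZ eT]] := linear_extension (fun a : Wel R =>
  if excluded_middle_informative (dom (Wtr a)) then g (Wtr a) *: eW (Wlin a) else 0) (let: And3 h _ _ := HT in h).
have e0 : evp 0 = 0 by rewrite -(scale0r 0) eZ scale0r.
have esum (J : Type) (s : seq J) (F : J -> A) : evp (\sum_(j <- s) F j) = \sum_(j <- s) evp (F j).
  by elim/big_rec2: _ => [|j x y _ <-]; rewrite ?e0 ?eD.
have eTT w x : inW0 R w -> inX R x -> dom x -> evp (TT w x) = g x *: eW w.
  move=> Hw Xx dx; have [a [E1 E2 ->]] := elt_ex T Hw Xx; rewrite eT E1 E2.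
  by case: excluded_middle_informative.
have eTx a z : clear a -> inX R z -> dom z -> evp (a * Tx z) = g z *: evp a.
  move=> [s [Hs ->]] Xz dz; rewrite mulr_suml !esum scaler_sumr big_seq [RHS]big_seq.
  apply: eq_bigr => p Hp; have [Hw Xx dx] := Hs _ Hp.
  rewrite -scalerAl TT_Tx // !eZ !eTT //; try first [exact: inXD|exact: domD].
  by rewrite gD // !scalerA; congr (_ *: _); ring.
have [y Hy] : exists y : A -> 'cV[rat]_n, forall a, [/\ inX R (y a), dom (y a) & clear (a * Tx (y a))].
  exists (fun a => sval (constructive_indefinite_description _ (clear_ex a))) => a.
  by case: constructive_indefinite_description.
pose ev a := (g (y a))^-1 *: evp (a * Tx (y a)).
have evE a z : inX R z -> dom z -> clear (a * Tx z) -> ev a = (g z)^-1 *: evp (a * Tx z).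
  move=> Xz dz Cz; have [Xy dy Cy] := Hy a.
  apply: (scalerI (g0 _ Xy)); apply: (scalerI (g0 _ Xz)).
  rewrite /ev !scalerA mulfK ?g0 // (mulrC (g z) (g (y a))) mulfK ?g0 //.
  by rewrite -!eTx // -!mulrA !Tx_add // addrC.
exists ev; split.
- move=> a b; have [Xa da Ca] := Hy a; have [Xb db Cb] := Hy b.
  have Xz := inXD Xa Xb; have dz := domD da db.
  have Ca' : clear (a * Tx (y a + y b)) by rewrite -Tx_add // mulrA; exact: clear_Tx.
  have Cb' : clear (b * Tx (y a + y b)) by rewrite addrC -Tx_add // mulrA; exact: clear_Tx.
  rewrite (evE _ _ Xz dz Ca') (evE _ _ Xz dz Cb') (evE _ _ Xz dz); last by rewrite mulrDl; exact: clearD.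
  by rewrite mulrDl eD scalerDr.
- move=> k a; have [Xa da Ca] := Hy a.
  rewrite (evE _ _ Xa da Ca) (evE _ _ Xa da); last by rewrite -scalerAl; exact: clearZ.
  by rewrite -scalerAl eZ !scalerA mulrC.
- have X0 : inX R 0 by exact: inX0.
  move=> w Hw; have E : Tw w * Tx 0 = TT w 0 by rewrite Tw_Tx //; exact: dom0.
  rewrite (evE _ 0) //; last 2 first; [exact: dom0| |].
    rewrite E; exists [:: (1, w, 0)]; split; last by rewrite big_seq1 scale1r.
    by move=> p; rewrite inE => /eqP ->; split=> //; exact: dom0.
  by rewrite E eTT ?scalerA ?mulVf ?scale1r ?g0 //; exact: dom0.
move=> a x Xx dx; have [Xa da Ca] := Hy a.
rewrite (evE (a * Tx x) _ Xa da) -mulrA (Tx_comm Xx dx Xa da) mulrA; last exact: clear_Tx.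
by rewrite (evE _ _ Xa da Ca) eTx // !scalerA mulrC.
Qed.

Lemma induced_rep g : tchar R g -> exists r : A -> 'M[cplx]_N,
  [/\ is_rep r, forall w, inW0 R w -> eW 1%:M *m r (Tw w) = eW w
    & forall x, inX R x -> dom x -> eW 1%:M *m r (Tx x) = g x *: eW 1%:M].
Proof.
move=> Hg; have [ev [eD eZ eT eTx]] := induced_functional Hg; have [gD g0] := Hg.
pose r (b : A) : 'M_N := \matrix_(i < N) ev (b * Tw (nth 1%:M W0s i)).
have e0 : ev 0 = 0 by rewrite -(scale0r 0) eZ scale0r.
have esum (J : Type) (s : seq J) (F : J -> A) : ev (\sum_(j <- s) F j) = \sum_(j <- s) ev (F j).
  by elim/big_rec2: _ => [|j x y _ <-]; rewrite ?e0 ?eD.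
have rW b w : inW0 R w -> eW w *m r b = ev (b * Tw w).
  by move=> /eW_ind [i <-]; rewrite eW_delta -rowE rowK.
have rE b a : ev (b * a) = ev a *m r b.
  have [y [s [Xy dy Hs E]]] := clear_denominators a.
  apply: (scalerI (g0 _ Xy)); rewrite scalemxAl -!eTx // -mulrA E mulr_sumr !esum mulmx_suml.
  rewrite big_seq [RHS]big_seq; apply: eq_bigr => p Hp; have [Hw Xx dx] := Hs _ Hp.
  by rewrite -scalerAr -Tw_Tx // mulrA !eZ !eTx // eT // -!scalemxAl rW.
have W1 : inW0 R 1%:M by exact: W0_1.
have ev1 : ev 1 = eW 1%:M by rewrite -Tw1 eT.
have Hr : is_rep r.
  split=> [|a b|k a|a b]; apply/row_matrixP => i; have Wi := W0_nth i.
  - by rewrite rowK mul1r eT // eW_delta row1.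
  - by rewrite rowK mulrDl eD [RHS]linearD /= !rowK.
  - by rewrite rowK -scalerAl eZ [RHS]linearZ /= rowK.
  by rewrite rowK -mulrA rE row_mul rowK.
exists r; split=> // [w Hw|x Xx dx]; first by rewrite -ev1 -rE mulr1 eT.
by rewrite -ev1 -rE -(mul1r (Tx x * 1)) mulr1 eTx.
Qed.
Lemma tchar0 t : tchar R t -> t 0 = 1.
Proof.
move=> [tD t0]; have X0 : inX R 0 by exact: inX0.
by apply: (mulfI (t0 _ X0)); rewrite -tD // addr0 mulr1.
Qed.
Lemma tcharN t x : tchar R t -> inX R x -> t (- x) = (t x)^-1.
Proof.
move=> Ht Xx; have [tD t0] := Ht; apply: (mulfI (t0 _ Xx)).
by rewrite -tD ?subrr ?(tchar0 Ht) ?mulfV ?t0 //; exact: inXN.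
Qed.
Lemma tcharB t x y : tchar R t -> inX R x -> inX R y -> t (x - y) = t x / t y.
Proof. by move=> Ht Xx Xy; rewrite (proj1 Ht) ?tcharN //; exact: inXN. Qed.
Lemma tcharMn t x k : tchar R t -> inX R x -> t (x *+ k) = t x ^+ k.
Proof.
move=> Ht Xx; elim: k => [|k IH]; first by rewrite mulr0n (tchar0 Ht).
by rewrite mulrS (proj1 Ht) ?IH ?exprS //; exact: inXMn.
Qed.
Lemma tcharMz t x z : tchar R t -> inX R x -> t (x *~ z) = t x ^ z.
Proof.
move=> Ht Xx; case: z => k; first exact: tcharMn.
by rewrite NegzE mulrNz tcharN // ?tcharMn ?exprnN //; exact: inXMn.
Qed.

Lemma tchar_ext t t' : tchar R t -> tchar R t' -> (forall i, t (om i) = t' (om i)) ->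
  forall x, inX R x -> t x = t' x.
Proof.
move=> Ht Ht' E x Xx.
have Xz i : inX R (pr x (al i) *: om i) /\ t (pr x (al i) *: om i) = t' (pr x (al i) *: om i).
  have [z ->] := Xx _ (al_root i); rewrite scaler_int !tcharMz ?E //; try exact: om_X.
  by split=> //; case: z => k; [|apply: inXN]; apply: inXMn; exact: om_X.
have [] : inX R (\sum_i pr x (al i) *: om i) /\ t (\sum_i pr x (al i) *: om i) = t' (\sum_i pr x (al i) *: om i).
  elim/big_rec: _ => [|i y _ [Xy Ey]]; first by rewrite !tchar0 //; split=> //; exact: inX0.
  have [Xi Ei] := Xz i; split; first exact: inXD.
  by rewrite (proj1 Ht) // (proj1 Ht') // Ei Ey.
by rewrite -omE.
Qed.

Definition tW (w : 'M[rat]_n) (t : 'cV[rat]_n -> cplx) : 'cV[rat]_n -> cplx := fun x => t (invmx w *m x).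
Lemma tW_tchar w t : inW0 R w -> tchar R t -> tchar R (tW w t).
Proof.
move=> Hw [tD t0]; have Hi := W0_invmx HR Hw; split=> [x y Xx Xy|x Xx]; rewrite /tW.
  by rewrite mulmxDr tD //; exact: inX_W0.
by apply: t0; exact: inX_W0.
Qed.

Lemma sum_pairl (V : zmodType) (F : 'M[rat]_n -> V) k :
  \sum_(w <- W0s) F w = \sum_(w <- W0s | invmx w *m al k \in pos) (F w + F (sr k *m w)).
Proof.
rewrite (bigID (fun w => invmx w *m al k \in pos)) /= big_split /=; congr (_ + _).
rewrite -(perm_big _ (W0s_mull HR W0u W0P (W0_sr k))) big_map /=.
rewrite big_seq_cond [RHS]big_seq_cond; apply: eq_bigl => w.
case: (boolP (w \in W0s)) => //= /W0P Hw; rewrite (invmxM (W0_sr k) Hw) invmx_sr -mulmxA sr_al.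
by have Hi := W0_invmx HR Hw; rewrite (mulmx_posN Hi (al_root k)) negbK.
Qed.

(** * Casimir elements and characters *)

Definition linear_map (p : A -> A) := (forall a b, p (a + b) = p a + p b) /\ forall k a, p (k *: a) = k *: p a.

Section LinearMap.
Variable p : A -> A.
Hypothesis Hp : linear_map p.
Lemma lmD a b : p (a + b) = p a + p b. Proof. by case: Hp. Qed.
Lemma lmZ k a : p (k *: a) = k *: p a. Proof. by case: Hp. Qed.
Lemma lm0 : p 0 = 0. Proof. by have := lmZ 0 0; rewrite !scale0r. Qed.
Lemma lmB a b : p (a - b) = p a - p b. Proof. by rewrite -(scaleN1r b) lmD lmZ scaleN1r. Qed.
End LinearMap.

(* Averaging against the Casimir element sum_w q^-l(w) T_w (x) T_(w^-1) of the finite Hecke algebra. *)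
Definition Av (p : A -> A) (b : A) : A :=
  \sum_(w <- W0s) (q ^- l0 w) *: (Tw w * p (Tw (invmx w) * b)).

(** The terms are grouped in pairs {w, s_k w}. The quadratic relation, used inside [p] on one side
    and on the left factor on the other, produces the same terms thanks to the coefficients
    q^-l(w). *)
Lemma Av_Ti p k b : linear_map p -> Av p (Ti k * b) = Ti k * Av p b.
Proof.
move=> Hp; rewrite /Av mulr_sumr !(sum_pairl _ k) big_seq_cond [RHS]big_seq_cond.
apply: eq_bigr => w /andP [/W0P Hw Hp1]; have Hi := W0_invmx HR Hw; have Ws := W0_sr k.
have Hsw := W0_mul Ws Hw; have Hswi := W0_invmx HR Hsw.
have Ei : invmx (sr k *m w) = invmx w *m sr k by rewrite (invmxM Ws Hw) invmx_sr.
have E1 : Tw (invmx w) * (Ti k * b) = Tw (invmx (sr k *m w)) * b by rewrite mulrA Tw_mulr // Ei.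
have Hn : invmx (sr k *m w) *m al k \notin pos.
  by rewrite Ei -mulmxA sr_al mulmx_posN ?negbK ?al_root.
have E2 : Tw (invmx (sr k *m w)) * (Ti k * b) =
    (q - 1) *: (Tw (invmx (sr k *m w)) * b) + q *: (Tw (invmx w) * b).
  by rewrite mulrA Tw_mulrN // Ei srKr mulrDl -!scalerAl.
have E3 : Ti k * Tw w = Tw (sr k *m w) by rewrite Tw_mull.
have E4 : Ti k * Tw (sr k *m w) = (q - 1) *: Tw (sr k *m w) + q *: Tw w.
  by rewrite Tw_mullN // srKl.
rewrite E1 E2 -!scalerAr !mulrA E3 E4 (lmD Hp) !(lmZ Hp) l0_mull // mulrDr mulrDl -!scalerAr -!scalerAl.
set X := Tw w * _; set Y := _ * p (Tw (invmx w) * b); set Z := Tw (sr k *m w) * p (Tw (invmx (sr k *m w)) * b).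
rewrite exprS invfM !scalerDr !scalerA.
have -> : q^-1 / q ^+ l0 w * q = q ^- l0 w by rewrite mulrAC mulVf // mul1r.
by rewrite addrCA [RHS]addrCA; congr (_ + _); rewrite addrC.
Qed.

Lemma Av_Tw p w b : linear_map p -> inW0 R w -> Av p (Tw w * b) = Tw w * Av p b.
Proof.
move=> Hp Hw; elim/W0_indl: w / Hw => [|w i Hw H IH]; first by rewrite Tw1 !mul1r.
by rewrite -Tw_mull // -!mulrA Av_Ti // IH.
Qed.
Lemma Av_linear p : linear_map p -> linear_map (Av p).
Proof.
move=> Hp; split=> [a b|k a]; rewrite /Av.
  by rewrite -big_split; apply: eq_bigr => w _; rewrite mulrDr (lmD Hp) mulrDr scalerDr.
rewrite scaler_sumr; apply: eq_bigr => w _.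
by rewrite -scalerAr (lmZ Hp) -scalerAr !scalerA mulrC.
Qed.

Lemma straight_inj v v' y : straight v y -> straight v' y -> v = v'.
Proof.
move=> [Hv H] [Hv' H']; have Hi := W0_invmx HR Hv.
suff E : v' *m invmx v = 1%:M by rewrite -[LHS]mul1mx -E mulmxKV // (W0_unit HR Hv).
apply: l0_eq0; first exact: W0_mul.
have key r : r \in pos -> (v' *m r \in pos) = (v *m r \in pos).
  by move=> Hr; apply/negb_inj; rewrite H // H'.
move=> i; rewrite -mulmxA; set r := invmx v *m al i.
have Er : v *m r = al i by rewrite mulKVmx // (W0_unit HR Hv).
have Rr : r \in rts by apply: W0_rootD => //; exact: al_root.
have [rp|rp] := pos_or HR Hpos Rr; first by rewrite key // Er al_pos.
have := key _ rp; rewrite !mulmx_posN // Er al_pos /= => /negbT; rewrite negbK //.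
Qed.

(** Freeness of A over the finite Hecke algebra: [p] keeps the basis elements that are straight and
    kills the others. On a straight element T_(w^-1) leads to a basis element that is not straight
    unless w = 1, so a single term of the average survives. *)
Lemma straight_part : exists p, linear_map p /\ forall b, Av p b = b.
Proof.
have [p [pD pZ pT]] := linear_extension
  (fun a : Wel R => if excluded_middle_informative (straight (Wlin a) (Wtr a)) then T a else 0) (let: And3 h _ _ := HT in h).
have Hp : linear_map p by [].
exists p; split=> // b; case: HT => -[_ sp] _ _; have [s [k ->]] := sp b.
elim: s => [|a s IH]; first by rewrite big_nil (lm0 (Av_linear Hp)).
rewrite big_cons (lmD (Av_linear Hp)) (lmZ (Av_linear Hp)) IH; congr (_ *: _ + _).
rewrite elt_E; have [Hw Hy] : inW0 R (Wlin a) /\ inX R (Wtr a) by case: a => -[].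
set w := Wlin a in Hw *; set y := Wtr a in Hy *.
have [v Hs] := straight_ex y; have [Hv _] := Hs.
have Hu : inW0 R (w *m invmx v) by apply: W0_mul => //; exact: W0_invmx.
have -> : TT w y = Tw (w *m invmx v) * TT v y by rewrite TT_decomp // mulmxKV // (W0_unit HR Hv).
rewrite Av_Tw //; congr (_ * _); have W1 : inW0 R 1%:M by exact: W0_1.
have pTT u : inW0 R u -> p (TT u y) = if u == v then TT u y else 0.
  move=> Wu; have [a' [E1 E2 ->]] := elt_ex T Wu Hy; rewrite pT E1 E2.
  destruct (excluded_middle_informative (straight u y)) as [Hsu|Hn] => /=.
    by have /eqP -> := straight_inj Hsu Hs.
  by case: eqP => // E; case: Hn; rewrite E.
rewrite /Av (bigD1_seq 1%:M) //=; last by apply/W0P.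
rewrite big_seq_cond big1 => [|u /andP [/W0P Wu u1]].
  by rewrite l0_1 expr0 invr1 scale1r Tw1 invmx1 Tw1 !mul1r pTT // eqxx addr0.
have Hi := W0_invmx HR Wu; rewrite TT_decomp // pTT; last exact: W0_mul.
case: eqP => [E|_]; last by rewrite mulr0 scaler0.
case/eqP: u1; rewrite -[u]invmxK; have -> : invmx u = 1%:M.
  by rewrite -[LHS]mulmx1 -(mulmxV (W0_unit HR Hv)) mulmxA E mulmxV // (W0_unit HR Hv).
by rewrite invmx1.
Qed.

Variable e : Wel R -> A.
Hypothesis He : is_group_algebra e.
Definition EE := elt e.

Lemma EE_E (a : Wel R) : e a = EE (Wlin a) (Wtr a). Proof. exact: elt_E. Qed.
Lemma EE_ex w x : inW0 R w -> inX R x -> exists a : Wel R, [/\ Wlin a = w, Wtr a = x & EE w x = e a].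
Proof. exact: elt_ex. Qed.
Lemma EE_mul w x w' x' : inW0 R w -> inX R x -> inW0 R w' -> inX R x' ->
  EE w x * EE w' x' = EE (w *m w') (invmx w' *m x + x').
Proof.
move=> Hw Hx Hw' Hx'.
have [a [a1 a2 ->]] := EE_ex Hw Hx; have [b [b1 b2 ->]] := EE_ex Hw' Hx'.
have Xc := inXD (inX_W0 (W0_invmx HR Hw') Hx) Hx'.
have [d [d1 d2 ->]] := EE_ex (W0_mul Hw Hw') Xc.
case: He => _; apply.
by rewrite /mulW d1 a1 b1 d2 b2 a2 addrK mulKVmx // (W0_unit HR Hw').
Qed.
Definition Ew w := EE w 0.
Definition Ex x := EE 1%:M x.
Let W1 : inW0 R 1%:M. Proof. exact: W0_1. Qed.
Let X0 : inX R 0. Proof. exact: inX0. Qed.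

Lemma EE_span b : exists s : seq (cplx * 'M[rat]_n * 'cV[rat]_n),
  (forall p, p \in s -> inW0 R p.1.2 /\ inX R p.2) /\ b = \sum_(p <- s) p.1.1 *: EE p.1.2 p.2.
Proof.
case: He => -[_ sp] _; have [s [k ->]] := sp b.
elim: s => [|a s [s' [Hs E]]]; first by exists [::]; rewrite !big_nil.
exists ((k a, Wlin a, Wtr a) :: s'); split; last by rewrite !big_cons EE_E E.
by move=> p; rewrite inE => /orP [/eqP -> /=|/Hs //]; case: a => -[].
Qed.

Lemma EE_Ew w x : inW0 R w -> inX R x -> EE w x = Ew w * Ex x.
Proof. by move=> Hw Hx; rewrite EE_mul // mulmx0 add0r mulmx1. Qed.
Lemma Ex0 : Ex 0 = 1.
Proof.
have [s [Hs E]] := EE_span 1; rewrite -[LHS]mulr1 E mulr_sumr big_seq [RHS]big_seq.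
apply: eq_bigr => p /Hs [Hw Hx]; rewrite -scalerAr EE_mul //.
by rewrite mul1mx mulmx0 add0r.
Qed.
Lemma Ew1 : Ew 1%:M = 1. Proof. exact: Ex0. Qed.
Lemma ExD x y : inX R x -> inX R y -> Ex (x + y) = Ex x * Ex y.
Proof. by move=> Hx Hy; rewrite EE_mul // invmx1 !mul1mx. Qed.
Lemma ExN x : inX R x -> Ex x * Ex (- x) = 1.
Proof. by move=> Hx; rewrite -ExD ?subrr ?Ex0 //; exact: inXN. Qed.
Lemma Ex_comm x y : inX R x -> inX R y -> Ex x * Ex y = Ex y * Ex x.
Proof. by move=> Hx Hy; rewrite -!ExD // addrC. Qed.
Lemma EwM w w' : inW0 R w -> inW0 R w' -> Ew w * Ew w' = Ew (w *m w').
Proof. by move=> Hw Hw'; rewrite EE_mul // mulmx0 addr0. Qed.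
Lemma EwV w : inW0 R w -> Ew w * Ew (invmx w) = 1.
Proof. by move=> Hw; rewrite EwM ?mulmxV ?(W0_unit HR Hw) ?Ew1 //; exact: (W0_invmx HR Hw). Qed.
Lemma EwVl w : inW0 R w -> Ew (invmx w) * Ew w = 1.
Proof. by move=> Hw; rewrite EwM ?mulVmx ?(W0_unit HR Hw) ?Ew1 //; exact: (W0_invmx HR Hw). Qed.
Lemma Ex_Ew x w : inX R x -> inW0 R w -> Ex x * Ew w = Ew w * Ex (invmx w *m x).
Proof.
move=> Hx Hw; rewrite EE_mul // EE_mul //; last exact: inX_W0 (W0_invmx HR Hw) Hx.
by rewrite mul1mx mulmx1 mulmx0 addr0 add0r.
Qed.

Lemma inX_ind (P : 'cV[rat]_n -> Prop) : P 0 -> (forall i, P (om i)) ->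
  (forall x y, inX R x -> inX R y -> P x -> P y -> P (x + y)) -> (forall x, inX R x -> P x -> P (- x)) ->
  forall x, inX R x -> P x.
Proof.
move=> P0 Pom PD PN x Xx.
have Pn i k : P (om i *+ k).
  elim: k => [|k IH]; first by rewrite mulr0n.
  by rewrite mulrS; apply: PD => //; [exact: om_X|apply: inXMn; exact: om_X].
suff [_ ] : inX R (\sum_i pr x (al i) *: om i) /\ P (\sum_i pr x (al i) *: om i) by rewrite -omE.
elim/big_rec: _ => [|i y _ [Xy Py]]; first by split.
have [z ->] := Xx _ (al_root i); rewrite scaler_int.
have Xk k : inX R (om i *+ k) by apply: inXMn; exact: om_X.
case: z => k.
  by rewrite -pmulrn; split; [apply: inXD|apply: PD].
rewrite NegzE mulrNz -pmulrn; split; first by apply: inXD => //; exact: inXN.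
by apply: PD => //; [exact: inXN|exact: PN].
Qed.

Lemma W0s_card_neq0 : (size W0s)%:R != 0 :> cplx.
Proof.
have : 1%:M \in W0s by apply/W0P.
by case: W0s => // w s _; exact: cplx_natr_neq0.
Qed.

Section Character.
Variable c : A -> cplx.
Hypotheses (cD : forall a b, c (a + b) = c a + c b) (cZ : forall k a, c (k *: a) = k * c a)
  (cM : forall a b, c (a * b) = c a * c b) (c1 : c 1 = 1).

Lemma char_unit a b : a * b = 1 -> c a != 0.
Proof. by move=> E; apply/eqP => H; have := cM a b; rewrite E c1 H mul0r => /eqP; rewrite oner_eq0. Qed.
Lemma char0 : c 0 = 0. Proof. by have := cZ 0 0; rewrite scale0r mul0r. Qed.
Lemma charB a b : c (a - b) = c a - c b.
Proof. by rewrite -(scaleN1r b) cD cZ mulN1r. Qed.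
Lemma char_sum I (s : seq I) (F : I -> A) : c (\sum_(i <- s) F i) = \sum_(i <- s) c (F i).
Proof. by elim/big_rec2: _ => [|i x y _ <-]; rewrite ?char0 ?cD. Qed.

Let tau (i : 'I_n) := c (Ex (om i)).
Let tau0 i : tau i != 0. Proof. by apply: (char_unit (ExN (om_X i))). Qed.
Let y1 (i : 'I_n) := Ex (om i) - (tau i)%:A.

(** The left ideal generated by the [y1 k] with [k] in [s], by recursion so that one generator is
    split off at a time. *)
Fixpoint Kid (s : seq 'I_n) (b : A) : Prop :=
  if s is k :: s' then exists a b', Kid s' b' /\ b = b' + a * y1 k else b = 0.

Lemma Kid0 s : Kid s 0.
Proof. by elim: s => //= k s IH; exists 0, 0; rewrite mul0r addr0. Qed.
Lemma KidD s a b : Kid s a -> Kid s b -> Kid s (a + b).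
Proof.
elim: s a b => [|k s IH] a b /=; first by move=> -> ->; rewrite addr0.
move=> [a1 [a2 [Ka ->]]] [b1 [b2 [Kb ->]]]; exists (a1 + b1), (a2 + b2).
by split; [exact: IH | rewrite mulrDl addrACA].
Qed.
Lemma KidM s a b : Kid s b -> Kid s (a * b).
Proof.
elim: s b => [|k s IH] b /=; first by move=> ->; rewrite mulr0.
move=> [b1 [b2 [Kb ->]]]; exists (a * b1), (a * b2).
by split; [exact: IH | rewrite mulrDr mulrA].
Qed.
Lemma KidZ s k b : Kid s b -> Kid s (k *: b).
Proof. by move=> Kb; rewrite -[b]mul1r scalerAl; exact: KidM. Qed.
Lemma KidB s a b : Kid s a -> Kid s b -> Kid s (a - b).
Proof. by move=> Ka Kb; rewrite -(scaleN1r b); apply: KidD => //; exact: KidZ. Qed.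
Lemma Kid_sum s I (r : seq I) (P : pred I) (F : I -> A) : (forall i, P i -> Kid s (F i)) ->
  Kid s (\sum_(i <- r | P i) F i).
Proof. by move=> H; elim/big_rec: _ => [|i x Pi Kx]; [exact: Kid0|apply: KidD => //; exact: H]. Qed.
Lemma Kid_char s b : Kid s b -> c b = 0.
Proof.
elim: s b => [|k s IH] b /=; first by move=> ->; exact: char0.
by move=> [a [b' [/IH H ->]]]; rewrite cD cM H /y1 charB cZ c1 mulr1 subrr mulr0 addr0.
Qed.
Lemma y1_comm i j : y1 i * y1 j = y1 j * y1 i.
Proof.
have sc (k : cplx) x : GRing.comm x (k%:A : A) by rewrite /GRing.comm -scalerAl -scalerAr mul1r mulr1.
apply: commrB; last exact: sc.
apply: commr_sym; apply: commrB; last exact: sc.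
by apply: Ex_comm; exact: om_X.
Qed.
Lemma Kid_y1 s b k : Kid s b -> Kid s (b * y1 k).
Proof.
elim: s b => [|j s IH] b /=; first by move=> ->; rewrite mul0r.
move=> [a [b' [Kb ->]]]; exists (a * y1 k), (b' * y1 k); split; first exact: IH.
by rewrite mulrDl -!mulrA y1_comm.
Qed.
Lemma Kid_y1_mem s k b : k \in s -> Kid s (b * y1 k).
Proof.
elim: s => // j s IH; rewrite inE => /orP [/eqP ->|/IH H] /=; last by exists 0, (b * y1 k); rewrite mul0r addr0.
by exists b, 0; rewrite add0r; split=> //; exact: Kid0.
Qed.

Lemma eq_linear (p p' : A -> A) : linear_map p -> linear_map p' ->
  (forall w x, inW0 R w -> inX R x -> p (EE w x) = p' (EE w x)) -> forall b, p b = p' b.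
Proof.
move=> Hp Hp' E b; have [s [Hs ->]] := EE_span b; rewrite big_seq.
elim/big_rec: _ => [|a z /Hs [Hw Hx] Ez]; first by rewrite (lm0 Hp) (lm0 Hp').
by rewrite (lmD Hp) (lmD Hp') Ez !(lmZ Hp, lmZ Hp') E.
Qed.

Fixpoint gpos (Y' : A) (t : cplx) (m : nat) : A :=
  if m is m'.+1 then Y' * (t *: gpos Y' t m' + 1) else 0.
Fixpoint gneg (Y : A) (t : cplx) (m : nat) : A :=
  if m is m'.+1 then t^-1 *: (Y * gneg Y t m' - 1) else 0.
(* (Y^-m)(Y^m - t^m)/(Y - t), a solution of Y g (m + 1) = t g m + 1 with g 0 = 0. *)
Definition gint (Y Y' : A) (t : cplx) (m : int) : A :=
  match m with Posz k => gpos Y' t k | Negz k => gneg Y t k.+1 end.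

Lemma gint_rec Y Y' t m : Y * Y' = 1 -> t != 0 -> Y * gint Y Y' t (m + 1) = t *: gint Y Y' t m + 1.
Proof.
move=> YY' t0; case: m => [k|k].
  by rewrite /= addn1 /= mulrA YY' mul1r.
have -> : Negz k + 1 = if k is k'.+1 then Negz k' else 0 by case: k => // k; rewrite !NegzE; lia.
by case: k => [|k] /=; rewrite scalerA mulfV // scale1r subrK.
Qed.
Lemma gint_comm Y Y' t m b : Y * b = b * Y -> Y' * b = b * Y' -> gint Y Y' t m * b = b * gint Y Y' t m.
Proof.
move=> E E'; case: m => k /=.
  elim: k => [|k IH] /=; first by rewrite mul0r mulr0.
  have H : (t *: gpos Y' t k + 1) * b = b * (t *: gpos Y' t k + 1).
    by rewrite mulrDl mulrDr mul1r mulr1 -scalerAl -scalerAr IH.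
  by rewrite -mulrA H mulrA E' -mulrA.
rewrite -/(gneg Y t k.+1); elim: k.+1 => [|m IH] /=; first by rewrite mul0r mulr0.
by rewrite -scalerAl -scalerAr mulrBl mulrBr mul1r mulr1 -mulrA IH mulrA E -mulrA.
Qed.

(** Division by Y - tau_k, where Y = e_(om k): the factor Y^m of a basis element is replaced by the
    quotient of Y^m - tau_k^m by Y - tau_k. The other variables are not touched, hence the
    compatibility with [y1 j]. *)
Lemma retraction k : exists r, [/\ linear_map r, forall b, r (b * y1 k) = b
  & forall b j, j != k -> r (b * y1 j) = r b * y1 j].
Proof.
pose Y := Ex (om k); pose Y' := Ex (- om k); pose g x := gint Y Y' (tau k) (numq (pr x (al k))).
have [r [rD rZ rT]] := linear_extension (fun a : Wel R => EE (Wlin a) (Wtr a) * g (Wtr a)) (proj1 He).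
have Hr : linear_map r by [].
have rE w x : inW0 R w -> inX R x -> r (EE w x) = EE w x * g x.
  by move=> Hw Hx; have [a [a1 a2 E]] := EE_ex Hw Hx; rewrite {1}E rT a1 a2.
have EEom w x i : inW0 R w -> inX R x -> EE w x * Ex (om i) = EE w (x + om i).
  by move=> Hw Hx; rewrite EE_mul ?mulmx1 ?invmx1 ?mul1mx //; exact: om_X.
have gom x i : inX R x -> g (x + om i) = gint Y Y' (tau k) (numq (pr x (al k)) + (i == k)).
  move=> Hx; rewrite /g pairingD pr_om; have [m ->] := Hx _ (al_root k).
  by rewrite -[(i == k)%:R]/((i == k : int)%:~R) -rmorphD !numq_int.
have lr i : linear_map (fun b => r (b * y1 i)).
  by split=> [a b|x a]; rewrite ?mulrDl ?rD // -scalerAl rZ.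
have rY i : linear_map (fun b => r b * y1 i).
  by split=> [a a'|x a]; rewrite ?rD ?mulrDl // rZ scalerAl.
exists r; split=> //.
  apply: (eq_linear (lr k)) => // w x Hw Hx.
  rewrite mulrBr mulr_algr rD -scaleN1r rZ scaleN1r rZ EEom // !rE //; last by apply: inXD => //; exact: om_X.
  rewrite gom // eqxx -EEom // -mulrA gint_rec ?tau0 //; last by apply: ExN; exact: om_X.
  by rewrite mulrDr mulr1 -scalerAr addrAC subrr add0r.
move=> b j jk; suff H w x : inW0 R w -> inX R x -> r (EE w x * y1 j) = r (EE w x) * y1 j.
  exact: (eq_linear (lr j) (rY j) H b).
move=> Hw Hx.
rewrite [in LHS]mulrBr mulr_algr rD -scaleN1r rZ scaleN1r rZ EEom // !rE //; last by apply: inXD => //; exact: om_X.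
rewrite gom // (negbTE jk) addr0 -EEom // [RHS]mulrBr mulr_algr; congr (_ - _).
rewrite -!mulrA; congr (_ * _); apply/esym/gint_comm; apply: Ex_comm; try exact: om_X.
by apply: inXN; exact: om_X.
Qed.

(** Higman's criterion for A / Kid s over the finite Hecke algebra, one generator at a time. Right
    multiplication by [y1 k] embeds A / Kid s into itself with a linear retraction; averaging makes
    the retraction linear over the finite Hecke algebra, so the quotient A / Kid (k :: s) is a
    direct summand. *)
Lemma averaging_step (s : seq 'I_n) : uniq s -> exists p, [/\ linear_map p, forall b, Kid s b -> Kid s (p b)
  & forall b, Kid s (Av p b - b)].
Proof.
elim: s => [_|k s IH /= /andP [ks us]].
  have [p [Hp E]] := straight_part; exists p; split=> // b; last by rewrite E subrr.
  by move=> ->; exact: lm0.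
have [p [Hp pK pAv]] := IH us; have [r [Hr rk rj]] := retraction k.
have Hpr : linear_map (fun b => p (r b)).
  by split=> [a b|x a]; [rewrite (lmD Hr) (lmD Hp)|rewrite (lmZ Hr) (lmZ Hp)].
have rK b : Kid s b -> Kid s (r b).
  elim: (s) ks b => [|j s' IH'] /= ks b; first by move=> ->; exact: lm0.
  move: ks; rewrite inE negb_or => /andP [kj ks'] [a [b' [Kb ->]]].
  by exists (r a), (r b'); split; [exact: IH'|rewrite (lmD Hr) rj // eq_sym].
pose rt := Av (fun b => p (r b)); have Hrt : linear_map rt by exact: Av_linear.
have rtK b : Kid s b -> Kid s (rt b).
  by move=> Kb; apply: Kid_sum => w _; apply/KidZ/KidM/pK/rK/KidM.
have rt1 b : rt (b * y1 k) = Av p b.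
  by apply: eq_bigr => w _; rewrite mulrA rk.
(* The projection complementary to the averaged retraction [rt]. Modulo [Kid s] it kills the
   multiples of [y1 k] and thus lifts A / Kid (k :: s) to A / Kid s. *)
pose pi b := b - rt b * y1 k.
have Hpi : linear_map pi.
  split=> [a b|x a]; rewrite /pi; first by rewrite (lmD Hrt) mulrDl opprD addrACA.
  by rewrite (lmZ Hrt) -scalerAl -scalerBr.
have piK b : Kid (k :: s) b -> Kid s (pi b).
  move=> /= [a [b' [Kb ->]]]; rewrite (lmD Hpi); apply: KidD.
    by apply: KidB => //; apply: Kid_y1; exact: rtK.
  rewrite /pi rt1 -mulrBl -opprB mulNr -scaleN1r; apply: KidZ; apply: Kid_y1; exact: pAv.
have KS b : Kid s b -> Kid (k :: s) b by move=> Kb; exists 0, b; rewrite mul0r addr0.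
have Hpp : linear_map (fun b => p (pi b)).
  by split=> [a b|x a]; [rewrite (lmD Hpi) (lmD Hp)|rewrite (lmZ Hpi) (lmZ Hp)].
exists (fun b => p (pi b)); split=> // [b Kb|b]; first by apply/KS/pK/piK.
have -> : Av (fun b => p (pi b)) b = Av p (pi b).
  rewrite /Av big_seq [RHS]big_seq; apply: eq_bigr => w /W0P Hw.
  have -> // : pi (Tw (invmx w) * b) = Tw (invmx w) * pi b.
  by rewrite /pi (mulrBr (Tw _)) mulrA /rt Av_Tw //; exact: W0_invmx.
have -> : Av p (pi b) - b = (Av p (pi b) - pi b) - rt b * y1 k by rewrite -addrA; congr (_ + _); rewrite /pi opprB addrAC subrr add0r.
by apply: (@KidB (k :: s)); [apply: KS; exact: pAv|apply: Kid_y1_mem; rewrite inE eqxx].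
Qed.

Let I := index_enum 'I_n.
Lemma Kid_Ex x : inX R x -> Kid I (Ex x - (c (Ex x))%:A).
Proof.
move: x; apply: inX_ind.
- by rewrite Ex0 c1 scale1r subrr; exact: Kid0.
- by move=> i; rewrite -[_ - _]mul1r; apply: Kid_y1_mem; rewrite mem_index_enum.
- move=> x y Xx Xy Kx Ky; rewrite ExD // cM.
  have -> : Ex x * Ex y - (c (Ex x) * c (Ex y))%:A =
      Ex x * (Ex y - (c (Ex y))%:A) + c (Ex y) *: (Ex x - (c (Ex x))%:A).
    by rewrite mulrBr mulr_algr scalerBr addrA subrK scalerA mulrC.
  by apply: KidD; [exact: KidM|exact: KidZ].
move=> x Xx Kx; have E := ExN Xx; have c0 := char_unit E.
have Ec : c (Ex (- x)) = (c (Ex x))^-1 by apply: (mulfI c0); rewrite -cM E c1 mulfV.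
have -> : Ex (- x) - (c (Ex (- x)))%:A = - (c (Ex x))^-1 *: (Ex (- x) * (Ex x - (c (Ex x))%:A)).
  rewrite mulrBr mulr_algr Ex_comm ?E //; last exact: inXN.
  by rewrite Ec scalerBr scalerA mulNr mulVf // !scaleNr scale1r opprK addrC.
by apply/KidZ/KidM.
Qed.

(** |W0| times the idempotent of [c] in the group algebra of W0. Modulo [Kid I] it spans a line on
    which A acts by [c], and [c] does not vanish on it. *)
Definition zc := \sum_(w <- W0s) (c (Ew w))^-1 *: Ew w.
Lemma char_zc : c zc = (size W0s)%:R.
Proof.
rewrite char_sum -sum1_size natr_sum big_seq [RHS]big_seq; apply: eq_bigr => w /W0P Hw.
by rewrite cZ mulVf // (char_unit (EwV Hw)).
Qed.

Lemma zc_eigen b : Kid I (b * zc - c b *: zc).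
Proof.
have [s [Hs ->]] := EE_span b; rewrite big_seq; elim/big_rec: _ => [|p x /Hs [Hw Hx] Kx].
  by rewrite mul0r char0 scale0r subrr; exact: Kid0.
rewrite mulrDl cD cZ scalerDl opprD addrACA; apply: KidD => //.
rewrite -scalerAl -scalerA -scalerBr; apply: KidZ.
move: (p.1.2) (p.2) Hw Hx => u y Hu Hy.
have cu := char_unit (EwV Hu); have Hui := W0_invmx HR Hu.
have Eyw w : inW0 R w -> c (Ex (invmx w *m y)) = c (Ex y).
  move=> Hw; have := Ex_Ew Hy Hw => /(congr1 c); rewrite !cM mulrC.
  by move/(mulfI (char_unit (EwV Hw))).
have E1 : \sum_(w <- W0s) (c (Ew w))^-1 *: (Ew (u *m w) * (c (Ex y))%:A) = c (EE u y) *: zc.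
  rewrite /zc -[X in _ = _ *: X](perm_big _ (W0s_mull HR W0u W0P Hu)) big_map /= scaler_sumr.
  rewrite big_seq [RHS]big_seq; apply: eq_bigr => w /W0P Hw; have cw := char_unit (EwV Hw).
  rewrite mulr_algr !scalerA EE_Ew // cM -EwM // cM invfM; congr (_ *: _).
  by field; rewrite cu cw.
rewrite -E1 /zc mulr_sumr -sumrB big_seq; apply: Kid_sum => w /W0P Hw.
rewrite EE_Ew // -mulrA -scalerAr Ex_Ew // -scalerAr -scalerBr mulrA EwM // -(Eyw w Hw) -mulrBr.
by apply/KidZ/KidM/Kid_Ex; apply: inX_W0 => //; exact: W0_invmx.
Qed.

(* The character c, restricted to the finite Hecke algebra, is projective. *)
Theorem poincare_neq0 : \sum_(w <- W0s) q ^- l0 w * (c (Tw w) * c (Tw (invmx w))) != 0.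
Proof.
have [|p [Hp pK pAv]] := @averaging_step I; first exact: index_enum_uniq.
have := Kid_char (pAv zc); rewrite charB => /eqP; rewrite subr_eq0 => /eqP E.
apply/eqP => H0; move: W0s_card_neq0; rewrite -char_zc -E /Av char_sum.
have -> : \sum_(w <- W0s) c (q ^- l0 w *: (Tw w * p (Tw (invmx w) * zc))) =
    (\sum_(w <- W0s) q ^- l0 w * (c (Tw w) * c (Tw (invmx w)))) * c (p zc).
  rewrite mulr_suml; apply: eq_bigr => w _; rewrite cZ cM -!mulrA; do 2 congr (_ * _).
  apply/eqP; rewrite -subr_eq0 -cZ -charB -(lmZ Hp) -(lmB Hp); apply/eqP/(@Kid_char I)/pK/zc_eigen.
by rewrite H0 mul0r eqxx.
Qed.

(** * Values of q excluded by a character *)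

Section Quantum.
Variables (i j : 'I_n) (a b : nat).
Hypotheses (cij : c (Ti i) = c (Ti j)).
Hypotheses (aE : pr (al j) (al i) = - a%:R) (bE : pr (al i) (al j) = - b%:R).
Let F (w : 'M[rat]_n) := q ^- l0 w * (c (Tw w) * c (Tw (invmx w))).
(** The ratio of the terms of w s_k and w when the length increases and c(T_k) = c(T_i). It is q or
    q^-1 according as c(T_i) is q or -1. *)
Let kap := c (Ti i) * c (Ti i) / q.

Lemma term_step w k : inW0 R w -> w *m al k \in pos -> c (Ti k) = c (Ti i) -> F (w *m sr k) = kap * F w.
Proof.
move=> Hw Hp Ek; rewrite /F l0_mulr // (invmxM Hw (W0_sr k)) invmx_sr -Tw_mulr // -Tw_mull; last 2 first.
- exact: W0_invmx.
- by rewrite invmxK.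
by rewrite !cM Ek exprS invfM /kap; ring.
Qed.

(* The images of al i and al j under the partial products of the longest word of <s_i, s_j>. *)
Lemma word_stepi (w u : 'M[rat]_n) (k1 k2 l1 l2 : rat) s : inW0 R w -> w *m al i \in pos -> w *m al j \in pos ->
  0 <= k1 -> 0 <= k2 ->
  [/\ inW0 R u, u *m al i = k1 *: (w *m al i) + k2 *: (w *m al j),
     u *m al j = l1 *: (w *m al i) + l2 *: (w *m al j) & F u = kap ^+ s * F w] ->
  [/\ inW0 R (u *m sr i), (u *m sr i) *m al i = (- k1) *: (w *m al i) + (- k2) *: (w *m al j),
     (u *m sr i) *m al j = (l1 + a%:R * k1) *: (w *m al i) + (l2 + a%:R * k2) *: (w *m al j)
   & F (u *m sr i) = kap ^+ s.+1 * F w].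
Proof.
move=> Hw Hi Hj k10 k20 [Hu E1 E2 EF].
have Hp : u *m al i \in pos.
  by apply: (pos_comb2 _ Hi Hj k10 k20 E1); apply: W0_rootD => //; exact: al_root.
split; first by apply: W0_mul => //; exact: W0_sr.
- by rewrite -mulmxA sr_al mulmxN E1 opprD !scaleNr.
- rewrite -mulmxA srE aE scaleNr opprK mulmxDr -scalemxAr E1 E2 !scalerDr !scalerDl !scalerA.
  by rewrite addrACA.
by rewrite term_step // EF exprS mulrA.
Qed.
Lemma word_stepj (w u : 'M[rat]_n) (k1 k2 l1 l2 : rat) s : inW0 R w -> w *m al i \in pos -> w *m al j \in pos ->
  0 <= l1 -> 0 <= l2 ->
  [/\ inW0 R u, u *m al i = k1 *: (w *m al i) + k2 *: (w *m al j),
     u *m al j = l1 *: (w *m al i) + l2 *: (w *m al j) & F u = kap ^+ s * F w] ->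
  [/\ inW0 R (u *m sr j), (u *m sr j) *m al i = (k1 + b%:R * l1) *: (w *m al i) + (k2 + b%:R * l2) *: (w *m al j),
     (u *m sr j) *m al j = (- l1) *: (w *m al i) + (- l2) *: (w *m al j)
   & F (u *m sr j) = kap ^+ s.+1 * F w].
Proof.
move=> Hw Hi Hj l10 l20 [Hu E1 E2 EF].
have Hp : u *m al j \in pos.
  by apply: (pos_comb2 _ Hi Hj l10 l20 E2); apply: W0_rootD => //; exact: al_root.
split; first by apply: W0_mul => //; exact: W0_sr.
- rewrite -mulmxA srE bE scaleNr opprK mulmxDr -scalemxAr E1 E2 !scalerDr !scalerDl !scalerA.
  by rewrite addrACA.
- by rewrite -mulmxA sr_al mulmxN E2 opprD !scaleNr.
by rewrite term_step // EF exprS mulrA.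
Qed.

Definition coxeter_number := if a == 1%N then 3%N else if a == 2%N then 4%N else 6%N.
Lemma long_word : b = 1%N -> (a = 1 \/ a = 2 \/ a = 3)%N -> exists v, [/\ inW0 R v,
   (v *m al i = - al i /\ v *m al j = - al j) \/ (v *m al i = - al j /\ v *m al j = - al i)
 & forall w, inW0 R w -> w *m al i \in pos -> w *m al j \in pos -> F (w *m v) = kap ^+ coxeter_number * F w].
Proof.
move=> b1 Ha.
pose v := if a == 1%N then sr i *m sr j *m sr i else if a == 2%N then sr i *m sr j *m sr i *m sr j
  else sr i *m sr j *m sr i *m sr j *m sr i *m sr j.
have key w : inW0 R w -> w *m al i \in pos -> w *m al j \in pos ->
   [/\ inW0 R (w *m v),  w *m v *m al i = (if a == 1%N then - (w *m al j) else - (w *m al i)),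
     w *m v *m al j = (if a == 1%N then - (w *m al i) else - (w *m al j))
    & F (w *m v) = kap ^+ coxeter_number * F w].
  move=> Hw Hi Hj.
  pose st u (k1 k2 l1 l2 : rat) s := [/\ inW0 R u, u *m al i = k1 *: (w *m al i) + k2 *: (w *m al j),
     u *m al j = l1 *: (w *m al i) + l2 *: (w *m al j) & F u = kap ^+ s * F w].
  have S0 : st w 1 0 0 1 0%N.
    by rewrite /st !scale1r !scale0r addr0 add0r expr0 mul1r.
  have SI u k1 k2 l1 l2 k1' k2' l1' l2' s : st u k1 k2 l1 l2 s -> 0 <= k1 -> 0 <= k2 -> k1' = - k1 ->
      k2' = - k2 -> l1' = l1 + a%:R * k1 -> l2' = l2 + a%:R * k2 -> st (u *m sr i) k1' k2' l1' l2' s.+1.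
    by move=> H H1 H2 -> -> -> ->; exact: word_stepi.
  have SJ u k1 k2 l1 l2 k1' k2' l1' l2' s : st u k1 k2 l1 l2 s -> 0 <= l1 -> 0 <= l2 -> k1' = k1 + b%:R * l1 ->
      k2' = k2 + b%:R * l2 -> l1' = - l1 -> l2' = - l2 -> st (u *m sr j) k1' k2' l1' l2' s.+1.
    by move=> H H1 H2 -> -> -> ->; exact: word_stepj.
  rewrite /v /coxeter_number; move: Ha SI SJ; rewrite b1 => -[->|[->|->]] SI SJ; rewrite /= !mulmxA.
  - have S1 : st (w *m sr i) (-1) 0 1 1 1%N by apply: SI S0 _ _ _ _ _ _; lra.
    have S2 : st (w *m sr i *m sr j) 0 1 (-1) (-1) 2 by apply: SJ S1 _ _ _ _ _ _; lra.
    have [] : st (w *m sr i *m sr j *m sr i) 0 (-1) (-1) 0 3 by apply: SI S2 _ _ _ _ _ _; lra.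
    by rewrite !scale0r !scaleN1r add0r addr0.
  - have S1 : st (w *m sr i) (-1) 0 2 1 1%N by apply: SI S0 _ _ _ _ _ _; lra.
    have S2 : st (w *m sr i *m sr j) 1 1 (-2) (-1) 2 by apply: SJ S1 _ _ _ _ _ _; lra.
    have S3 : st (w *m sr i *m sr j *m sr i) (-1) (-1) 0 1 3 by apply: SI S2 _ _ _ _ _ _; lra.
    have [] : st (w *m sr i *m sr j *m sr i *m sr j) (-1) 0 0 (-1) 4 by apply: SJ S3 _ _ _ _ _ _; lra.
    by rewrite !scale0r !scaleN1r add0r addr0.
  have S1 : st (w *m sr i) (-1) 0 3 1 1%N by apply: SI S0 _ _ _ _ _ _; lra.
  have S2 : st (w *m sr i *m sr j) 2 1 (-3) (-1) 2 by apply: SJ S1 _ _ _ _ _ _; lra.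
  have S3 : st (w *m sr i *m sr j *m sr i) (-2) (-1) 3 2 3 by apply: SI S2 _ _ _ _ _ _; lra.
  have S4 : st (w *m sr i *m sr j *m sr i *m sr j) 1 1 (-3) (-2) 4 by apply: SJ S3 _ _ _ _ _ _; lra.
  have S5 : st (w *m sr i *m sr j *m sr i *m sr j *m sr i) (-1) (-1) 0 1 5 by apply: SI S4 _ _ _ _ _ _; lra.
  have [] : st (w *m sr i *m sr j *m sr i *m sr j *m sr i *m sr j) (-1) 0 0 (-1) 6 by apply: SJ S5 _ _ _ _ _ _; lra.
  by rewrite !scale0r !scaleN1r add0r addr0.
have [] := key 1%:M (W0_1 R); rewrite ?mul1mx ?al_pos // => Hv E1 E2 _; exists v; split=> //.
  by move: E1 E2; case: ifP => _; [right|left].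
by move=> w Hw Hi Hj; have [] := key w Hw Hi Hj.
Qed.

Lemma sum_W0r (P : pred 'M[rat]_n) (G : 'M[rat]_n -> cplx) v : inW0 R v ->
  \sum_(w <- W0s | P w) G w = \sum_(w <- W0s | P (w *m v)) G (w *m v).
Proof. by move=> Hv; rewrite -(perm_big _ (W0s_mulr HR W0u W0P Hv)) big_map. Qed.

(** The sum is a multiple of the Poincare polynomial (1 + k)(1 + k + ... + k^(m-1)) of <s_i, s_j> at
    k = [kap], with m the order of s_i s_j. Instead of cosets, four partial sums are used, by the
    signs of w al_i and w al_j; right multiplication by s_i, s_j and the longest element [v] relates
    them. *)
Lemma poincare_quantum : b = 1%N -> (a = 1 \/ a = 2 \/ a = 3)%N -> q != 1 ->
  q != -1 /\ q ^+ coxeter_number != 1.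
Proof.
move=> b1 Ha q1; have := poincare_neq0.
rewrite -/F => S0.
have [v [Hv Ev EF]] := long_word b1 Ha.
pose sa w := w *m al i \in pos; pose sb w := w *m al j \in pos.
pose p := \sum_(w <- W0s | sa w && sb w) F w; pose x := \sum_(w <- W0s | sa w && ~~ sb w) F w.
pose y := \sum_(w <- W0s | ~~ sa w && sb w) F w; pose z := \sum_(w <- W0s | ~~ sa w && ~~ sb w) F w.
have SE : \sum_(w <- W0s) F w = (p + x) + (y + z).
  by rewrite (bigID sa) /= (bigID sb) /= [X in _ + X](bigID sb).
have ES k C : (forall w, C w = (w *m al k \in pos)) -> c (Ti k) = c (Ti i) ->
    \sum_(w <- W0s | ~~ C w) F w = kap * \sum_(w <- W0s | C w) F w.
  move=> EC Ek; rewrite (sum_W0r _ _ (W0_sr k)) mulr_sumr big_seq_cond [RHS]big_seq_cond.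
  have E w : (w \in W0s) && ~~ C (w *m sr k) = (w \in W0s) && C w.
    case: (boolP (w \in W0s)) => //= /W0P Hw.
    by rewrite !EC -mulmxA sr_al mulmx_posN ?negbK ?al_root.
  rewrite (eq_bigl _ _ E); apply: eq_bigr => w /andP [/W0P Hw]; rewrite EC => Hp.
  exact: term_step.
have E1 : y + z = kap * (p + x).
  have := ES i sa (fun=> erefl) erefl; rewrite (bigID sb) /= [X in _ = _ * X](bigID sb) /= => <-.
  by [].
have E2 : x + z = kap * (p + y).
  have := ES j sb (fun=> erefl) (esym cij); rewrite (bigID sa) /= [X in _ = _ * X](bigID sa) /=.
  rewrite /x /z /p /y => E.
  have -> : \sum_(w <- W0s | sa w && ~~ sb w) F w = \sum_(w <- W0s | ~~ sb w && sa w) F w.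
    by apply: eq_bigl => w; rewrite andbC.
  have -> : \sum_(w <- W0s | ~~ sa w && ~~ sb w) F w = \sum_(w <- W0s | ~~ sb w && ~~ sa w) F w.
    by apply: eq_bigl => w; rewrite andbC.
  rewrite E; congr (_ * (_ + _)); apply: eq_bigl => w; exact: andbC.
have E3 : z = kap ^+ coxeter_number * p.
  rewrite /z (sum_W0r _ _ Hv) mulr_sumr big_seq_cond [RHS]big_seq_cond.
  have E w : (w \in W0s) && (~~ sa (w *m v) && ~~ sb (w *m v)) = (w \in W0s) && (sa w && sb w).
    case: (boolP (w \in W0s)) => //= /W0P Hw; rewrite /sa /sb -!mulmxA.
    case: Ev => -[-> ->]; rewrite !mulmx_posN ?negbK ?al_root //.
    exact: andbC.
  rewrite (eq_bigl _ _ E); apply: eq_bigr => w /andP [/W0P Hw /andP [Hi Hj]].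
  exact: EF.
have kq : kap = q \/ kap = q^-1.
  have := congr1 c (Ti2 i); rewrite cM cD !cZ c1 mulr1 => Ec.
  have : (c (Ti i) - q) * (c (Ti i) + 1) == 0.
    by apply/eqP; rewrite mulrDr mulr1 mulrBl Ec; ring.
  rewrite mulf_eq0 subr_eq0 addr_eq0 => /orP [/eqP E|/eqP E]; rewrite /kap E; [left|right].
    by rewrite mulfK.
  by rewrite mulrNN mul1r mul1r.
have k1 : kap != 1 by case: kq => ->; rewrite // invr_eq1.
have kN : kap != -1.
  by apply/eqP => k; move: S0; rewrite SE E1 k mulN1r subrr eqxx.
(* If kap^m = 1, then z = p, and x = y because 1 + kap is nonzero. So (p + x)(kap - 1) = 0, and the
   whole sum 2(p + x) vanishes. *)
have km : kap ^+ coxeter_number != 1.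
  apply/eqP => k; move: S0; rewrite SE; set m := coxeter_number in E3 k.
  have : ((p + x) + (y + z)) * (kap - 1) = 0.
    rewrite k mul1r in E3; have Exy : y = kap * (p + x) - z by rewrite -E1 addrK.
    have : (1 + kap) * (x - y) = 0.
      have -> : (1 + kap) * (x - y) = (x + z) - (y + z) + kap * (p + x) - kap * (p + y) by ring.
      by rewrite E1 E2; ring.
    move=> /eqP; rewrite mulf_eq0 addrC addr_eq0 (negbTE kN) /= subr_eq0 => /eqP Ex'.
    rewrite -Ex' in E1 E2 *; rewrite E3 in E1 *.
    have -> : (p + x + (x + p)) * (kap - 1) = 2 * (kap * (p + x) - (x + p)) by ring.
    by rewrite -E1 subrr mulr0.
  by move=> /eqP; rewrite mulf_eq0 subr_eq0 (negbTE k1) orbF => ->.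
case: kq kN km => -> // H1 H2; split; first by rewrite -(inj_eq invr_inj) invrN1.
by rewrite -(inj_eq invr_inj) -exprVn invr1.
Qed.
End Quantum.
End Character.

(** * Modules over the group algebra *)

Definition ex (i : 'I_n) : A := Ex (om i).
Definition wB (s : 'cV[rat]_n -> cplx) : {ffun 'I_n -> cplx} := [ffun i => s (om i)].

Lemma wB_inj s s' : tchar R s -> tchar R s' -> wB s = wB s' -> forall x, inX R x -> s x = s' x.
Proof. by move=> Hs Hs' /ffunP E; apply: tchar_ext => // i; have := E i; rewrite !ffunE. Qed.

Definition xweight d (r : A -> 'M[cplx]_d) (s : 'cV[rat]_n -> cplx) (v : 'rV[cplx]_d) :=
  forall x, inX R x -> v *m r (Ex x) = s x *: v.

Lemma xweight_ex d (r : A -> 'M[cplx]_d) : is_rep r -> (0 < d)%N ->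
  exists s v, [/\ tchar R s, v != 0 & xweight r s v].
Proof.
move=> Hr d0; have [i j|k [v [v0 Hv]]] := @common_eigenvector d _ (fun i => r (ex i)) (index_enum 'I_n) d0.
  by rewrite -!(repM Hr) /ex Ex_comm //; exact: om_X.
have ex_s x : exists l, inX R x -> v *m r (Ex x) = l *: v.
  have [Xx|] := excluded_middle_informative (inX R x); last by exists 0.
  move: x Xx; apply: inX_ind.
  - by exists 1 => _; rewrite Ex0 (rep1 Hr) mulmx1 scale1r.
  - by move=> i; exists (k i) => _; rewrite Hv // mem_index_enum.
  - move=> x y Xx Xy [l1 /(_ Xx) E1] [l2 /(_ Xy) E2]; exists (l2 * l1) => _.
    by rewrite ExD // Ex_comm // (repM Hr) mulmxA E1 -scalemxAl E2 scalerA mulrC.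
  move=> x Xx [l /(_ Xx) E]; exists l^-1 => _.
  have E1 : v *m r (Ex x) *m r (Ex (- x)) = v.
    by rewrite -mulmxA -(repM Hr) Ex_comm ?ExN ?(rep1 Hr) ?mulmx1 //; exact: inXN.
  have l0' : l != 0 by apply: contra v0 => /eqP l0'; rewrite -E1 E l0' scale0r mul0mx.
  by apply: (scalerI l0'); rewrite scalemxAl -E E1 scalerA mulfV // scale1r.
pose s x := sval (constructive_indefinite_description _ (ex_s x)).
have sP : xweight r s v by move=> x Xx; rewrite /s; case: constructive_indefinite_description => l /= /(_ Xx).
exists s, v; split=> //; split.
  move=> x y Xx Xy; apply/eqP; rewrite -subr_eq0; apply: contraT => H; case/negP: v0.
  have : (s (x + y) - s x * s y) *: v = 0.
    rewrite scalerBl -sP; last exact: inXD.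
    by rewrite ExD // Ex_comm // (repM Hr) mulmxA sP // -scalemxAl sP // scalerA subrr.
  by move/eqP; rewrite scaler_eq0 (negbTE H).
move=> x Xx; apply: contra v0 => /eqP s0.
have <- : v *m r (Ex x) *m r (Ex (- x)) = v.
  by rewrite -mulmxA -(repM Hr) Ex_comm ?ExN ?(rep1 Hr) ?mulmx1 //; exact: inXN.
by rewrite sP // s0 scale0r mul0mx.
Qed.

Lemma xweight_Ew d (r : A -> 'M[cplx]_d) s v w : is_rep r -> xweight r s v -> inW0 R w ->
  xweight r (tW w s) (v *m r (Ew w)).
Proof.
move=> Hr Hv Hw x Xx; rewrite -mulmxA -(repM Hr) Ex_Ew // (repM Hr) mulmxA Hv ?scalemxAl //.
by apply: inX_W0 => //; exact: W0_invmx.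
Qed.
Lemma Ew_neq0 d (r : A -> 'M[cplx]_d) (v : 'rV[cplx]_d) w : is_rep r -> v != 0 -> inW0 R w -> v *m r (Ew w) != 0.
Proof.
move=> Hr v0 Hw; apply: contra v0 => /eqP E.
by rewrite -[v]mulmx1 -(rep1 Hr) -(EwVl Hw) (repM Hr) mulmxA E mul0mx.
Qed.
Lemma xweight_wvec d (r : A -> 'M[cplx]_d) s v : xweight r s v -> wvec ex r (wB s) v.
Proof. by move=> Hv i; rewrite /ex Hv ?ffunE //; exact: om_X. Qed.

Lemma irred_span d (r : A -> 'M[cplx]_d) s v : is_rep r -> irred r -> v != 0 -> xweight r s v ->
  forall (P : 'rV[cplx]_d -> Prop), P 0 -> (forall x y, P x -> P y -> P (x + y)) -> (forall k x, P x -> P (k *: x)) ->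
  (forall w, inW0 R w -> P (v *m r (Ew w))) -> forall y, P y.
Proof.
move=> Hr [_ Hirr] v0 Hv P P0 PD PZ PW y; have [b ->] := Hirr v y v0.
have [l [Hl ->]] := EE_span b; rewrite (rep_sum Hr) mulmx_sumr big_seq.
elim/big_rec: _ => [|p x /Hl [Hw Hx] Px]; first exact: P0.
apply: PD => //; rewrite (repZ Hr) -scalemxAr; apply: (PZ).
by rewrite EE_Ew // (repM Hr) mulmxA Hv // -scalemxAl; apply: (PZ); exact: PW.
Qed.

Definition orb s := undup [seq wB (tW w s) | w <- W0s].
Lemma mem_orb s w : inW0 R w -> wB (tW w s) \in orb s.
Proof. by move=> Hw; rewrite mem_undup map_f //; apply/W0P. Qed.

Lemma orb_leq d (r : A -> 'M[cplx]_d) s v : is_rep r -> v != 0 -> xweight r s v -> (size (orb s) <= d)%N.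
Proof.
move=> Hr v0 Hv.
have HV c : exists u : 'rV[cplx]_d, c \in orb s -> u != 0 /\ wvec ex r c u.
  have [|_] := boolP (c \in orb s); last by exists 0.
  rewrite mem_undup => /mapP [w /W0P Hw ->]; exists (v *m r (Ew w)) => _.
  by split; [exact: Ew_neq0|exact/xweight_wvec/xweight_Ew].
apply: (weights_leq (V := fun c => sval (constructive_indefinite_description _ (HV c))) Hr (undup_uniq _)).
move=> c /=; case: (constructive_indefinite_description _ (HV c)) => u Hu /=; exact: Hu.
Qed.

(* A central element sum_w e_w f e_w^-1 with f in the span of X separates the W0-orbits of X-weights. *)
Lemma linked_orbit d (r : A -> 'M[cplx]_d) s v d' (r' : A -> 'M[cplx]_d') s' v' :
  is_rep r -> is_rep r' -> v != 0 -> xweight r s v -> v' != 0 -> xweight r' s' v' ->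
  tchar R s' -> (forall z, (forall a, z * a = a * z) -> exists k, r z = k%:M /\ r' z = k%:M) ->
  wB s' \in orb s.
Proof.
move=> Hr Hr' v0 Hv v0' Hv' Hs' Hlink; apply: contraT => Hn.
have [f0 [g [fc fg g1 g0]]] := weight_projector ex (orb s ++ orb s') (wB s').
have fEx y : inX R y -> f0 * Ex y = Ex y * f0.
  by move=> Xy; apply: fc => i; apply: Ex_comm => //; exact: om_X.
have [z zE] : exists z, z = \sum_(w <- W0s) Ew w * f0 * Ew (invmx w) by eexists.
have zEw u : inW0 R u -> z * Ew u = Ew u * z.
  move=> Hu; rewrite zE -{1}(perm_big _ (W0s_mull HR W0u W0P Hu)) big_map mulr_suml mulr_sumr.
  rewrite big_seq [RHS]big_seq; apply: eq_bigr => w /W0P Hw; have Hi := W0_invmx HR Hw.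
  rewrite (invmxM Hu Hw) -!EwM //; last exact: W0_invmx.
  by rewrite -!mulrA EwVl // mulr1.
have zEx x : inX R x -> z * Ex x = Ex x * z.
  move=> Xx; rewrite zE mulr_suml mulr_sumr big_seq [RHS]big_seq; apply: eq_bigr => w /W0P Hw.
  have Hi := W0_invmx HR Hw; have Xi := inX_W0 Hi Xx.
  have E : Ew (invmx w) * Ex x = Ex (invmx w *m x) * Ew (invmx w).
    by rewrite Ex_Ew // invmxK mulKVmx // (W0_unit HR Hw).
  by rewrite -!mulrA E (mulrA f0) fEx // !mulrA -Ex_Ew.
have zc a : z * a = a * z.
  have [l [Hl ->]] := EE_span a; rewrite mulr_suml mulr_sumr big_seq [RHS]big_seq; apply: eq_bigr => p /Hl [Hw Hx].
  by rewrite -scalerAl -scalerAr EE_Ew // mulrA zEw // -mulrA zEx // mulrA.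
have zv dd (rr : A -> 'M[cplx]_dd) ss (vv : 'rV_dd) : is_rep rr -> xweight rr ss vv ->
    vv *m rr z = (\sum_(w <- W0s) g (wB (tW (invmx w) ss))) *: vv.
  move=> Hrr Hvv; rewrite zE (rep_sum Hrr) mulmx_sumr scaler_suml big_seq [RHS]big_seq.
  apply: eq_bigr => w /W0P Hw; have Hi := W0_invmx HR Hw.
  rewrite !(repM Hrr) !mulmxA (fg _ _ _ _ Hrr (xweight_wvec (xweight_Ew Hrr Hvv Hi))).
  by rewrite -scalemxAl -mulmxA -(repM Hrr) EwV // (rep1 Hrr) mulmx1.
have [k [Ek Ek']] := Hlink z zc.
have := zv _ _ _ _ Hr Hv; rewrite Ek mul_mx_scalar big_seq big1 => [|w /W0P Hw]; last first.
  have Ho := mem_orb s (W0_invmx HR Hw).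
  by apply: g0; [rewrite mem_cat Ho|apply: contra Hn => /eqP <-].
rewrite scale0r => /eqP; rewrite scaler_eq0 (negbTE v0) orbF => /eqP k0.
have := zv _ _ _ _ Hr' Hv'; rewrite Ek' k0 mul_mx_scalar scale0r => /esym /eqP.
rewrite scaler_eq0 (negbTE v0') orbF.
have -> : \sum_(w <- W0s) g (wB (tW (invmx w) s')) = (count (fun w => wB (tW (invmx w) s') == wB s') W0s)%:R.
  rewrite -sum1_count natr_sum [RHS]big_mkcond big_seq [RHS]big_seq; apply: eq_bigr => w /W0P Hw.
  case: eqP => [->//|/eqP Hne]; apply: g0 => //; by rewrite mem_cat mem_orb ?orbT //; exact: W0_invmx.
have : has (fun w => wB (tW (invmx w) s') == wB s') W0s.
  apply/hasP; exists 1%:M; first by apply/W0P; exact: W0_1.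
  by apply/eqP/ffunP => i; rewrite !ffunE /tW !invmx1 mul1mx.
by rewrite has_count; case: count => // m _; rewrite (negbTE (cplx_natr_neq0 m)).
Qed.

Lemma wB_orb_W0 s s' w : tchar R s -> tchar R s' -> wB s' \in orb s -> inW0 R w -> wB (tW w s') \in orb s.
Proof.
move=> Hs Hs'; rewrite mem_undup => /mapP [u /W0P Hu E] Hw.
suff -> : wB (tW w s') = wB (tW (w *m u) s) by apply: mem_orb; apply: W0_mul.
apply/ffunP => i; rewrite !ffunE /tW (invmxM Hw Hu) -mulmxA.
rewrite (wB_inj Hs' (tW_tchar Hu Hs) E) //; apply: inX_W0; first exact: W0_invmx.
exact: om_X.
Qed.

(** An irreducible module is spanned by the weight vectors e_w v, so X acts diagonally and e_x is a
    combination of interpolating projectors, one for each weight of the orbit. [a] and [ch] depend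
    only on [s]; this is what allows two modules to be treated together in [pair_bound]. *)
Lemma orbit_projectors s : tchar R s -> exists (a : {ffun 'I_n -> cplx} -> A) (ch : {ffun 'I_n -> cplx} -> 'cV[rat]_n -> cplx),
  forall d (r : A -> 'M[cplx]_d) s' v, is_rep r -> irred r -> v != 0 -> xweight r s' v -> tchar R s' ->
    wB s' \in orb s -> forall w x, inW0 R w -> inX R x ->
    r (EE w x) = \sum_(c <- orb s) ch c x *: r (Ew w * a c).
Proof.
move=> Hs.
have Hc c : exists p : A * ('M[rat]_n * ({ffun 'I_n -> cplx} -> cplx)), c \in orb s ->
    [/\ inW0 R p.2.1, c = wB (tW p.2.1 s),
      forall d (r : A -> 'M[cplx]_d) c' v, is_rep r -> wvec ex r c' v -> v *m r p.1 = p.2.2 c' *: v,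
      p.2.2 c = 1 & forall c', c' \in orb s -> c' != c -> p.2.2 c' = 0].
  have [Oc|_] := boolP (c \in orb s); last by exists (0, (0, fun=> 0)).
  have := Oc; rewrite mem_undup => /mapP [w /W0P Hw Ew'].
  by have [f0 [g [_ H1 H2 H3]]] := weight_projector ex (orb s) c; exists (f0, (w, g)).
pose p c := sval (constructive_indefinite_description _ (Hc c)).
have pP c : c \in orb s -> [/\ inW0 R (p c).2.1, c = wB (tW (p c).2.1 s),
      forall d (r : A -> 'M[cplx]_d) c' v, is_rep r -> wvec ex r c' v -> v *m r (p c).1 = (p c).2.2 c' *: v,
      (p c).2.2 c = 1 & forall c', c' \in orb s -> c' != c -> (p c).2.2 c' = 0].
  by rewrite /p; case: (constructive_indefinite_description _ (Hc c)) => y Hy /=; exact: Hy.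
exists (fun c => (p c).1), (fun c x => tW (p c).2.1 s x).
move=> d r s' v Hr Hirr v0 Hv Hs' Hss' w x Hw Xx.
have key (y : 'rV[cplx]_d) : y *m r (Ex x) = y *m \sum_(c <- orb s) tW (p c).2.1 s x *: r (p c).1.
  move: y; apply: (irred_span Hr Hirr v0 Hv).
  - by rewrite !mul0mx.
  - by move=> y z E1 E2; rewrite mulmxDl E1 E2 mulmxDl.
  - by move=> k y E; rewrite -!scalemxAl E.
  move=> u Hu; have Hvu := xweight_Ew Hr Hv Hu; rewrite Hvu //.
  have Oc := wB_orb_W0 Hs Hs' Hss' Hu; set c' := wB (tW u s') in Oc.
  rewrite mulmx_sumr (bigD1_seq c') ?undup_uniq //= [X in _ + X]big_seq_cond [X in _ + X]big1 ?addr0.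
    have [Hw' Ec' Hp1 g1 _] := pP _ Oc.
    rewrite -scalemxAr (Hp1 _ _ _ _ Hr (xweight_wvec Hvu)) -/c' g1 scale1r; congr (_ *: _).
    exact: (wB_inj (tW_tchar Hu Hs') (tW_tchar Hw' Hs)).
  move=> c /andP [Oc1 Nc]; have [_ _ Hp1 _ g0] := pP _ Oc1.
  by rewrite -scalemxAr (Hp1 _ _ _ _ Hr (xweight_wvec Hvu)) -/c' g0 ?scale0r ?scaler0 // eq_sym.
have {}key : r (Ex x) = \sum_(c <- orb s) tW (p c).2.1 s x *: r (p c).1.
  by apply/row_matrixP => i; rewrite !rowE key.
rewrite EE_Ew // (repM Hr) key mulmx_suml; apply: eq_bigr => c _.
by rewrite (repM Hr) scalemxAl.
Qed.

Lemma orbit_bound m (Phi : A -> 'rV[cplx]_m) (O : seq {ffun 'I_n -> cplx}) a ch :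
  (forall x y, Phi (x + y) = Phi x + Phi y) -> (forall k x, Phi (k *: x) = k *: Phi x) ->
  (forall w x, inW0 R w -> inX R x -> Phi (EE w x) = \sum_(c <- O) ch c x *: Phi (Ew w * a c)) ->
  (forall y, exists b, y = Phi b) -> (m <= size W0s * size O)%N.
Proof.
move=> PD PZ PE Psurj.
rewrite -[(_ * _)%N](_ : #|{: 'I_(size W0s) * 'I_(size O)}| = _); last by rewrite card_prod !card_ord.
apply: (@spanned_leq _ _ _ (fun p : 'I_(size W0s) * 'I_(size O) =>
   Phi (Ew (nth 1%:M W0s p.1) * a (nth [ffun=> 0] O p.2)))) => y.
have [b ->] := Psurj y; have [l [Hl ->]] := EE_span b; rewrite big_seq; elim/big_rec: _ => [|p x /Hl [Hw Xx] [u Eu]].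
  exists (fun=> 0); rewrite big1 => [|i _]; last by rewrite scale0r.
  by have := PZ 0 0; rewrite !scale0r.
have [i Ei] := eW_ind Hw.
exists (fun k : 'I_(size W0s) * 'I_(size O) => (if k.1 == i then p.1.1 * ch (nth [ffun=> 0] O k.2) p.2 else 0) + u k).
rewrite PD Eu PZ (PE _ _ Hw Xx); under [RHS]eq_bigr => k _ do rewrite scalerDl.
rewrite big_split /=; congr (_ + _).
rewrite -(pair_bigA _ (fun (k1 : 'I_(size W0s)) (k2 : 'I_(size O)) => (if k1 == i then p.1.1 * ch (nth [ffun=> 0] O k2) p.2 else 0) *:
   Phi (Ew (nth 1%:M W0s k1) * a (nth [ffun=> 0] O k2)))) /=.
rewrite (bigD1 i) //= [X in _ + X]big1 ?addr0 => [|k /negbTE Hk]; last first.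
  by rewrite big1 // => k2 _; rewrite Hk scale0r.
rewrite scaler_sumr (big_nth [ffun=> 0]) big_mkord; apply: eq_bigr => k _.
by rewrite eqxx scalerA Ei.
Qed.

Lemma mxvec_rep_onto d1 d2 (r1 : A -> 'M[cplx]_d1) (r2 : A -> 'M[cplx]_d2) :
  (forall X Y, exists b, r1 b = X /\ r2 b = Y) ->
  forall y, exists b, y = row_mx (mxvec (r1 b)) (mxvec (r2 b)).
Proof.
move=> H y; have [b [E1 E2]] := H (vec_mx (lsubmx y)) (vec_mx (rsubmx y)).
by exists b; rewrite E1 E2 !vec_mxK hsubmxK.
Qed.

Lemma pair_bound d1 d2 (r1 : A -> 'M[cplx]_d1) (r2 : A -> 'M[cplx]_d2) s s1 s2 v1 v2 : tchar R s ->
  is_rep r1 -> irred r1 -> v1 != 0 -> xweight r1 s1 v1 -> tchar R s1 -> wB s1 \in orb s ->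
  is_rep r2 -> irred r2 -> v2 != 0 -> xweight r2 s2 v2 -> tchar R s2 -> wB s2 \in orb s ->
  (forall X Y, exists b, r1 b = X /\ r2 b = Y) -> (d1 * d1 + d2 * d2 <= size W0s * size (orb s))%N.
Proof.
move=> Hs Hr1 I1 v10 Hv1 Hs1 O1 Hr2 I2 v20 Hv2 Hs2 O2 Hsurj; have [a [ch H]] := orbit_projectors Hs.
apply: (orbit_bound (Phi := fun b => row_mx (mxvec (r1 b)) (mxvec (r2 b))) (a := a) (ch := ch)).
- by move=> x y; rewrite (repD Hr1) (repD Hr2) !linearD /= add_row_mx.
- by move=> k x; rewrite (repZ Hr1) (repZ Hr2) !linearZ /= scale_row_mx.
- move=> w x Hw Xx; rewrite (H _ r1 s1 v1) // (H _ r2 s2 v2) //.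
  elim/big_rec3: _ => [|c y z t _ IH]; first by rewrite !linear0 row_mx0.
  by rewrite !linearD !linearZ /= -IH scale_row_mx add_row_mx.
exact: mxvec_rep_onto.
Qed.

Lemma single_bound d (r : A -> 'M[cplx]_d) s s1 v1 : tchar R s ->
  is_rep r -> irred r -> v1 != 0 -> xweight r s1 v1 -> tchar R s1 -> wB s1 \in orb s ->
  (forall X, exists b, r b = X) -> (d * d <= size W0s * size (orb s))%N.
Proof.
move=> Hs Hr Ir v10 Hv1 Hs1 O1 Hsurj; have [a [ch H]] := orbit_projectors Hs.
apply: (orbit_bound (Phi := fun b => mxvec (r b)) (a := a) (ch := ch)).
- by move=> x y; rewrite (repD Hr) linearD.
- by move=> k x; rewrite (repZ Hr) linearZ.
- move=> w x Hw Xx; rewrite (H _ r s1 v1) // linear_sum; apply: eq_bigr => c _.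
  by rewrite linearZ.
by move=> y; have [b E] := Hsurj (vec_mx y); exists b; rewrite E vec_mxK.
Qed.

(* X acts by scalars, so L is an irreducible module of the dihedral group W0: an eigenvector u of s_i s_j
   and s_i u span it. *)
Lemma dihedral_bound d (r : A -> 'M[cplx]_d) s s1 v1 i j : tchar R s ->
  is_rep r -> irred r -> v1 != 0 -> xweight r s1 v1 -> tchar R s1 -> wB s1 \in orb s ->
  (size (orb s) <= 1)%N -> (forall k : 'I_n, k = i \/ k = j) -> (d <= 2)%N.
Proof.
move=> Hs Hr Ir v10 Hv1 Hs1 O1 O_le Hk.
have Oeq (c c' : {ffun 'I_n -> cplx}) : c \in orb s -> c' \in orb s -> c = c'.
  by case: (orb s) O_le => [|c0 [|]] //= _; rewrite !inE => /eqP -> /eqP ->.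
have scal x (y : 'rV[cplx]_d) : inX R x -> y *m r (Ex x) = s1 x *: y.
  move=> Xx; move: y; apply: (irred_span Hr Ir v10 Hv1).
  - by rewrite mul0mx scaler0.
  - by move=> y z E1 E2; rewrite mulmxDl E1 E2 scalerDr.
  - by move=> k y E; rewrite -scalemxAl E !scalerA mulrC.
  move=> w Hw; rewrite (xweight_Ew Hr Hv1 Hw Xx); congr (_ *: _).
  apply: (wB_inj (tW_tchar Hw Hs1) Hs1) => //; apply: Oeq => //; exact: wB_orb_W0.
pose M k := r (Ew (sr k)).
have MM k : M k *m M k = 1%:M.
  rewrite /M -(repM Hr) EwM ?srK ?Ew1 ?(rep1 Hr) //; exact: W0_sr.
have [l [u [u0 Hu]]] := mx_eigenvector (M j *m M i) (proj1 Ir).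
have l0' : l != 0.
  apply: contra u0 => /eqP E; have : u *m (M j *m M i) *m (M i *m M j) = u.
    by rewrite -mulmxA (mulmxA (M j *m M i)) -(mulmxA (M j)) MM mulmx1 MM mulmx1.
  by rewrite Hu E scale0r mul0mx => <-.
have Ej : u *m M j = l *: (u *m M i).
  by rewrite -[LHS]mulmx1 -(MM i) !mulmxA -(mulmxA u) Hu scalemxAl.
have Eij : u *m M i *m M j = l^-1 *: u.
  by apply: (scalerI l0'); rewrite scalemxAl -Ej -mulmxA MM mulmx1 scalerA mulfV // scale1r.
pose B := col_mx u (u *m M i).
have uB : (u <= B)%MS by rewrite -addsmxE addsmxSl.
have uiB : (u *m M i <= B)%MS by rewrite -addsmxE addsmxSr.
have Bst k (y : 'rV[cplx]_d) : (y <= B)%MS -> (y *m M k <= B)%MS.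
  move=> yB; apply: submx_trans (submxMr _ yB) _; rewrite mul_col_mx col_mx_sub.
  case: (Hk k) => ->; rewrite ?Ej ?Eij ?scalemx_sub // uiB /=.
  by rewrite -mulmxA MM mulmx1.
have BW w (y : 'rV[cplx]_d) : inW0 R w -> (y <= B)%MS -> (y *m r (Ew w) <= B)%MS.
  move=> Hw; elim/W0_indr: w / Hw y => [|w k Hw _ IH] y yB; first by rewrite Ew1 (rep1 Hr) mulmx1.
  rewrite -EwM //; last exact: W0_sr.
  by rewrite (repM Hr) mulmxA; apply: IH; exact: Bst.
have : row_full B.
  rewrite -sub1mx; apply/row_subP => k; have [b ->] := proj2 Ir u (row k 1%:M) u0.
  have [t [Ht ->]] := EE_span b; rewrite (rep_sum Hr) mulmx_sumr big_seq.
  apply: summx_sub => p /Ht [Hw Xx]; rewrite (repZ Hr) -scalemxAr; apply: scalemx_sub.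
  by rewrite EE_Ew // (repM Hr) mulmxA scal // -scalemxAl; apply/scalemx_sub/BW.
by rewrite /row_full => /eqP <-; exact: rank_leq_row.
Qed.

(** * Induced modules *)

Variable c : cplx.
Hypothesis cq : c * c = q.
Lemma sqrt_neq0 : c != 0. Proof. by apply: contra q0 => /eqP c0; rewrite -cq c0 mul0r. Qed.

(* The square root of the modulus: Q x = q^(<x, rho^vee>). *)
Definition Q (x : 'cV[rat]_n) : cplx := zexp c (delta x).
Lemma Q_tchar : tchar R Q.
Proof.
split=> [x y Xx Xy|x Xx]; last exact: (zexp_neq0 _ sqrt_neq0).
by rewrite /Q deltaD zexpD ?sqrt_neq0 //; exact: delta_int.
Qed.
Lemma Q_al i : Q (al i) = q.
Proof. by rewrite /Q delta_al (zexp_nat c 2) expr2. Qed.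

(** For dominant x, T_x is Q x times the Bernstein element theta_x. In this normalization
    intertwiners move weights by the plain action of W0. *)
Definition wt (t : 'cV[rat]_n -> cplx) : {ffun 'I_n -> cplx} := [ffun i => Q (om i) * t (om i)].
Definition tx (i : 'I_n) : A := Tx (om i).
Definition has_wt d (r : A -> 'M[cplx]_d) t := exists2 v : 'rV[cplx]_d, v != 0 & wvec tx r (wt t) v.

Lemma wt_inj t t' : tchar R t -> tchar R t' -> wt t = wt t' -> forall x, inX R x -> t x = t' x.
Proof.
move=> Ht Ht' E; apply: tchar_ext => // i; have /ffunP /(_ i) := E; rewrite !ffunE.
by apply/mulfI/(proj2 Q_tchar)/om_X.
Qed.

Lemma wvec_dom d (r : A -> 'M[cplx]_d) t (v : 'rV[cplx]_d) : is_rep r -> tchar R t -> wvec tx r (wt t) v ->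
  forall x, inX R x -> dom x -> v *m r (Tx x) = (Q x * t x) *: v.
Proof.
move=> Hr Ht Hv; apply: dom_ind => [|x i Xx dx IH].
  by rewrite Tx0 (rep1 Hr) mulmx1 (tchar0 Q_tchar) (tchar0 Ht) mulr1 scale1r.
have Xi := om_X i; rewrite -Tx_add //; last exact: dom_om.
rewrite (repM Hr) mulmxA IH -scalemxAl (Hv i) ffunE scalerA (proj1 Q_tchar) // (proj1 Ht) //.
by congr (_ *: _); ring.
Qed.

Lemma Tom_Ti_Tom i : Tx (om i) * Ti i * Tx (om i) =
  (q - 1) *: (Tx (om i) * Tx (om i)) + q *: (Ti i * Tx (ym i)).
Proof.
rewrite {1}Ti_Tv mulrDr mulrDl -(scalerAr q) -(scalerAr (q - 1)) mulr1 -(scalerAl q) -(scalerAl (q - 1)).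
by rewrite TomTvTom addrC.
Qed.

Lemma Q_ym i : Q (ym i) * q = Q (om i) * Q (om i).
Proof.
have Xi := om_X i; rewrite /ym (tcharB Q_tchar) ?Q_al ?divfK //; first exact: (proj1 Q_tchar).
  exact: inXD.
exact: inX_al1.
Qed.

Section RankOne.
Variables (d : nat) (r : A -> 'M[cplx]_d) (t : 'cV[rat]_n -> cplx) (v : 'rV[cplx]_d) (k : 'I_n).
Hypotheses (Hr : is_rep r) (Ht : tchar R t) (Hv : wvec tx r (wt t) v).
Let u := v *m r (Ti k).
Let z := t (al k).

Lemma rank1_ne j : j != k -> u *m r (tx j) = wt t j *: u.
Proof.
move=> jk; rewrite /u -mulmxA -(repM Hr) Tx_Ti; [|exact: om_X|exact: dom_om|by rewrite pr_om (negbTE jk)].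
by rewrite (repM Hr) mulmxA (Hv j) -scalemxAl.
Qed.

Lemma rank1_eq : u *m r (tx k) = (wt t k / z) *: u + ((q - 1) * wt t k) *: v.
Proof.
have Xk := om_X k; have z0 : z != 0 by apply: (proj2 Ht); exact: inX_al1.
have w0 : wt t k != 0 by rewrite ffunE mulf_neq0 //; [exact: (proj2 Q_tchar)|exact: (proj2 Ht)].
apply: (scalerI w0).
have -> : wt t k *: (u *m r (tx k)) = v *m r (tx k) *m r (Ti k) *m r (tx k).
  by rewrite (Hv k) -!scalemxAl.
rewrite -!mulmxA -!(repM Hr) Tom_Ti_Tom (repD Hr) !(repZ Hr) mulmxDr -!scalemxAr !(repM Hr) !mulmxA.
rewrite !(Hv k) -scalemxAl (Hv k) (wvec_dom Hr Ht Hv) //; [|exact: ym_X|exact: ym_dom].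
rewrite -scalemxAl -/u scalerDr !scalerA addrC; congr (_ *: _ + _ *: _); last by ring.
have -> : t (ym k) = t (om k) * t (om k) / z.
  by rewrite /ym (tcharB Ht) ?(proj1 Ht) //; [exact: inXD|exact: inX_al1].
have -> : q * (Q (ym k) * (t (om k) * t (om k) / z)) = Q (ym k) * q * (t (om k) * t (om k) / z) by ring.
by rewrite Q_ym !ffunE; ring.
Qed.

(** On the span of [v] and [u] the element T_(om k) is triangular, with diagonal entries [wt t k]
    and [wt t k / z]; the equation for [g] says that [u - g *: v] is an eigenvector for the second
    one. *)
Lemma rank1_wt g : g * (1 - z^-1) = q - 1 -> wvec tx r (wt (tW (sr k) t)) (u - g *: v).
Proof.
move=> Hg j; have Xj := om_X j; rewrite mulmxBl -scalemxAl (Hv j).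
have -> : wt (tW (sr k) t) j = Q (om j) * t (om j - (j == k)%:R *: al k).
  by rewrite ffunE /tW invmx_sr srE pr_om.
have [Ejk|jk] := eqVneq j k; last first.
  by rewrite rank1_ne // scale0r subr0 ffunE scalerBr !scalerA (mulrC g).
rewrite {}Ejk in Xj *; rewrite rank1_eq scale1r (tcharB Ht) //; last exact: inX_al1.
rewrite mulrA -/z !ffunE scalerBr -addrA; congr (_ + _).
rewrite !scalerA -scalerBl -scaleNr -Hg; congr (_ *: _); ring.
Qed.

(** If the vector vanished, [g] would be an eigenvalue of T_k, that is q or -1, and these correspond
    to z = q and z = q^-1. *)
Lemma rank1_neq0 g : g * (1 - z^-1) = q - 1 -> v != 0 -> z != 1 -> z != q -> z != q^-1 ->
  u - g *: v != 0.
Proof.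
move=> Hg v0 z1 zq zq'; have z0 : z != 0 by apply: (proj2 Ht); exact: inX_al1.
apply/eqP => /eqP; rewrite subr_eq0 => /eqP Eu.
have : u *m r (Ti k) = (q - 1) *: u + q *: v.
  by rewrite /u -mulmxA -(repM Hr) Ti2 (repD Hr) (repZ Hr) (rep_scal Hr) mulmxDr -scalemxAr mul_mx_scalar.
rewrite {1}Eu -scalemxAl -/u Eu !scalerA -scalerDl => /eqP.
rewrite -subr_eq0 -scalerBl scaler_eq0 (negbTE v0) orbF => /eqP E.
have : (g - q) * (g + 1) == 0 by apply/eqP; rewrite -E; ring.
rewrite mulf_eq0 => /orP [/eqP Eg|/eqP Eg].
  have {}Eg : g = q by apply/eqP; rewrite -subr_eq0 Eg.
  move: Hg; rewrite Eg mulrBr mulr1 => /addrI /oppr_inj H.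
  by case/eqP: zq; rewrite -[LHS]mul1r -H divfK.
have {}Eg : g = -1 by apply/eqP; rewrite -subr_eq0 opprK Eg.
move: Hg; rewrite Eg mulN1r opprB => /addIr H.
by case/eqP: zq'; rewrite -H invrK.
Qed.
End RankOne.

Lemma wt_step d (r : A -> 'M[cplx]_d) t k : is_rep r -> tchar R t -> has_wt r t ->
  t (al k) != 1 -> t (al k) != q -> t (al k) != q^-1 -> has_wt r (tW (sr k) t).
Proof.
move=> Hr Ht [v v0 Hv] z1 zq zq'; set z := t (al k) in z1 zq zq'.
have z0 : z != 0 by apply: (proj2 Ht); exact: inX_al1.
have nz : 1 - z^-1 != 0 by rewrite subr_eq0 eq_sym -invr1 (inj_eq invr_inj).
have Hg : (q - 1) / (1 - z^-1) * (1 - z^-1) = q - 1 by rewrite divfK.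
by exists (v *m r (Ti k) - (q - 1) / (1 - z^-1) *: v); [apply: (rank1_neq0 Hr Ht) | exact: rank1_wt].
Qed.

(** * Weights and central characters of the induced modules *)

Definition low m (y : 'rV[cplx]_N) := forall i : 'I_N, (m <= l0 (nth 1%:M W0s i))%N -> y 0 i = 0.
Lemma low_eW m w : inW0 R w -> (l0 w < m)%N -> low m (eW w).
Proof.
move=> Hw Hm i Hi; rewrite mxE; case: eqP => // E; by move: Hi; rewrite E leqNgt Hm.
Qed.
Lemma lowD m y y' : low m y -> low m y' -> low m (y + y').
Proof. by move=> H H' i Hi; rewrite mxE H ?H' ?addr0. Qed.
Lemma lowZ m k y : low m y -> low m (k *: y).
Proof. by move=> H i Hi; rewrite mxE H ?mulr0. Qed.
Lemma low_mono m m' y : (m <= m')%N -> low m y -> low m' y.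
Proof. by move=> Hm H i Hi; apply: H; exact: leq_trans Hi. Qed.
Lemma row_eW (y : 'rV[cplx]_N) : y = \sum_i y 0 i *: eW (nth 1%:M W0s i).
Proof. by rewrite {1}(row_sum_delta y); apply: eq_bigr => i _; rewrite eW_delta. Qed.

Definition regular (t : 'cV[rat]_n -> cplx) := forall w, inW0 R w -> w != 1%:M ->
  exists2 x, inX R x & t (w *m x) != t x.

Definition wts t := [seq wt (tW w t) | w <- W0s].
Lemma wt_tW_inj t : tchar R t -> regular t -> {in W0s &, injective (fun w => wt (tW w t))}.
Proof.
move=> Ht Hreg w w' /W0P Hw /W0P Hw' /(wt_inj (tW_tchar Hw Ht) (tW_tchar Hw' Ht)) E.
have Hi := W0_invmx HR Hw; have Hww : inW0 R (invmx w *m w') by apply: W0_mul.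
have [E1|/(Hreg _ Hww) [x Xx /eqP []]] := eqVneq (invmx w *m w') 1%:M.
  by rewrite -[LHS]mulmx1 -E1 mulKVmx // (W0_unit HR Hw).
have := E _ (inX_W0 Hw' Xx); rewrite /tW mulmxA => ->.
by rewrite mulKmx // (W0_unit HR Hw').
Qed.
Lemma wts_uniq t : tchar R t -> regular t -> uniq (wts t).
Proof. by move=> Ht Hreg; rewrite map_inj_in_uniq //; exact: wt_tW_inj. Qed.

Section Induced.
Variables (t : 'cV[rat]_n -> cplx) (r : A -> 'M[cplx]_N).
Hypotheses (Ht : tchar R t) (Hr : is_rep r).
Hypothesis (rW : forall w, inW0 R w -> eW 1%:M *m r (Tw w) = eW w).
Hypothesis (rX : forall x, inX R x -> dom x -> eW 1%:M *m r (Tx x) = (Q x * t x) *: eW 1%:M).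

Lemma wvec_e1 : wvec tx r (wt t) (eW 1%:M).
Proof. by move=> i; rewrite /tx rX ?ffunE //; [exact: om_X|exact: dom_om]. Qed.

Lemma e1_cyclic x : exists a, x = eW 1%:M *m r a.
Proof.
exists (\sum_i x 0 i *: Tw (nth 1%:M W0s i)); rewrite (rep_sum Hr) mulmx_sumr {1}(row_eW x).
by apply: eq_bigr => i _; rewrite (repZ Hr) -scalemxAr rW //; exact: W0_nth.
Qed.

Lemma eW_Ti w k : inW0 R w -> eW w *m r (Ti k) =
  if invmx w *m al k \in pos then eW (sr k *m w) else (q - 1) *: eW w + q *: eW (sr k *m w).
Proof.
move=> Hw; have Hs : inW0 R (sr k *m w) by apply: W0_mul => //; exact: W0_sr.
rewrite -(rW Hw) -mulmxA -(repM Hr); case: ifPn => Hp; first by rewrite Tw_mull // rW.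
by rewrite Tw_mullN // (repD Hr) !(repZ Hr) mulmxDr -!scalemxAr !rW.
Qed.

Lemma low_Ti m k y : low m y -> low m.+1 (y *m r (Ti k)).
Proof.
move=> Hy; rewrite (row_eW y) mulmx_suml; elim/big_rec: _ => [|i z _ Hz]; first by move=> j _; rewrite mxE.
apply: lowD => //; rewrite -scalemxAl; have Wi := W0_nth i.
have Hs : inW0 R (sr k *m nth 1%:M W0s i) by apply: W0_mul => //; exact: W0_sr.
have [Hi|Hi] := leqP m (l0 (nth 1%:M W0s i)).
  by rewrite Hy // scale0r => j _; rewrite mxE.
apply: lowZ; rewrite eW_Ti //; case: ifPn => Hp.
  by apply: low_eW => //; rewrite l0_mull.
apply: lowD; apply: lowZ; apply: low_eW => //; first exact: ltnW.
by move: Hi; rewrite (l0_mullN Wi Hp) => H; apply: ltnW; apply: ltnW.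
Qed.

(* Applying the rank one intertwiners successively to e_1 yields weight vectors with leading term e_w. *)
Lemma induced_weight w : regular t -> inW0 R w -> has_wt r (tW w t).
Proof.
move=> Hreg Hw; suff [y Hy Hv] : exists2 y, low (l0 w) y & wvec tx r (wt (tW w t)) (eW w + y).
  exists (eW w + y) => //; have [i Ei] := eW_ind Hw; apply/eqP => /rowP /(_ i).
  by rewrite mxE Hy ?Ei // addr0 !mxE Ei eqxx => /eqP; rewrite oner_eq0.
elim/W0_indl: w / Hw => [|w k Hw Hp [y Hy Hv]].
  exists 0; first by move=> i _; rewrite mxE.
  rewrite addr0; have -> : wt (tW 1%:M t) = wt t.
    by apply/ffunP => i; rewrite !ffunE /tW invmx1 mul1mx.
  exact: wvec_e1.
have Ht' := tW_tchar Hw Ht; have Ws := W0_sr k.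
set z := tW w t (al k); have z0 : z != 0 by apply: (proj2 Ht'); exact: inX_al1.
have z1 : z != 1.
  apply/eqP => z1; have Hc : inW0 R (invmx w *m sr k *m w) by do !apply: W0_mul => //; exact: W0_invmx.
  have [E|/(Hreg _ Hc) [x Xx /eqP []]] := eqVneq (invmx w *m sr k *m w) 1%:M.
    have : sr k *m w = w.
      by rewrite -[RHS]mulmx1 -E !mulmxA mulmxV ?mul1mx // (W0_unit HR Hw).
    by move=> E'; have := l0_mull Hw Hp; rewrite E' => /eqP; rewrite -[X in X == _]addn0 -addn1 eqn_add2l.
  have Xw := inX_W0 Hw Xx; rewrite -!mulmxA srE mulmxBr -scalemxAr.
  have [m Em] := Xw _ (al_root k); rewrite Em scaler_int mulKmx ?(W0_unit HR Hw) //.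
  have Xi : inX R (invmx w *m al k) by apply: inX_W0; [exact: W0_invmx|exact: inX_al1].
  rewrite (tcharB Ht) ?(tcharMz _ Ht) //; last by case: m {Em} => m; [|apply: inXN]; exact: inXMn.
  by rewrite -[t (invmx w *m al k)]/z z1 exp1rz divr1.
have nz : 1 - z^-1 != 0 by rewrite subr_eq0 eq_sym -invr1 (inj_eq invr_inj).
have Hg : (q - 1) / (1 - z^-1) * (1 - z^-1) = q - 1 by rewrite divfK.
have := rank1_wt Hr Ht' Hv Hg.
have -> : wt (tW (sr k) (tW w t)) = wt (tW (sr k *m w) t).
  by apply/ffunP => i; rewrite !ffunE /tW (invmxM Ws Hw) -mulmxA.
set g := _ / _ => Hv'; exists (y *m r (Ti k) - g *: (eW w + y)).
  rewrite l0_mull //; apply: lowD; first exact: low_Ti.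
  rewrite -scaleNr; apply/lowZ/lowD; first exact: low_eW.
  exact: low_mono Hy.
by move: Hv'; rewrite (mulmxDl (eW w) y) (eW_Ti k Hw) Hp addrA.
Qed.

(** For regular [t] the |W0| distinct weights have eigenvectors forming a basis, so the
    interpolating projector of one weight has its image in a line. As an element of A it also acts
    on every other module, where it fixes the vectors of that weight. *)
Lemma induced_line w : regular t -> inW0 R w -> exists a (u : 'rV[cplx]_N),
  [/\ forall x : 'rV[cplx]_N, exists k, x *m r a = k *: u, wvec tx r (wt (tW w t)) u
  & forall d (r' : A -> 'M[cplx]_d) (v : 'rV_d), is_rep r' -> wvec tx r' (wt (tW w t)) v -> v *m r' a = v].
Proof.
move=> Hreg Hw; set c0 := wt (tW w t); have Lu := wts_uniq Ht Hreg.
have [a [g [_ Ha g1 g0]]] := weight_projector tx (wts t) c0.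
have HV c' : exists v : 'rV[cplx]_N, c' \in wts t -> v != 0 /\ wvec tx r c' v.
  have [/mapP [w' /W0P Hw' ->]|Hn] := boolP (c' \in wts t); last by exists 0.
  by have [v v0 Hv] := induced_weight Hreg Hw'; exists v.
pose V c' := sval (constructive_indefinite_description _ (HV c')).
have VP c' : c' \in wts t -> V c' != 0 /\ wvec tx r c' (V c').
  by rewrite /V; case: constructive_indefinite_description.
have := weights_free Hr Lu VP; set M := \matrix_(k < _) _ => Mf.
have Mfull : row_full M by rewrite /row_full (eqP Mf) size_map.
exists a, (V c0); split; last first.
- by move=> d r' v Hr' Hv; rewrite (Ha _ _ _ _ Hr' Hv) g1 scale1r.
- by have [|_ ?] := VP c0; first by apply/map_f/W0P.
move=> x; have /submxP [y ->] : (x <= M)%MS by apply: submx_full.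
rewrite (mulmx_sum_row y) mulmx_suml; elim/big_rec: _ => [|i z _ [k Ek]]; first by exists 0; rewrite scale0r.
have iL : nth [ffun=> 0] (wts t) i \in wts t by apply: mem_nth.
rewrite Ek rowK -scalemxAl (Ha _ _ _ _ Hr (proj2 (VP _ iL))).
have [->|Hn] := eqVneq (nth [ffun=> 0] (wts t) i) c0.
  by exists (y 0 i * g c0 + k); rewrite scalerDl scalerA.
by rewrite g0 // scale0r scaler0 add0r; exists k.
Qed.

Lemma regular_central z : regular t -> (forall a, z * a = a * z) -> exists k, eW 1%:M *m r z = k *: eW 1%:M.
Proof.
move=> Hreg Hz.
have [a [u [Hu _ Ha]]] := induced_line Hreg W1.
have E1 : wt (tW 1%:M t) = wt t by apply/ffunP => i; rewrite !ffunE /tW invmx1 mul1mx.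
rewrite E1 in Ha; have [k1 Ek1] := Hu (eW 1%:M).
have {Ek1} : eW 1%:M = k1 *: u by rewrite -Ek1 (Ha _ _ _ Hr) //; exact: wvec_e1.
have Hw : wvec tx r (wt t) (eW 1%:M *m r z).
  by move=> i; rewrite -mulmxA -(repM Hr) -Hz (repM Hr) mulmxA wvec_e1 -scalemxAl.
have [k2 Ek2] := Hu (eW 1%:M *m r z).
have {Ek2} -> : eW 1%:M *m r z = k2 *: u by rewrite -Ek2 (Ha _ _ _ Hr).
move=> Eu; have k10 : k1 != 0.
  apply/eqP => k0; have [i Ei] := eW_ind W1; move/rowP/(_ i): Eu.
  by rewrite k0 scale0r !mxE Ei eqxx => /eqP; rewrite oner_eq0.
by exists (k2 / k1); rewrite Eu scalerA divfK.
Qed.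

Lemma e1_clear z y (s : seq (cplx * 'M[rat]_n * 'cV[rat]_n)) : inX R y -> dom y ->
  (forall p, p \in s -> [/\ inW0 R p.1.2, inX R p.2 & dom p.2]) ->
  z * Tx y = \sum_(p <- s) p.1.1 *: TT p.1.2 p.2 ->
  (Q y * t y) *: (eW 1%:M *m r z) = \sum_(p <- s) (p.1.1 * (Q p.2 * t p.2)) *: eW p.1.2.
Proof.
move=> Xy dy Hs E; rewrite scalemxAl -(rX Xy dy) -mulmxA -(repM Hr) E (rep_sum Hr) mulmx_sumr.
rewrite big_seq [RHS]big_seq; apply: eq_bigr => p /Hs [Hw Xx dx].
by rewrite (repZ Hr) -Tw_Tx // (repM Hr) -scalemxAr mulmxA rX // -scalemxAl rW // scalerA.
Qed.

End Induced.

Definition induced t (r : A -> 'M[cplx]_N) : Prop := [/\ is_rep r,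
  forall w, inW0 R w -> eW 1%:M *m r (Tw w) = eW w
  & forall x, inX R x -> dom x -> eW 1%:M *m r (Tx x) = (Q x * t x) *: eW 1%:M].

Lemma tcharM t t' : tchar R t -> tchar R t' -> tchar R (fun x => t x * t' x).
Proof.
move=> [tD t0] [tD' t0']; split=> [x y Xx Xy|x Xx]; last by rewrite mulf_neq0 ?t0 ?t0'.
by rewrite tD // tD' // mulrACA.
Qed.

Lemma induced_ex t : tchar R t -> exists r, induced t r.
Proof.
by move=> Ht; have [r [H1 H2 H3]] := induced_rep (tcharM Q_tchar Ht); exists r.
Qed.

Lemma zexp_delta_tchar s : s != 0 -> tchar R (fun x => zexp s (delta x)).
Proof.
move=> s0; split=> [x y Xx Xy|x Xx]; last exact: zexp_neq0.
by rewrite deltaD zexpD //; exact: delta_int.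
Qed.

(* For regular t, z e_1 is a weight vector of weight t, hence a multiple of e_1; the other coefficients
   of z e_1 are polynomial in a parameter s along the family t s^delta, which is regular for almost all s. *)
Lemma central_induced t r z : tchar R t -> induced t r -> (forall a, z * a = a * z) ->
  exists k, r z = k%:M.
Proof.
move=> Ht [Hr rW rX] Hz; suff [k Ek] : exists k, eW 1%:M *m r z = k *: eW 1%:M.
  by exists k; apply: (central_scalar Hr _ Hz Ek) => x; exact: (e1_cyclic Hr rW).
have [i1 Ei1] := eW_ind W1; exists ((eW 1%:M *m r z) 0 i1); apply/rowP => i; rewrite [RHS]mxE [eW _ _ _]mxE.
have [Ei|Ni] := eqVneq (nth 1%:M W0s i) 1%:M.
  rewrite mulr1; congr (_ 0 _); apply/val_inj/eqP; rewrite -(nth_uniq 1%:M _ _ W0u) ?ltn_ord //.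
  by rewrite Ei Ei1.
rewrite mulr0; have [y [s [Xy dy Hs E]]] := clear_denominators z.
pose dl x := `|numq (delta x)|%N.
have dlE x : inX R x -> dom x -> delta x = (dl x)%:R.
  move=> Xx dx; have [m Em] := delta_int Xx; have := delta_dom dx; rewrite /dl Em numq_int ler0z.
  by case: m Em => // m _ _.
(* Up to a nonzero factor, the value of [P] at x is the [i]-th coefficient of z e_1 in the module
   induced from t x^delta. Only dominant weights occur after clearing denominators, so no negative
   power of x appears. *)
pose P : {poly cplx} := \sum_(p <- s) (if p.1.2 == nth 1%:M W0s i then p.1.1 * (Q p.2 * t p.2) else 0) *: 'X^(dl p.2).
pose ts (x : cplx) y := t y * zexp x (delta y).
have ts_char x : x != 0 -> tchar R (ts x) by move=> x0; apply: tcharM => //; exact: zexp_delta_tchar.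
have PE x r' : x != 0 -> induced (ts x) r' -> P.[x] = (Q y * ts x y) * (eW 1%:M *m r' z) 0 i.
  move=> x0 [Hr' rW' rX']; have := e1_clear Hr' rW' rX' Xy dy Hs E => /rowP /(_ i); rewrite mxE => ->.
  rewrite summxE /P horner_sum big_seq [RHS]big_seq; apply: eq_bigr => p /Hs [Hw Xx dx].
  rewrite !mxE hornerZ hornerXn /ts (dlE _ Xx dx) zexp_nat eq_sym.
  by case: eqP => _; rewrite ?mulr1 ?mulr0 ?mul0r // !mulrA.
have Qt0 x : x != 0 -> Q y * ts x y != 0.
  by move=> x0; rewrite mulf_neq0 // ?(proj2 Q_tchar) ?(proj2 (ts_char _ x0)).
have P0 : P = 0.
  apply/eqP; apply: contraT => P0.
  have mpos w : w != 1%:M -> inW0 R w -> exists2 m : nat, (0 < m)%N & delta rho - delta (w *m rho) = m%:R.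
    move=> w1 Hw; have [E1|Hlt] := delta_rho Hw; first by rewrite E1 eqxx in w1.
    have Xw := inX_W0 Hw rho_X; have [m1 E1] := delta_int rho_X; have [m2 E2] := delta_int Xw.
    move: Hlt; rewrite E1 E2 ltr_int => Hlt; exists `|m1 - m2|%N; first by lia.
    by rewrite -rmorphB -[RHS]/((`|m1 - m2|%N : int)%:~R); congr (_%:~R); lia.
  (* Where [G] is nonzero, t x^delta takes different values at rho and at w rho for every w other
     than 1, hence is regular. *)
  pose G := \prod_(w <- W0s | w != 1%:M)
    (t rho *: 'X^(`|numq (delta rho - delta (w *m rho))|%N) - (t (w *m rho))%:P).
  have G0 : G != 0.
    rewrite /G prodf_seq_neq0; apply/allP => w /W0P Hw; apply/implyP => w1.
    have [m m0 Em] := mpos w w1 Hw; rewrite Em -[m%:R]/((m : int)%:~R) numq_int /=.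
    by apply: binomial_poly_neq0 => //; apply: (proj2 Ht); exact: rho_X.
  have [k] := poly_natr_neq0 (mulf_neq0 P0 G0); set x := _%:R.
  rewrite hornerM mulf_eq0 negb_or => /andP [Px Gx]; have x0 : x != 0 by exact: cplx_natr_neq0.
  have Hreg : regular (ts x).
    move=> w Hw w1; exists rho; first exact: rho_X.
    move: Gx; rewrite /G horner_prod prodf_seq_neq0 => /allP Gx.
    have Ww : w \in W0s by apply/W0P.
    have /implyP /(_ w1) := Gx w Ww; have [m m0 Em] := mpos w w1 Hw.
    rewrite Em -[m%:R]/((m : int)%:~R) numq_int hornerD hornerN hornerC hornerZ hornerXn subr_eq0 eq_sym.
    apply: contra => /eqP; have Xw := inX_W0 Hw rho_X.
    have -> : ts x rho = t rho * x ^+ m * zexp x (delta (w *m rho)).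
      rewrite /ts -[X in zexp x X](subrK (delta (w *m rho))) Em zexpD ?zexp_nat ?mulrA //; last exact: delta_int.
      by exists m.
    by rewrite /ts => /(mulIf (zexp_neq0 _ x0)) ->.
  have [r' Hi] := induced_ex (ts_char _ x0); have [Hr' rW' rX'] := Hi.
  have [k' Ek'] := regular_central (ts_char _ x0) Hr' rW' rX' Hreg Hz.
  by move: Px; rewrite (PE _ _ x0 Hi) Ek' !mxE (negbTE Ni) !mulr0 eqxx.
(* The given module is the member x = 1 of the family. *)
have t1 : induced (ts 1) r.
  by split=> // x Xx dx; rewrite rX // /ts zexp1 mulr1.
have := PE 1 r (oner_neq0 _) t1; rewrite P0 horner0 => /esym /eqP.
by rewrite mulf_eq0 (negbTE (Qt0 _ (oner_neq0 _))) /= => /eqP.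
Qed.
Lemma Theta_weight d (r : A -> 'M[cplx]_d) t (v : 'rV[cplx]_d) a : is_rep r -> tchar R t -> wvec tx r (wt t) v ->
  Theta a -> exists k, v *m r a = k *: v.
Proof.
move=> Hr Ht Hv; elim=> [k|i|i b H1 H2|a1 a2 _ [k1 E1] _ [k2 E2]|a1 a2 _ [k1 E1] _ [k2 E2]].
- by exists k; rewrite (rep_scal Hr) mul_mx_scalar.
- by exists (wt t i); exact: Hv.
- have w0 : wt t i != 0 by rewrite ffunE mulf_neq0 //; [exact/(proj2 Q_tchar)/om_X|exact/(proj2 Ht)/om_X].
  exists (wt t i)^-1; apply: (scalerI w0).
  by rewrite scalemxAl -(Hv i) -mulmxA -(repM Hr) H2 (rep1 Hr) mulmx1 scalerA mulfV // scale1r.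
- by exists (k1 + k2); rewrite (repD Hr) mulmxDr E1 E2 scalerDl.
by exists (k1 * k2); rewrite (repM Hr) mulmxA E2 -scalemxAl E1 scalerA mulrC.
Qed.

Lemma weight_generated d (r : A -> 'M[cplx]_d) t (v : 'rV[cplx]_d) (P : 'rV[cplx]_d -> Prop) :
  is_rep r -> tchar R t -> wvec tx r (wt t) v ->
  (forall x y, P x -> P y -> P (x + y)) -> (forall k x, P x -> P (k *: x)) ->
  (forall w, inW0 R w -> P (v *m r (Tw w))) -> forall a, P (v *m r a).
Proof.
move=> Hr Ht Hv PD PZ PW a; elim: (HTh_all a) => [w b Hw Hb|b b' _ IH _ IH'].
  have [k E] := Theta_weight Hr Ht Hv Hb.
  by rewrite (repM Hr) mulmxA E -scalemxAl; apply: (PZ); exact: PW.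
by rewrite (repD Hr) mulmxDr; exact: PD.
Qed.

(** * Simple subquotients of the induced modules *)

Section Subquotients.
Variables (t : 'cV[rat]_n -> cplx) (r : A -> 'M[cplx]_N).
Hypotheses (Ht : tchar R t) (Hi : induced t r).
Let Hr : is_rep r := let: And3 h _ _ := Hi in h.
Let rW : forall w, inW0 R w -> eW 1%:M *m r (Tw w) = eW w := let: And3 _ h _ := Hi in h.
Let rX := let: And3 _ _ h := Hi in h.

(** The intertwiner applied to e_1 with [g] = q, which is the value of [g] when t(al k) = q. *)
Definition vq k := eW 1%:M *m r (Ti k) - q *: eW 1%:M.
Lemma vqE k : vq k = eW (sr k) - q *: eW 1%:M.
Proof. by rewrite /vq rW //; exact: W0_sr. Qed.
Lemma vq_neq0 k : vq k != 0.
Proof.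
have Ws := W0_sr k; have [i Ei] := eW_ind Ws; apply/eqP => /rowP /(_ i).
rewrite vqE !mxE Ei eqxx; case: eqP => [E|_].
  by have := l0_sr k; rewrite E l0_1.
by rewrite mulr0 subr0 => /eqP; rewrite oner_eq0.
Qed.
Lemma vq_weight k : t (al k) = q -> wvec tx r (wt (tW (sr k) t)) (vq k).
Proof.
move=> E; apply: (rank1_wt Hr Ht (wvec_e1 rX)) => //.
by rewrite E mulrBr mulr1 mulfV.
Qed.

(* The index character of the finite Hecke algebra, as a functional on the induced module. *)
Definition idx (y : 'rV[cplx]_N) : cplx := \sum_i y 0 i * q ^+ l0 (nth 1%:M W0s i).
Lemma idxD y z : idx (y + z) = idx y + idx z.
Proof. by rewrite -big_split; apply: eq_bigr => i _; rewrite mxE mulrDl. Qed.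
Lemma idxZ k y : idx (k *: y) = k * idx y.
Proof. by rewrite mulr_sumr; apply: eq_bigr => i _; rewrite mxE mulrA. Qed.
Lemma idx_eW w : inW0 R w -> idx (eW w) = q ^+ l0 w.
Proof.
move=> Hw; have [i Ei] := eW_ind Hw; rewrite /idx (bigD1 i) //= big1 => [|j Hj].
  by rewrite mxE Ei eqxx mul1r addr0.
by rewrite mxE -Ei nth_uniq // (inj_eq val_inj) (negbTE Hj) mul0r.
Qed.
Lemma idx_Ti k y : idx (y *m r (Ti k)) = q * idx y.
Proof.
rewrite (row_eW y) mulmx_suml; elim/big_rec2: _ => [|i z z' _ IH].
  by rewrite /idx big1 ?mulr0 // => i _; rewrite mxE mul0r.
rewrite !idxD IH mulrDr -scalemxAl !idxZ; congr (_ + _); rewrite mulrCA; congr (_ * _).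
have Wi := W0_nth i; have Ws : inW0 R (sr k *m nth 1%:M W0s i) by apply: W0_mul => //; exact: W0_sr.
rewrite eW_Ti //; case: ifPn => Hp; first by rewrite !idx_eW // l0_mull // exprS.
by rewrite idxD !idxZ !idx_eW // (l0_mullN Wi Hp) mulrBl mul1r -[X in _ + X]exprS subrK.
Qed.
Lemma idx_Tw w y : inW0 R w -> idx (y *m r (Tw w)) = q ^+ l0 w * idx y.
Proof.
move=> Hw; elim/W0_indl: w / Hw y => [|w k Hw Hp IH] y.
  by rewrite Tw1 (rep1 Hr) mulmx1 l0_1 mul1r.
by rewrite -Tw_mull // (repM Hr) mulmxA idx_Ti IH l0_mull // exprS mulrA.
Qed.
Lemma idx_vq k : idx (vq k) = 0.
Proof. by rewrite vqE -scaleNr idxD idxZ !idx_eW //; [rewrite l0_sr l0_1 expr1 mulr1 subrr|exact: W0_sr]. Qed.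

Definition Dset (i j : 'I_n) := [seq w <- W0s | (w *m al i \in pos) && (w *m al j \in pos)].
Lemma mem_Dset i j w : w \in Dset i j <-> [/\ inW0 R w, w *m al i \in pos & w *m al j \in pos].
Proof.
rewrite mem_filter; split=> [/andP [/andP [? ?] /W0P ?]//|[/W0P H3 H1 H2]].
by rewrite H1 H2.
Qed.

(** The submodule [U] generated by [vq i] and [vq j] is proper because [idx] vanishes on it but not
    on e_1. Modulo [U], e_(w s_k) is q e_w whenever k is i or j and the length increases, so the e_w
    with [w] in [Dset i j] span the quotient. *)
Lemma one_dim_like (i j : 'I_n) : t (al i) = q -> t (al j) = q -> exists d' (r' : A -> 'M[cplx]_d') (v' : 'rV[cplx]_d'),
  [/\ is_rep r' /\ irred r', (d' <= size (Dset i j))%N, v' != 0,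
     forall z k, r z = k%:M -> v' *m r' z = k *: v'
   & v' *m r' (Ti i) = q *: v' /\ v' *m r' (Ti j) = q *: v'].
Proof.
move=> ti tj.
have [|x y [a [b ->]] [a' [b' ->]]|k x [a [b ->]]|U HU] :=
  @subspace_mx _ N (fun x => exists a b, x = vq i *m r a + vq j *m r b).
- by exists 0, 0; rewrite (rep0 Hr) !mulmx0 addr0.
- by exists (a + a'), (b + b'); rewrite !(repD Hr) !mulmxDr addrACA.
- by exists (k *: a), (k *: b); rewrite !(repZ Hr) -!scalemxAr scalerDr.
have SU : stable r U.
  move=> x a /HU [b [b' ->]]; apply/HU; exists (a * b), (a * b').
  by rewrite !(repM Hr) !mulmxA mulmxDl.
have Uvq k a : k = i \/ k = j -> (vq k *m r a <= U)%MS.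
  case=> ->; apply/HU; [exists a, 0|exists 0, a]; by rewrite (rep0 Hr) mulmx0 ?addr0 ?add0r.
have Uvq1 k : k = i \/ k = j -> (vq k <= U)%MS.
  by move=> Hk; rewrite -[vq k]mulmx1 -(rep1 Hr); exact: Uvq.
have idxU x : (x <= U)%MS -> idx x = 0.
  move=> /HU [a [b ->]]; rewrite idxD.
  have H k a' : t (al k) = q -> idx (vq k *m r a') = 0.
    move=> tk; apply: (weight_generated (P := fun y => idx y = 0) Hr _ (vq_weight tk)).
    - exact: tW_tchar (W0_sr k) Ht.
    - by move=> x' y E1 E2; rewrite idxD E1 E2 addr0.
    - by move=> l x' E; rewrite idxZ E mulr0.
    by move=> w Hw; rewrite idx_Tw // idx_vq mulr0.
  by rewrite !H // addr0.
have e1U : ~~ (eW 1%:M <= U)%MS.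
  by apply/negP => /idxU; rewrite idx_eW // l0_1 => /eqP; rewrite oner_eq0.
have [d' [r' [v' [HrI Hd v0 Hl _]]]] := simple_quotient Hr SU e1U.
exists d', r', v'; split=> //; last 2 first.
- by move=> z k E; apply: Hl; rewrite E mul_mx_scalar subrr sub0mx.
- by split; apply: Hl; apply: Uvq1; [left|right].
pose V := \matrix_(k < size (Dset i j)) eW (nth 1%:M (Dset i j) k).
have Vw w : w \in Dset i j -> (eW w <= V)%MS.
  move=> Hw; have Hk : (index w (Dset i j) < size (Dset i j))%N by rewrite index_mem.
  have -> : eW w = row (Ordinal Hk) V by rewrite rowK /= nth_index.
  exact: row_sub.
have UV w : inW0 R w -> (eW w <= U + V)%MS.
  have [m] := ubnP (l0 w); elim: m w => // m IH w Hm Hw.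
  have [Hin|Hin] := boolP (w \in Dset i j); first by apply: submx_trans (Vw _ Hin) _; exact: addsmxSr.
  have [k [Hk Hn]] : exists k, (k = i \/ k = j) /\ w *m al k \notin pos.
    have [Hpi|Hni] := boolP (w *m al i \in pos); last by exists i; split=> //; left.
    have [Hpj|Hnj] := boolP (w *m al j \in pos); last by exists j; split=> //; right.
    by move/negP: Hin; case; apply/mem_Dset.
  have Hws : inW0 R (w *m sr k) by apply: W0_mul => //; exact: W0_sr.
  have Hp : (w *m sr k) *m al k \in pos by rewrite -mulmxA sr_al mulmx_posN // al_root.
  have -> : eW w = vq k *m r (Tw (w *m sr k)) + q *: eW (w *m sr k).
    rewrite -(rW Hw) -{1}(srKr k w) -Tw_mulr // (repM Hr) mulmxA /vq mulmxBl -scalemxAl (rW Hws).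
    by rewrite subrK.
  apply: addmx_sub; first by apply: submx_trans (Uvq _ _ Hk) _; exact: addsmxSl.
  by apply/scalemx_sub/IH => //; move: Hm; rewrite (l0_mulrN Hw Hn) ltnS.
have Hfull : (1%:M <= U + V)%MS.
  by apply/row_subP => k; rewrite row1 -eW_delta; apply/UV/W0_nth.
have := mxrankS Hfull; rewrite mxrank1 => H1.
have := leq_trans H1 (leq_trans (mxrank_adds_leqif U V) (leq_add (leqnn _) (rank_leq_row V))).
by move=> H2; rewrite -(leq_add2r (\rank U)); apply: leq_trans Hd _; rewrite addnC.
Qed.

Lemma simple_of_weight k : t (al k) = q -> exists d' (r' : A -> 'M[cplx]_d'),
  [/\ is_rep r' /\ irred r', has_wt r' (tW (sr k) t),
     forall z l, (forall a, z * a = a * z) -> r z = l%:M -> r' z = l%:M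
   & forall a (u : 'rV[cplx]_N) s, (forall x : 'rV[cplx]_N, exists l, x *m r a = l *: u) -> wvec tx r (wt s) u ->
       (exists (cc : 'cV[cplx]_d') (ww : 'rV[cplx]_d'), r' a = cc *m ww) /\ (r' a != 0 -> has_wt r' s)].
Proof.
move=> tk; have S0 : stable r 0 by move=> x a; rewrite !submx0 => /eqP ->; rewrite mul0mx.
have v0 : ~~ (vq k <= (0 : 'M[cplx]_N))%MS by rewrite submx0 vq_neq0.
have [d' [r' [v' [[Hr' Ir'] _ v0' Hl Hu]]]] := simple_quotient Hr S0 v0.
exists d', r'; split=> //.
- exists v' => // i; apply: Hl; by rewrite (vq_weight tk i) subrr sub0mx.
- move=> z l Hz Ez; apply: (central_scalar Hr' _ Hz (v := v')).
    by move=> x; exact: (proj2 Ir').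
  by apply: Hl; rewrite Ez mul_mx_scalar subrr sub0mx.
move=> a u s Hx Hw; have [H1 H2] := Hu a u Hx; split=> // ra.
by have [y y0 Hy] := H2 _ _ _ Hw ra; exists y.
Qed.
End Subquotients.

(** * The simply laced case *)

Section Subsystem.
Variables (i j : 'I_n).

(** For a root: not in the plane of [al i] and [al j]. On such roots the character [t] will be
    generic. *)
Definition outside (b : 'cV[rat]_n) := exists k, [/\ k != i, k != j & co k b != 0].

Lemma has_wt_ext d (r : A -> 'M[cplx]_d) t t' : (forall x, t x = t' x) -> has_wt r t -> has_wt r t'.
Proof.
move=> E [v v0 Hv]; exists v => // k; rewrite Hv; congr (_ *: _).
by rewrite !ffunE E.
Qed.
Lemma tWM w w' t x : inW0 R w -> inW0 R w' -> tW w (tW w' t) x = tW (w *m w') t x.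
Proof. by move=> Hw Hw'; rewrite /tW (invmxM Hw Hw') -mulmxA. Qed.

Lemma co_sr k l x : k != l -> co k (sr l *m x) = co k x.
Proof. by move=> kl; rewrite srE -scaleNr coD coZ co_al (negbTE kl) mulr0 addr0. Qed.

(* Weights outside {1, q, q^-1} propagate a weight along the minimal coset representatives of W0 / <s_i, s_j>. *)
Lemma weights_spread d (r : A -> 'M[cplx]_d) t w0 : i != j -> is_rep r -> tchar R t ->
  (forall b, b \in rts -> outside b -> [/\ t b != 1, t b != q & t b != q^-1]) ->
  inW0 R w0 -> (forall b, outside b -> outside (invmx w0 *m b)) ->
  has_wt r (tW w0 t) -> forall u, u \in Dset i j -> has_wt r (tW (u *m w0) t).
Proof.
move=> ij Hr Ht Hout Hw0 Hw0o H0 u /mem_Dset [Hu]; elim/W0_indl: u / Hu => [|u k Hu Hp IH] ui uj; first by rewrite mul1mx.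
have Hi := W0_invmx HR Hu; have Wk := W0_sr k; have Huw := W0_mul Hu Hw0.
have keep l : (sr k *m u) *m al l \in pos -> u *m al l \in pos.
  move=> Hl; have Rl : u *m al l \in rts by apply: W0_rootD => //; exact: al_root.
  apply: contraT; rewrite -mem_posN // => Hn.
  have [E|E] := eqVneq (- (u *m al l)) (al k).
    by move: Hp; rewrite -E mulmxN mulKmx ?(W0_unit HR Hu) // mem_posN ?al_root // al_pos.
  by have := sr_pos Hn E; rewrite mulmx_posN ?mulmxA ?Hl.
apply: (has_wt_ext (t := tW (sr k) (tW (u *m w0) t))).
  by move=> x; rewrite tWM // mulmxA.
have [||H1 H2 H3] := Hout (invmx (u *m w0) *m al k).
- by apply: W0_rootD; [exact: W0_invmx|exact: al_root].
(* If u^-1 al_k were a combination of [al i] and [al j], then s_k u, which keeps both of them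
   positive, would send this positive root to - al_k. *)
- rewrite (invmxM Hu Hw0) -mulmxA; apply: Hw0o; apply: Classical_Prop.NNPP => Hno.
  set b := invmx u *m al k in Hp Hno.
  have Eb : b = co i b *: al i + co j b *: al j.
    apply: co_inj => l; rewrite coD !coZ !co_al.
    have [->|li] := eqVneq l i; last have [->|lj] := eqVneq l j.
    + by rewrite (negbTE ij) mulr0 addr0 mulr1.
    + by rewrite mulr0 add0r mulr1.
    rewrite !mulr0 addr0; apply/eqP; apply: contraT => H; case: Hno; by exists l.
  have : (sr k *m u) *m b \in pos.
    have Rb : (sr k *m u) *m b \in rts by apply: W0_rootD; [exact: W0_mul|exact: (pos_rts Hp)].
    apply: (pos_comb2 Rb ui uj (pos_co_ge0 i Hp) (pos_co_ge0 j Hp)).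
    by rewrite {1}Eb mulmxDr -!scalemxAr.
  by rewrite -mulmxA /b mulKVmx ?(W0_unit HR Hu) // sr_al mem_posN ?al_root // al_pos.
apply: (wt_step Hr _ _ H1 H2 H3); first exact: tW_tchar.
by apply: IH; apply: keep.
Qed.

Lemma Dset_cover : i != j -> pr (al j) (al i) = -1 -> pr (al i) (al j) = -1 -> (size W0s <= size (Dset i j) * 6)%N.
Proof.
move=> ij aij aji.
pose V6 := [:: 1%:M; sr i; sr j; sr j *m sr i; sr i *m sr j; sr i *m sr j *m sr i].
have <- : size [seq u *m v | u <- Dset i j, v <- V6] = (size (Dset i j) * 6)%N by rewrite size_allpairs.
apply: uniq_leq_size => // w /W0P Hw.
have Eji : sr i *m al j = al j + al i by rewrite srE aij scaleN1r opprK.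
have Eij : sr j *m al i = al i + al j by rewrite srE aji scaleN1r opprK.
have Wi := W0_sr i; have Wj := W0_sr j; have [Wij Wji] := (W0_mul Wi Wj, W0_mul Wj Wi).
have fin u v : v \in V6 -> inW0 R u -> u *m al i \in pos -> u *m al j \in pos -> w = u *m v ->
    w \in [seq u *m v | u <- Dset i j, v <- V6].
  by move=> Hv Hu Hi Hj ->; apply: allpairs_f => //; apply/mem_Dset.
have [Hi|Hi] := boolP (w *m al i \in pos); have [Hj|Hj] := boolP (w *m al j \in pos).
- by apply: (fin w 1%:M) => //; rewrite ?mulmx1 // !inE eqxx.
- have H1 : (w *m sr j) *m al j \in pos by rewrite -mulmxA sr_al mulmx_posN // al_root.
  have Hw1 := W0_mul Hw Wj.
  have [H2|H2] := boolP ((w *m sr j) *m al i \in pos).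
    by apply: (fin (w *m sr j) (sr j)) => //; rewrite ?srKr // !inE eqxx !orbT.
  apply: (fin (w *m sr j *m sr i) (sr i *m sr j)); rewrite ?mulmxA ?srKr //.
  - by rewrite !inE eqxx !orbT.
  - by apply: W0_mul.
  - by rewrite -mulmxA sr_al mulmx_posN // al_root.
  by rewrite -!mulmxA Eji mulmxDr sr_al Eij addrC addrK -?addrA ?addNr ?addr0 // addrC addrK.
- have H1 : (w *m sr i) *m al i \in pos by rewrite -mulmxA sr_al mulmx_posN // al_root.
  have Hw1 := W0_mul Hw Wi.
  have [H2|H2] := boolP ((w *m sr i) *m al j \in pos).
    by apply: (fin (w *m sr i) (sr i)) => //; rewrite ?srKr // !inE eqxx !orbT.
  apply: (fin (w *m sr i *m sr j) (sr j *m sr i)); rewrite ?mulmxA ?srKr //.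
  - by rewrite !inE eqxx !orbT.
  - by apply: W0_mul.
  - by rewrite -!mulmxA Eij mulmxDr sr_al Eji addrC addrK -?addrA ?addNr ?addr0 // addrC addrK.
  by rewrite -mulmxA sr_al mulmx_posN // al_root.
have Wl := W0_mul (W0_mul Hw Wi) (W0_mul Wj Wi).
have E1 : sr i *m (sr j *m (sr i *m al i)) = - al j.
  by rewrite sr_al !mulmxN Eij mulmxDr sr_al Eji addrC addrK.
have E2 : sr i *m (sr j *m (sr i *m al j)) = - al i.
  by rewrite Eji mulmxDr sr_al Eij addrC addrK sr_al.
apply: (fin (w *m sr i *m sr j *m sr i) (sr i *m sr j *m sr i)); rewrite ?mulmxA ?srKr //.
- by rewrite !inE eqxx !orbT.
- by rewrite -!mulmxA; rewrite mulmxA in Wl; rewrite !mulmxA.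
- by rewrite -!mulmxA E1 mulmx_posN // al_root.
by rewrite -!mulmxA E2 mulmx_posN // al_root.
Qed.
End Subsystem.

Section SimplyLacedCharacter.
Variables (i j : 'I_n).
Hypotheses (ij : i != j) (aij : pr (al j) (al i) = -1) (aji : pr (al i) (al j) = -1).

(** The plane carries a system of type A2. If b = x al_i + y al_j with x and y positive, then s_i b
    and s_j b are positive, which gives y >= x and x >= y. So s_i b = y al_j is a root, and y =
    1. *)
Lemma inside_pos b : b \in pos -> ~ outside i j b -> b = al i \/ b = al j \/ b = al i + al j.
Proof.
move=> Hb Hno; have Rb := pos_rts Hb.
have Eb : b = co i b *: al i + co j b *: al j.
  apply: co_inj => l; rewrite coD !coZ !co_al.
  have [->|li] := eqVneq l i; last have [->|lj] := eqVneq l j.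
  - by rewrite (negbTE ij) mulr0 addr0 mulr1.
  - by rewrite mulr0 add0r mulr1.
  rewrite !mulr0 addr0; apply/eqP; apply: contraT => H; case: Hno; by exists l.
have x0 := pos_co_ge0 i Hb; have y0 := pos_co_ge0 j Hb.
have mult k x : b = x *: al k -> b = al k.
  move=> E; have [//|E'] := root_prop (b_red D) Rb (al_root k) E.
  by move: Hb; rewrite E' mem_posN ?al_root // al_pos.
have [yz|yn] := eqVneq (co j b) 0; first by left; apply: (mult i (co i b)); rewrite {1}Eb yz scale0r addr0.
have [xz|xn] := eqVneq (co i b) 0; first by right; left; apply: (mult j (co j b)); rewrite {1}Eb xz scale0r add0r.
have xp : 0 < co i b by rewrite lt_def xn. have yp : 0 < co j b by rewrite lt_def yn.
have pri : pr b (al i) = 2 * co i b - co j b.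
  by rewrite {1}Eb pairingD !pairingZ (pr_self HR) ?al_root // aij mulrN1 mulrC.
have prj : pr b (al j) = 2 * co j b - co i b.
  by rewrite {1}Eb pairingD !pairingZ (pr_self HR) ?al_root // aji mulrN1 addrC [2 * _]mulrC.
have refl k l : k != l -> 0 < co k b -> 0 <= co l b - pr b (al l).
  move=> kl H; have Rs : sr l *m b \in rts by apply: W0_rootD => //; exact: W0_sr.
  have Ps : sr l *m b \in pos by apply: (co_gt0_pos Rs (i := k)); rewrite co_sr.
  have := pos_co_ge0 l Ps; rewrite srE -scaleNr coD coZ co_al eqxx mulr1 //.
have H1 := refl j i; rewrite eq_sym ij pri in H1; have {}H1 := H1 isT yp.
have H2 := refl i j ij xp; rewrite prj in H2.
have Exy : co i b = co j b by lra.
have Rs : sr i *m b \in rts by apply: W0_rootD => //; exact: W0_sr.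
have Es : sr i *m b = co j b *: al j.
  rewrite srE pri {1}Eb Exy; have -> : 2 * co j b - co j b = co j b by ring.
  by rewrite addrAC subrr add0r.
right; right; have x1 : co j b = 1.
  have [E|E] := root_prop (b_red D) Rs (al_root j) Es; move: Es; rewrite E => /(congr1 (co j)).
    by rewrite coZ co_al eqxx mulr1.
  by rewrite coN coZ co_al eqxx mulr1 => H; move: yp; rewrite -H oppr_gt0 ltr10.
by rewrite Eb Exy x1 !scale1r.
Qed.

(* 2 rho^vee minus twice that of the subsystem spanned by al i and al j. *)
Definition xi (x : 'cV[rat]_n) : rat := delta x - 2 * pr x (al i) - 2 * pr x (al j).
Lemma xiD x y : xi (x + y) = xi x + xi y.
Proof. by rewrite /xi deltaD !pairingD; ring. Qed.
Lemma xiZ k x : xi (k *: x) = k * xi x.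
Proof. by rewrite /xi deltaZ !pairingZ; ring. Qed.
Lemma xi0 : xi 0 = 0. Proof. by rewrite -(scale0r 0) xiZ mul0r. Qed.
Lemma xi_sum (I : Type) (s : seq I) (F : I -> 'cV[rat]_n) : xi (\sum_(k <- s) F k) = \sum_(k <- s) xi (F k).
Proof. by elim/big_rec2: _ => [|k x y _ <-]; rewrite ?xi0 ?xiD. Qed.
Lemma xi_int x : inX R x -> is_int (xi x).
Proof.
move=> Xx; have [m1 E1] := delta_int Xx; have [m2 E2] := Xx _ (al_root i); have [m3 E3] := Xx _ (al_root j).
by exists (m1 - 2 * m2 - 2 * m3); rewrite /xi E1 E2 E3 !rmorphB !rmorphM.
Qed.
Lemma xi_i : xi (al i) = 0.
Proof. by rewrite /xi delta_al (pr_self HR) ?al_root // aji; lra. Qed.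
Lemma xi_j : xi (al j) = 0.
Proof. by rewrite /xi delta_al (pr_self HR) ?al_root // aij; lra. Qed.
Lemma xi_out k : k != i -> k != j -> 0 < xi (al k).
Proof.
move=> ki kj; rewrite /xi delta_al.
have [|m1 ->] := @cartan i k; first by rewrite eq_sym.
have [|m2 ->] := @cartan j k; first by rewrite eq_sym.
by have := ler0n rat m1; have := ler0n rat m2; lra.
Qed.
Lemma xi_al_ge0 k : 0 <= xi (al k).
Proof.
have [->|ki] := eqVneq k i; first by rewrite xi_i.
have [->|kj] := eqVneq k j; first by rewrite xi_j.
exact/ltW/xi_out.
Qed.
Lemma xi_pos_ge0 b : b \in pos -> 0 <= xi b.
Proof.
move=> Hb; rewrite (coE b) xi_sum; apply: sumr_ge0 => k _.
by rewrite xiZ mulr_ge0 ?xi_al_ge0 ?pos_co_ge0.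
Qed.
Lemma xi_outside b : b \in pos -> outside i j b -> 0 < xi b.
Proof.
move=> Hb [k [ki kj Hk]]; rewrite (coE b) xi_sum (bigD1 k) //= xiZ.
apply: ltr_pwDl; first by rewrite mulr_gt0 ?xi_out // lt_def Hk pos_co_ge0.
by apply: sumr_ge0 => l _; rewrite xiZ mulr_ge0 ?xi_al_ge0 ?pos_co_ge0.
Qed.

(** t = Q s^xi equals q on [al i] and [al j], where [xi] vanishes; [s] has to avoid finitely many
    equations. [l1] keeps [t] off 1, q, q^-1 on outside roots, and [l2] forces every [w] fixing [t]
    to preserve [xi]. Such a [w] could only turn [al i] or [al j] negative; then a positive root of
    the plane would take the value q^-1, whereas these values are q, q and q^2. *)
Lemma generic_char : q != 1 -> q != -1 -> q ^+ 3 != 1 -> exists t, [/\ tchar R t, t (al i) = q, t (al j) = q,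
  forall b, b \in rts -> outside i j b -> [/\ t b != 1, t b != q & t b != q^-1] & regular t].
Proof.
move=> q1 qN q3.
pose l1 := [seq (Q b, v, xi b) | b <- rts, v <- [:: 1; q; q^-1]].
pose l2 := [seq (Q (w *m om l), Q (om l), xi (w *m om l) - xi (om l)) | w <- W0s, l <- enum 'I_n].
have [|s [s0 Hs]] := @generic_power [seq p <- l1 ++ l2 | p.2 != 0].
  move=> p; rewrite mem_filter => /andP [p0]; rewrite mem_cat => /orP [] /allpairsP [[b v] /= [Hb Hv Ep]];
    rewrite Ep /= in p0 *; split=> //.
  - exact/(proj2 Q_tchar)/inX_root.
  - by move: Hv; rewrite !inE => /or3P [] /eqP ->; rewrite ?oner_eq0 ?invr_eq0.
  - exact/xi_int/inX_root.
  - by apply/(proj2 Q_tchar)/inX_W0; [exact/W0P|exact: om_X].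
  - exact/(proj2 Q_tchar)/om_X.
  by apply: is_intB; apply: xi_int; [apply: inX_W0; [exact/W0P|exact: om_X]|exact: om_X].
pose t x := Q x * zexp s (xi x).
have Hxi : tchar R (fun x => zexp s (xi x)).
  split=> [x y Xx Xy|x _]; last exact: zexp_neq0.
  by rewrite xiD zexpD //; exact: xi_int.
have Ht : tchar R t := tcharM Q_tchar Hxi.
have z0 : zexp s 0 = 1 by rewrite (zexp_nat s 0).
have ti : t (al i) = q by rewrite /t xi_i z0 Q_al mulr1.
have tj : t (al j) = q by rewrite /t xi_j z0 Q_al mulr1.
have xi_out0 b : b \in rts -> outside i j b -> xi b != 0.
  move=> Rb Hb; have [Hp|Hp] := pos_or HR Hpos Rb; first by rewrite gt_eqF // xi_outside.
  have Ho : outside i j (- b) by have [k [ki kj Hk]] := Hb; exists k; rewrite coN oppr_eq0.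
  by have := xi_outside Hp Ho; rewrite -scaleN1r xiZ mulN1r oppr_gt0 => /lt_eqF ->.
exists t; split=> //.
  move=> b Rb Hb; have nz := xi_out0 _ Rb Hb.
  have H v : v \in [:: 1; q; q^-1] -> t b != v.
    move=> Hv; apply: (Hs (Q b, v, xi b)); rewrite mem_filter /= nz mem_cat.
    by rewrite (allpairs_f (fun b v => (Q b, v, xi b))).
  by split; apply: H; rewrite !inE eqxx ?orbT.
move=> w Hw w1; apply: Classical_Prop.NNPP => Hno.
have Hfix x : inX R x -> t (w *m x) = t x.
  by move=> Xx; apply/eqP; apply: contraT => H; case: Hno; exists x.
have xi_om l : xi (w *m om l) = xi (om l).
  apply/eqP; rewrite -subr_eq0; apply: contraT => nz.
  have Xl := om_X l; have Xw := inX_W0 Hw Xl.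
  have : Q (w *m om l) * zexp s (xi (w *m om l) - xi (om l)) != Q (om l).
    apply: (Hs (Q (w *m om l), Q (om l), xi (w *m om l) - xi (om l))).
    rewrite mem_filter /= nz mem_cat orbC (allpairs_f (fun w l => (Q (w *m om l), Q (om l), xi (w *m om l) - xi (om l)))) ?mem_enum //.
    by apply/W0P.
  case/eqP; apply: (mulIf (zexp_neq0 (xi (om l)) s0)).
  rewrite -mulrA -zexpD ?subrK //; first exact: Hfix.
    by apply: is_intB; exact: xi_int.
  exact: xi_int.
have xi_w x : xi (w *m x) = xi x.
  rewrite (omE x) mulmx_sumr !xi_sum; apply: eq_bigr => l _.
  by rewrite -scalemxAr !xiZ xi_om.
case/eqP: w1; apply: l0_eq0 => // k.
have Rk : w *m al k \in rts by apply: W0_rootD => //; exact: al_root.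
apply: contraT; rewrite -mem_posN // => Hn.
have q2 : q * q != 1.
  by rewrite -expr2 -subr_eq0 subr_sqr_1 mulf_neq0 // ?subr_eq0 // addr_eq0.
have key : k = i \/ k = j -> false.
  move=> Hk; have xik : xi (al k) = 0 by case: Hk => ->; rewrite ?xi_i ?xi_j.
  have tk : t (w *m al k) = q by rewrite Hfix; [case: Hk => ->|exact: inX_al1].
  have tn : t (- (w *m al k)) = q^-1 by rewrite (tcharN Ht (inX_root Rk)) tk.
  have Hin : ~ outside i j (- (w *m al k)).
    by move=> /(xi_outside Hn); rewrite -scaleN1r xiZ xi_w xik mulr0 ltxx.
  have qq v : q^-1 = v -> q * v = 1 by move=> <-; rewrite mulfV.
  case: (inside_pos Hn Hin) => [E|[E|E]]; move: tn; rewrite E ?ti ?tj => /esym /qq.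
  - by move=> /eqP; rewrite (negbTE q2).
  - by move=> /eqP; rewrite (negbTE q2).
  have -> : t (al i + al j) = q * q by rewrite (proj1 Ht) ?ti ?tj //; exact: inX_al1.
  by move=> E3; case/eqP: q3; rewrite -E3 !exprS expr0 mulr1.
have [ki|ki] := eqVneq k i; first by apply: key; left.
have [kj|kj] := eqVneq k j; first by apply: key; right.
by have := xi_pos_ge0 Hn; rewrite -scaleN1r xiZ xi_w mulN1r oppr_ge0 leNgt xi_out.
Qed.
End SimplyLacedCharacter.

Hypothesis q1 : q != 1.

Lemma augmentation : exists h : A -> cplx, [/\ forall a b, h (a + b) = h a + h b, forall k a, h (k *: a) = k * h a,
  forall a b, h (a * b) = h a * h b & h 1 = 1].
Proof.
have [h [hD hZ hT]] := linear_extension (fun=> 1 : cplx^o) (proj1 He).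
have hE w x : inW0 R w -> inX R x -> h (EE w x) = 1.
  by move=> Hw Xx; have [a [_ _ ->]] := EE_ex Hw Xx.
have {}hZ k a : h (k *: a) = k * h a by exact: hZ.
have h0 : h 0 = 0 by have := hZ 0 0; rewrite scale0r mul0r.
exists h; split=> //; last by rewrite -Ew1 hE //; exact: inX0.
move=> a b; have [s [Hs ->]] := EE_span a; have [s' [Hs' ->]] := EE_span b.
rewrite big_seq; elim/big_rec: _ => [|p x /Hs [Hw Xx] IH]; first by rewrite mul0r h0 mul0r.
rewrite mulrDl !hD mulrDl {}IH; congr (_ + _); rewrite -scalerAl !hZ hE // mulr1; congr (_ * _).
rewrite big_seq; elim/big_rec: _ => [|p' y /Hs' [Hw' Xx'] IH]; first by rewrite mulr0.
rewrite mulrDr !hD IH; congr (_ + _); rewrite -scalerAr !hZ EE_mul // !hE //.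
  exact: W0_mul.
by apply: inXD => //; apply: inX_W0 => //; exact: W0_invmx.
Qed.

Lemma weight_count d (r : A -> 'M[cplx]_d) t (ws : seq 'M[rat]_n) : is_rep r -> tchar R t -> regular t ->
  uniq ws -> (forall w, w \in ws -> inW0 R w /\ has_wt r (tW w t)) -> (size ws <= d)%N.
Proof.
move=> Hr Ht Hreg Hu Hws.
have HV cc : exists v : 'rV[cplx]_d, cc \in [seq wt (tW w t) | w <- ws] -> v != 0 /\ wvec tx r cc v.
  have [/mapP [w Hw ->]|_] := boolP (cc \in [seq wt (tW w t) | w <- ws]); last by exists 0.
  by have [_ [v v0 Hv]] := Hws _ Hw; exists v.
rewrite -(size_map (fun w => wt (tW w t)) ws).
apply: (weights_leq (V := fun cc => sval (constructive_indefinite_description _ (HV cc))) Hr).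
  rewrite map_inj_in_uniq // => w w' Hw Hw'; apply: (wt_tW_inj Ht Hreg); apply/W0P.
    by have [] := Hws _ Hw.
  by have [] := Hws _ Hw'.
by move=> cc; case: (constructive_indefinite_description _ (HV cc)) => v /= H; exact: H.
Qed.

Section SimplyLaced.
Variables (i j : 'I_n).
Hypotheses (ij : i != j) (aij : pr (al j) (al i) = -1) (aji : pr (al i) (al j) = -1).

(** The value of s_i t at [al j] is q^2, which avoids 1, q and q^-1, so s_j s_i t is a weight as
    well; both spread over [Dset i j]. The recorded signs of w al_i and w al_j separate this family
    from the one with i and j exchanged. *)
Lemma half_weights d (r : A -> 'M[cplx]_d) t : is_rep r -> tchar R t ->
  (forall b, b \in rts -> outside i j b -> [/\ t b != 1, t b != q & t b != q^-1]) ->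
  t (al i) = q -> t (al j) = q -> q != -1 -> q ^+ 3 != 1 -> has_wt r (tW (sr i) t) ->
  exists ws, [/\ uniq ws, size ws = (2 * size (Dset i j))%N
   & forall w, w \in ws -> [/\ inW0 R w, has_wt r (tW w t), w *m al i \notin pos & w *m al j \in pos]].
Proof.
move=> Hr Ht Hout ti tj qN q3 H0.
have Wi := W0_sr i; have Wj := W0_sr j; have Wji := W0_mul Wj Wi.
have Eji : sr i *m al j = al j + al i by rewrite srE aij scaleN1r opprK.
have Eij : sr j *m al i = al i + al j by rewrite srE aji scaleN1r opprK.
have q2 : q * q != 1.
  by rewrite -expr2 -subr_eq0 subr_sqr_1 mulf_neq0 // ?subr_eq0 // addr_eq0.
have outs l b : l = i \/ l = j -> outside i j b -> outside i j (sr l *m b).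
  by move=> Hl [k [ki kj Hk]]; exists k; split=> //; rewrite co_sr //; case: Hl => ->.
have H1 : has_wt r (tW (sr j *m sr i) t).
  apply: (has_wt_ext (t := tW (sr j) (tW (sr i) t))); first by move=> x; rewrite tWM.
  have E : tW (sr i) t (al j) = q * q.
    by rewrite /tW invmx_sr Eji (proj1 Ht) ?ti ?tj //; exact: inX_al1.
  apply: (wt_step Hr (tW_tchar Wi Ht) H0); rewrite E //.
    by rewrite -[X in _ != X]mulr1 (inj_eq (mulfI q0)).
  by apply: contra q3 => /eqP E'; rewrite !exprS expr0 mulr1 E' mulfV.
have spread w0 : inW0 R w0 -> (forall b, outside i j b -> outside i j (invmx w0 *m b)) -> has_wt r (tW w0 t) ->
    forall u, u \in Dset i j -> has_wt r (tW (u *m w0) t).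
  by move=> Hw0 Ho Hwt; exact: weights_spread.
have inj w0 : inW0 R w0 -> injective (fun u : 'M[rat]_n => u *m w0).
  by move=> Hw0 u u' /(congr1 (mulmx^~ (invmx w0))); rewrite !mulmxK // (W0_unit HR Hw0).
have Du : uniq (Dset i j) by exact: filter_uniq.
exists ([seq u *m sr i | u <- Dset i j] ++ [seq u *m (sr j *m sr i) | u <- Dset i j]); split.
- rewrite cat_uniq !(map_inj_uniq (inj _ _)) // Du andbT /=; apply/hasPn => w /mapP [u Hu ->].
  apply/mapP => -[u' Hu' /(congr1 (mulmx^~ (sr i)))]; rewrite !mulmxA !srKr => E.
  have [Wu _ Hj] := (iffLR (mem_Dset _ _ _) Hu); have [Wu' _ Hj'] := (iffLR (mem_Dset _ _ _) Hu').
  by move: Hj'; rewrite -E -mulmxA sr_al mulmx_posN ?al_root // Hj.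
- by rewrite size_cat !size_map mul2n addnn.
move=> w; rewrite mem_cat => /orP [] /mapP [u Hu ->]; have [Wu Hi Hj] := (iffLR (mem_Dset _ _ _) Hu).
  have Rij : u *m (al j + al i) \in rts by rewrite -Eji; apply: W0_rootD => //; apply: W0_rootD => //; exact: al_root.
  split; first exact: W0_mul.
  - by apply: spread => // b Hb; rewrite invmx_sr; apply: outs => //; left.
  - by rewrite -mulmxA sr_al mulmx_posN ?negbK ?al_root.
  rewrite -mulmxA Eji; apply: (pos_comb2 Rij Hj Hi ler01 ler01).
  by rewrite !scale1r mulmxDr.
have Rij : u *m (al i + al j) \in rts by rewrite -Eij; apply: W0_rootD => //; apply: W0_rootD => //; exact: al_root.
split; first exact: W0_mul.
- apply: spread => // b Hb; rewrite (invmxM Wj Wi) !invmx_sr -mulmxA.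
  by apply: (outs _ _ (or_introl erefl)); exact: (outs _ _ (or_intror erefl)).
- rewrite -!mulmxA sr_al mulmxN Eij mulmx_posN ?negbK //; last by rewrite -Eij; apply: W0_rootD => //; exact: al_root.
  by apply: (pos_comb2 Rij Hi Hj ler01 ler01); rewrite !scale1r mulmxDr.
by rewrite -!mulmxA Eji mulmxDr sr_al Eij addrC addrK.
Qed.
End SimplyLaced.

(* The composition factors of the module induced from t, over which all X-weights form a single orbit
   with at most |Dset i j| elements. *)
Lemma linked_factors i j t : tchar R t -> t (al i) = q -> t (al j) = q ->
  exists r s d1 (r1 : A -> 'M[cplx]_d1) (v1 : 'rV[cplx]_d1),
  [/\ induced t r, tchar R s, (size (orb s) <= size (Dset i j))%N,
    [/\ is_rep r1, (0 < d1 <= size (Dset i j))%N, v1 != 0, v1 *m r1 (Ti i) = q *: v1 & v1 *m r1 (Ti j) = q *: v1]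
  & forall k, t (al k) = q -> exists d' (r' : A -> 'M[cplx]_d') s' v',
    [/\ is_rep r' /\ irred r', has_wt r' (tW (sr k) t),
      [/\ tchar R s', v' != 0, xweight r' s' v' & wB s' \in orb s]
    & forall a (u : 'rV[cplx]_N) s, (forall x : 'rV[cplx]_N, exists l, x *m r a = l *: u) -> wvec tx r (wt s) u ->
       (exists (cc : 'cV[cplx]_d') (ww : 'rV[cplx]_d'), r' a = cc *m ww) /\ (r' a != 0 -> has_wt r' s)]].
Proof.
move=> Ht ti tj; have [r Hi] := induced_ex Ht.
have [d1 [r1 [v1 [[Hr1 I1] Hd1 v10 Hl1 [E1 E2]]]]] := one_dim_like Ht Hi ti tj.
have [s [w1 [Hs w10 Hw1]]] := xweight_ex Hr1 (proj1 I1).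
exists r, s, d1, r1, v1; split=> //.
- exact: leq_trans (orb_leq Hr1 w10 Hw1) Hd1.
- by split=> //; rewrite (proj1 I1).
move=> k tk; have [d' [r' [[Hr' I'] Hwt Hz Hrk]]] := simple_of_weight Ht Hi tk.
have [s' [v' [Hs' v0' Hv']]] := xweight_ex Hr' (proj1 I').
exists d', r', s', v'; split=> //; split=> //.
apply: (linked_orbit Hr1 Hr' w10 Hw1 v0' Hv' Hs') => z Hzc.
have [l El] := central_induced Ht Hi Hzc; exists l; split; last exact: Hz.
apply: (central_scalar Hr1 (v := v1) _ Hzc); last exact: Hl1.
by move=> x; exact: (proj2 I1).
Qed.

Lemma simply_laced_contra i j : i != j -> pr (al j) (al i) = -1 -> pr (al i) (al j) = -1 -> False.
Proof.
move=> ij aij aji; have [h [hD hZ hM h1]] := augmentation.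
have Wi := W0_sr i; have Wj := W0_sr j.
(* The braid relation of a simple edge makes T_i and T_j conjugate, so [h] agrees on them, as
   [poincare_quantum] requires. *)
have hij : h (Ti i) = h (Ti j).
  have Eji : sr i *m al j = al j + al i by rewrite srE aij scaleN1r opprK.
  have Eij : sr j *m al i = al j + al i by rewrite srE aji scaleN1r opprK addrC.
  have Pij : al j + al i \in pos.
    apply: (pos_comb2 (k := 1) (l := 1) _ (al_pos j) (al_pos i)); rewrite ?scale1r //.
    by rewrite -Eji; apply: W0_rootD => //; exact: al_root.
  have braid : sr i *m sr j *m sr i = sr j *m sr i *m sr j.
    have cj k l : sr k *m sr l *m sr k = refl_mx R (sr k *m al l).
      by rewrite (refl_conj HR W0u W0P (W0_sr k) (al_root l)) invmx_sr.
    by rewrite !cj Eji Eij.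
  have TTT k l : sr k *m al l = al j + al i -> (sr k *m sr l) *m al k = al l ->
      Tw (sr k *m sr l *m sr k) = Ti k * Ti l * Ti k.
    move=> H1 H2; rewrite -Tw_mulr; [|by apply: W0_mul; exact: W0_sr|by rewrite H2 al_pos].
    by rewrite -Tw_mulr //; [exact: W0_sr|rewrite H1].
  have := TTT i j Eji; rewrite -mulmxA Eij mulmxDr sr_al Eji addrK => /(_ erefl).
  rewrite braid (TTT j i Eij) => [|]; last by rewrite -mulmxA Eji mulmxDr sr_al Eij addKr.
  move=> /(congr1 h); rewrite !hM => E.
  have u k : h (Ti k) != 0.
    apply/eqP => h0; have := congr1 h (TiTv k); rewrite hM h0 mul0r h1 => /eqP.
    by rewrite eq_sym oner_eq0.
  have : h (Ti j) * h (Ti i) * h (Ti j) = h (Ti j) * h (Ti i) * h (Ti i) by rewrite E; ring.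
  by move/(mulfI (mulf_neq0 (u j) (u i))).
have [|qN q3] := poincare_quantum hD hZ hM h1 hij (aij : _ = - 1%:R) (aji : _ = - 1%:R) erefl _ q1; first by left.
have [t [Ht ti tj Hout Hreg]] := generic_char ij aij aji q1 qN q3.
have [r [s [d1 [r1 [v1 [Hi Hs Os _ Hk]]]]]] := linked_factors Ht ti tj.
have [Hr rW rX] := Hi.
have [d2 [r2 [s2 [v2 [[Hr2 I2] W2 [Hs2 v20 Hv2 O2] K2]]]]] := Hk i ti.
have [d3 [r3 [s3 [v3 [[Hr3 I3] W3 [Hs3 v30 Hv3 O3] K3]]]]] := Hk j tj.
have HN := Dset_cover ij aij aji.
have [a2 [u2 [Hu2 wu2 Ha2]]] := induced_line Ht Hr rW rX Hreg Wi.
have [a3 [u3 [Hu3 wu3 Ha3]]] := induced_line Ht Hr rW rX Hreg Wj.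
have Dji w : (w \in Dset j i) = (w \in Dset i j) by rewrite !mem_filter /=; congr (_ && _); exact: andbC.
have sji : size (Dset j i) = size (Dset i j).
  by apply: perm_size; apply: uniq_perm => //; exact: filter_uniq.
have outC b : outside j i b -> outside i j b by move=> [k [? ? ?]]; exists k.
have Hout' b : b \in rts -> outside j i b -> [/\ t b != 1, t b != q & t b != q^-1].
  by move=> Rb /outC; exact: Hout.
have D0 : (0 < size (Dset i j))%N.
  have : 1%:M \in Dset i j by apply/mem_Dset; rewrite !mul1mx !al_pos; split=> //; exact: W0_1.
  by case: (Dset i j).
have [ws2 [U2 S2 P2]] := half_weights ij aij aji Hr2 Ht Hout ti tj qN q3 W2.
have ji : j != i by rewrite eq_sym.
have [ws3 [U3 S3 P3]] := half_weights ji aji aij Hr3 Ht Hout' tj ti qN q3 W3.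
have c2 : (size ws2 <= d2)%N.
  by apply: (weight_count Hr2 Ht Hreg U2) => w /P2 [H1 H2 _ _].
have c3 : (size ws3 <= d3)%N.
  by apply: (weight_count Hr3 Ht Hreg U3) => w /P3 [H1 H2 _ _].
have nz2 : r2 a2 != 0.
  have [v v0 Hv] := W2; apply: contra v0 => /eqP E.
  by rewrite -(Ha2 _ _ _ Hr2 Hv) E mulmx0.
have nz3 : r3 a3 != 0.
  have [v v0 Hv] := W3; apply: contra v0 => /eqP E.
  by rewrite -(Ha3 _ _ _ Hr3 Hv) E mulmx0.
have [[cc2 [ww2 E2]] _] := K2 _ _ _ Hu2 wu2; have [[cc3 [ww3 E3]] _] := K3 _ _ _ Hu3 wu3.
have [_ R3] := K3 _ _ _ Hu2 wu2.
have full3 X : exists b, r3 b = X.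
  rewrite E3 in nz3; have [b _ Eb] := density Hr3 I3 (K := fun=> True) I (fun _ _ _ _ => I) (fun _ _ _ => I) (fun _ _ _ => I) I E3 nz3 X.
  by exists b.
(* If [a2] acts on [r3] by a nonzero operator, [r3] also contains the weight s_i t and has dimension
   at least 4|D|. Otherwise [a2] tells [r2] from [r3], and A maps onto the product of the two matrix
   algebras. *)
have [r3a2|r3a2] := eqVneq (r3 a2) 0; last first.
  have [ws4 [U4 S4 P4]] := half_weights ij aij aji Hr3 Ht Hout ti tj qN q3 (R3 r3a2).
  have c4 : (size (ws3 ++ ws4) <= d3)%N.
    apply: (weight_count Hr3 Ht Hreg) => [|w]; last by rewrite mem_cat => /orP [/P3 []|/P4 []].
    rewrite cat_uniq U3 U4 andbT /=; apply/hasPn => w /P4 [_ _ Hni _]; apply/negP => /P3 [_ _ _ Hpi].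
    by rewrite Hpi in Hni.
  have := single_bound Hs Hr3 I3 v30 Hv3 Hs3 O3 full3; move: c4; rewrite size_cat S3 S4 sji.
  by move=> c4; exact: single_count D0 c4 HN Os.
(* The kernel of [r3] is a two-sided ideal containing [a2], which has rank one on [r2]. Its elements
   therefore correct the first component without changing the second. *)
have full X Y : exists b, r2 b = X /\ r3 b = Y.
  have [b Eb] := full3 Y; rewrite E2 in nz2.
  have [|a b' Ka Kb|a b' Ka|a b' Ka|a Ka Ea] := density Hr2 I2 (K := fun b => r3 b = 0) _ _ _ _ r3a2 E2 nz2 (X - r2 b).
  - exact: rep0.
  - by rewrite (repD Hr3) Ka Kb addr0.
  - by rewrite (repM Hr3) Ka mul0mx.
  - by rewrite (repM Hr3) Ka mulmx0.
  by exists (a + b); rewrite (repD Hr2) (repD Hr3) Ea Eb Ka add0r subrK.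
have := pair_bound Hs Hr2 I2 v20 Hv2 Hs2 O2 Hr3 I3 v30 Hv3 Hs3 O3 full.
rewrite S2 in c2; rewrite S3 sji in c3.
exact: pair_count D0 c2 c3 HN Os.
Qed.

(** * Types B2 and G2 *)

Section RankTwo.
Variables (i j : 'I_n) (a : nat).
Hypotheses (aij : pr (al j) (al i) = - a%:R) (aji : pr (al i) (al j) = -1).
Hypotheses (ij : i != j) (rank2 : forall k, k = i \/ k = j).

Let Eji : sr i *m al j = al j + al i *+ a.
Proof. by rewrite srE aij scaleNr opprK scaler_nat. Qed.
Let Eij : sr j *m al i = al i + al j.
Proof. by rewrite srE aji scaleN1r opprK. Qed.

(* If t (al j) = 1 then T_(om j) acts on u, T_j u by a Jordan block. In dimension 2, T_(om i) would act by a
   scalar, hence so would T_i, and then T_(ym i) = T_(om j) too. *)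
Lemma jordan_block d (r : A -> 'M[cplx]_d) t : is_rep r -> tchar R t -> has_wt r t -> t (al j) = 1 ->
  q != -1 -> (d <= 2)%N -> False.
Proof.
move=> Hr Ht [u u0 Hu] tj1 qN d2.
have q10 : q - 1 != 0 by rewrite subr_eq0.
set w := u *m r (Ti j).
have wtn k : wt t k != 0.
  by rewrite ffunE mulf_neq0 //; [exact/(proj2 Q_tchar)/om_X|exact/(proj2 Ht)/om_X].
have Ew_j : w *m r (tx j) = wt t j *: w + ((q - 1) * wt t j) *: u.
  by rewrite (rank1_eq j Hr Ht Hu) tj1 divr1.
have wu : ~~ (w <= u)%MS.
  apply/negP => /sub_rVP [l El]; move: Ew_j; rewrite El -scalemxAl (Hu j) !scalerA mulrC => /eqP.
  by rewrite -[X in X == _]addr0 (inj_eq (addrI _)) eq_sym scaler_eq0 (negbTE u0) orbF mulf_eq0 (negbTE q10) (negbTE (wtn j)).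
have Ew_i : w *m r (tx i) = wt t i *: w by exact: (rank1_ne Hr Hu ij).
have span (y : 'rV[cplx]_d) : exists k l, y = k *: u + l *: w.
  have Hf : row_full (u + w)%MS.
    have : (u < u + w)%MS by rewrite ltmxE addsmxSl /=; apply: contra wu => H; apply: submx_trans H; exact: addsmxSr.
    rewrite ltmxErank rank_rV u0 => /andP [_ H].
    by rewrite /row_full eqn_leq rank_leq_col (leq_trans d2 H).
  have /sub_addsmxP [[y1 y2] /= ->] := submx_full y Hf.
  exists (y1 0 0), (y2 0 0); by rewrite [y1]mx11_scalar [y2]mx11_scalar !mul_scalar_mx !mxE !eqxx !mulr1n.
have free k l : k *: u + l *: w = 0 -> k = 0 /\ l = 0.
  move=> E; have l0' : l = 0.
    apply/eqP; apply: contraT => ln; case/negP: wu.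
    have -> : w = (- (l^-1 * k)) *: u.
      apply: (scalerI ln); rewrite scalerA mulrN mulrA mulfV // mul1r scaleNr.
      by apply/eqP; rewrite -addr_eq0 addrC E.
    by rewrite scalemx_sub.
  by move: E; rewrite l0' scale0r addr0 => /eqP; rewrite scaler_eq0 (negbTE u0) orbF => /eqP.
have free2 k l k' l' : k *: u + l *: w = k' *: u + l' *: w -> k = k' /\ l = l'.
  move=> /eqP; rewrite -subr_eq0 opprD addrACA -!scalerBl => /eqP /free [/eqP H1 /eqP H2].
  by split; apply/eqP; rewrite -subr_eq0.
have scal_i (y : 'rV[cplx]_d) : y *m r (tx i) = wt t i *: y.
  have [k [l ->]] := span y; rewrite mulmxDl -!scalemxAl (Hu i) Ew_i scalerDr !scalerA.
  by rewrite ![wt t i * _]mulrC.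
set z := t (al i); have z0 : z != 0 by apply: (proj2 Ht); exact: inX_al1.
have z1 : z != 1.
  apply/eqP => z1; have := rank1_eq i Hr Ht Hu; rewrite -/z z1 divr1 scal_i => /eqP.
  by rewrite -[X in X == _]addr0 (inj_eq (addrI _)) eq_sym scaler_eq0 (negbTE u0) orbF mulf_eq0 (negbTE q10) (negbTE (wtn i)).
have nz : 1 - z^-1 != 0 by rewrite subr_eq0 eq_sym -invr1 (inj_eq invr_inj).
set g := (q - 1) / (1 - z^-1); have Hg : g * (1 - z^-1) = q - 1 by rewrite /g divfK.
have Eu : u *m r (Ti i) = g *: u.
  have /(_ i) := rank1_wt Hr Ht Hu Hg; rewrite scal_i !ffunE /tW invmx_sr srE pr_om eqxx scale1r.
  rewrite (tcharB Ht (om_X i) (inX_al1 i)) -/z => /eqP; rewrite -subr_eq0 -scalerBl scaler_eq0 => /orP [|].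
    have -> : Q (om i) * t (om i) - Q (om i) * (t (om i) / z) = (Q (om i) * t (om i)) * (1 - z^-1) by ring.
    by rewrite mulf_eq0 (negbTE nz) orbF; have := wtn i; rewrite ffunE => /negbTE ->.
  by rewrite subr_eq0 => /eqP.
have Tsq (y : 'rV[cplx]_d) : y *m r (Ti i) *m r (Ti i) = (q - 1) *: (y *m r (Ti i)) + q *: y.
  by rewrite -mulmxA -(repM Hr) Ti2 (repD Hr) (repZ Hr) (rep_scal Hr) mulmxDr -scalemxAr mul_mx_scalar.
have gq : g * g = (q - 1) * g + q.
  have := Tsq u; rewrite Eu -scalemxAl Eu !scalerA -scalerDl => /eqP.
  by rewrite -subr_eq0 -scalerBl scaler_eq0 (negbTE u0) orbF subr_eq0 => /eqP.
have [al1 [be Ey]] := span (w *m r (Ti i)).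
have Ebe : be = g.
  have E1 : w *m r (tx j) *m r (Ti i) = w *m r (Ti i) *m r (tx j).
    rewrite -!mulmxA -!(repM Hr) Tx_Ti //; [exact: om_X|exact: dom_om|].
    by rewrite pr_om eq_sym (negbTE ij).
  move: E1; rewrite Ew_j mulmxDl -!scalemxAl Ey Eu mulmxDl -!scalemxAl (Hu j) Ew_j !scalerDr !scalerA.
  rewrite addrAC -scalerDl [_ *: w + _ *: u]addrC addrA -scalerDl => /free2 [H _].
  have n0' : (q - 1) * wt t j != 0 by rewrite mulf_neq0.
  by apply: (mulIf n0'); apply: (addrI (al1 * wt t j)); rewrite -H; ring.
have al0 : al1 = 0.
  have := Tsq w; rewrite Ey mulmxDl -!scalemxAl Ey Eu Ebe !scalerDr !scalerA addrA -scalerDl -addrA -scalerDl.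
  move=> /free2 [H0 _]; have H : al1 * (2 * g - (q - 1)) = 0.
    have -> : al1 * (2 * g - (q - 1)) = (al1 * g + g * al1) - (q - 1) * al1 by ring.
    by rewrite H0 subrr.
  move/eqP: H; rewrite mulf_eq0 => /orP [/eqP //|/eqP H].
  have : (g - q) * (g + 1) == 0 by apply/eqP; rewrite mulrDr mulr1 mulrBl gq; ring.
  rewrite mulf_eq0 subr_eq0 addr_eq0 => /orP [] /eqP Eg; exfalso; move: H; rewrite Eg => H.
    by case/eqP: qN; apply/eqP; rewrite -addr_eq0 -H; apply/eqP; ring.
  by case/eqP: qN; apply/eqP; rewrite -addr_eq0 -oppr_eq0 -H; apply/eqP; ring.
have Ewi : w *m r (Ti i) = g *: w by rewrite Ey al0 Ebe scale0r add0r.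
have g0 : g != 0 by apply: contra q0 => /eqP g0; move: gq; rewrite g0 !mulr0 add0r => <-.
have ymE : ym i = om j.
  rewrite (omE (ym i)) (omE (om j)); apply: eq_bigr => k _; congr (_ *: _).
  case: (rank2 k) => ->; first by rewrite ym_pr0 pr_om eq_sym (negbTE ij).
  by rewrite ym_pr // aji opprK pr_om eqxx.
have L : w *m r (tx i * Ti i * tx i) = 0 *: u + (wt t i * (wt t i * g)) *: w.
  by rewrite !(repM Hr) !mulmxA !scal_i -scalemxAl Ewi !scalerA -mulrA scale0r add0r.
have Rs : w *m r (tx i * Ti i * tx i) = (q * ((q - 1) * wt t j * g)) *: u +
    ((q - 1) * (wt t i * wt t i) + q * (wt t j * g)) *: w.
  rewrite /tx Tom_Ti_Tom ymE (repD Hr) !(repZ Hr) mulmxDr -!scalemxAr !(repM Hr) !mulmxA !scal_i.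
  rewrite -/(tx j) Ew_j mulmxDl -!scalemxAl Ewi Eu !scalerDr !scalerA !scalerDl.
  by rewrite addrA addrC !mulrA.
move: L; rewrite Rs => /free2 [/eqP H _].
by move: H; rewrite (negbTE (mulf_neq0 q0 (mulf_neq0 (mulf_neq0 q10 (wtn j)) g0))).
Qed.

Lemma three_weights d (r : A -> 'M[cplx]_d) t1 t2 t3 : is_rep r -> tchar R t1 -> tchar R t2 -> tchar R t3 ->
  has_wt r t1 -> has_wt r t2 -> has_wt r t3 -> t1 (al i) != t2 (al i) -> t1 (al i) != t3 (al i) ->
  t2 (al i) != t3 (al i) -> (2 < d)%N.
Proof.
move=> Hr H1 H2 H3 V1 V2 V3 n12 n13 n23.
have Xi := inX_al1 i.
have ne t t' : tchar R t -> tchar R t' -> t (al i) != t' (al i) -> wt t != wt t'.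
  by move=> Ht Ht'; apply: contra => /eqP E; apply/eqP; apply: (wt_inj Ht Ht' E).
have HV cc : exists v : 'rV[cplx]_d, cc \in [:: wt t1; wt t2; wt t3] -> v != 0 /\ wvec tx r cc v.
  have [|_] := boolP (cc \in [:: wt t1; wt t2; wt t3]); last by exists 0.
  rewrite !inE => /or3P [] /eqP ->; [case: V1|case: V2|case: V3] => v v0 Hv; by exists v.
rewrite -[3%N]/(size [:: wt t1; wt t2; wt t3]).
apply: (weights_leq (V := fun cc => sval (constructive_indefinite_description _ (HV cc))) Hr).
  by rewrite /= !inE negb_or !ne.
by move=> cc; case: (constructive_indefinite_description _ (HV cc)) => v /= H; exact: H.
Qed.

Lemma tW_al k l t : tchar R t -> tW (sr k) t (al l) = t (sr k *m al l).
Proof. by rewrite /tW invmx_sr. Qed.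

(** For t = Q the set D is {1}, so one factor is one-dimensional; it supplies the character [h],
    since the augmentation might differ on T_i and T_j. The weights [t1], [t2], [t3] reached from
    s_i Q take the values q^-1, q^a, q^-a at [al i], three in a module of dimension at most 2.
    Coincidences not excluded by [poincare_quantum] produce a weight with value 1 at [al j], which
    [jordan_block] forbids. *)
Lemma doubly_laced_contra : (a = 2 \/ a = 3)%N -> False.
Proof.
move=> Ha; have Wi := W0_sr i; have Wj := W0_sr j.
have [Qi Qj] := (Q_al i, Q_al j); have Ht := Q_tchar; have [QD Q0] := Ht.
have [r [s [d1 [r1 [v1 [Hi Hs Os [Hr1 d1b v10 E1 E2] Hk]]]]]] := linked_factors Ht Qi Qj.
have D1 : (size (Dset i j) <= 1)%N.
  rewrite -[1%N]/(size [:: 1%:M : 'M[rat]_n]); apply: uniq_leq_size; first exact: filter_uniq.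
  move=> w /mem_Dset [Hw Hwi Hwj]; rewrite inE; apply/eqP/l0_eq0 => // k.
  by case: (rank2 k) => ->.
have d11 : d1 = 1%N by have /andP [H1 H2] := d1b; apply/eqP; rewrite eqn_leq H1 (leq_trans H2 D1).
subst d1; pose h b := r1 b 0 0.
have hE b : r1 b = (h b)%:M by exact: mx11_scalar.
have hq k : v1 *m r1 (Ti k) = q *: v1 -> h (Ti k) = q.
  move=> E; move: E; rewrite hE mul_mx_scalar => /eqP; rewrite -subr_eq0 -scalerBl scaler_eq0 (negbTE v10) orbF.
  by rewrite subr_eq0 => /eqP.
have [||||||qN qm] := @poincare_quantum h _ _ _ _ i j a 1%N _ aij (aji : _ = - 1%:R) erefl _ q1.
- by move=> x y; rewrite /h (repD Hr1) mxE.
- by move=> k x; rewrite /h (repZ Hr1) mxE.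
- by move=> x y; rewrite /h (repM Hr1) !hE -scalar_mxM !mxE mulrC.
- by rewrite /h (rep1 Hr1) mxE.
- by rewrite !hq.
- by right.
have small k : Q (al k) = q -> exists d (r' : A -> 'M[cplx]_d), [/\ is_rep r', (d <= 2)%N & has_wt r' (tW (sr k) Q)].
  move=> Qk; have [d [r' [s' [v' [[Hr' I'] W' [Hs' v0' Hv' O'] _]]]]] := Hk k Qk.
  exists d, r'; split=> //.
  exact: (dihedral_bound Hs Hr' I' v0' Hv' Hs' O' (leq_trans Os D1) rank2).
have pow (x : cplx) : x = q^-1 -> q * x = 1 by move=> ->; rewrite mulfV.
have q2 : q ^+ 2 != 1.
  by rewrite -subr_eq0 subr_sqr_1 mulf_neq0 // ?subr_eq0 // addr_eq0.
have [Xi Xj] := (inX_al1 i, inX_al1 j).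
have [d2 [r2 [Hr2 d2_le W2]]] := small i Qi.
pose t1 := tW (sr i) Q; have Ht1 : tchar R t1 by exact: tW_tchar.
have t1i : t1 (al i) = q^-1 by rewrite /t1 tW_al // sr_al (tcharN Ht Xi) Qi.
have t1j : t1 (al j) = q ^+ a.+1.
  by rewrite /t1 tW_al // Eji QD //; [by rewrite (tcharMn _ Ht Xi) Qi Qj exprS|exact: inXMn].
have [E|n1] := eqVneq (q ^+ a.+1) 1.
  by apply: (jordan_block Hr2 Ht1 W2 _ qN d2_le); rewrite t1j.
pose t2 := tW (sr j) t1; have Ht2 : tchar R t2 by exact: tW_tchar.
have t2i : t2 (al i) = q ^+ a.
  by rewrite /t2 tW_al // Eij (proj1 Ht1) // t1i t1j exprS mulKf.
pose t3 := tW (sr i) t2; have Ht3 : tchar R t3 by exact: tW_tchar.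
have t3i : t3 (al i) = (q ^+ a)^-1 by rewrite /t3 tW_al // sr_al (tcharN Ht2 Xi) t2i.
have done3 : q ^+ a.+1 != q -> q ^+ a.+1 != q^-1 -> q ^+ a != 1 -> q ^+ a != q -> q ^+ a != q^-1 ->
    q ^+ a != (q ^+ a)^-1 -> False.
  move=> h1 h2 h3 h4 h5 h6.
  have W2' : has_wt r2 t2 by apply: wt_step => //; rewrite t1j.
  have W3' : has_wt r2 t3 by apply: wt_step => //; rewrite t2i.
  have a1 : q^-1 != q ^+ a by rewrite eq_sym.
  have a2 : q^-1 != (q ^+ a)^-1 by rewrite (inj_eq invr_inj) eq_sym.
  have := three_weights Hr2 Ht1 Ht2 Ht3 W2 W2' W3'; rewrite t1i t2i t3i => /(_ a1 a2 h6).
  by rewrite ltnNge d2_le.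
have pq k : q ^+ k.+1 = q -> q ^+ k = 1 by rewrite exprS => H; apply: (mulfI q0); rewrite mulr1.
have pv k : q ^+ k = q^-1 -> q ^+ k.+1 = 1 by rewrite exprS => ->; rewrite mulfV.
have pp k : q ^+ k = (q ^+ k)^-1 -> q ^+ (k + k) = 1.
  by rewrite exprD => {1}->; rewrite mulVf // expf_neq0.
move: qm done3; rewrite /coxeter_number; case: Ha => Ea; rewrite Ea /= => qm done3.
  rewrite Ea in n1; apply: done3 => //.
  - by apply: contra q2 => /eqP /pq ->.
  - by apply: contra qm => /eqP /pv ->.
  - by apply: contra q1 => /eqP /(pq 1%N) ; rewrite expr1 => ->.
  - by apply: contra n1 => /eqP /pv ->.
  by apply: contra qm => /eqP /pp ->.
have q3 : q ^+ 3 != 1 by apply: contra qm => /eqP E; rewrite (exprM q 3 2) E expr1n.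
(* In type G2 the step from [t1] to [t2] is blocked when q^4 = q^-1. Then the factor with weight s_j
   Q is used instead: s_i s_j Q takes the value q^5 = 1 at [al j]. *)
rewrite Ea in n1; have [E5|n5] := eqVneq (q ^+ 5) 1.
  have [d3 [r3 [Hr3 d3_le W3]]] := small j Qj.
  pose t4 := tW (sr j) Q; have Ht4 : tchar R t4 by exact: tW_tchar.
  have t4i : t4 (al i) = q ^+ 2 by rewrite /t4 tW_al // Eij QD // Qi Qj expr2.
  have t4j : t4 (al j) = q^-1 by rewrite /t4 tW_al // sr_al (tcharN Ht Xj) Qj.
  have W4 : has_wt r3 (tW (sr i) t4).
    apply: wt_step => //; rewrite t4i //.
      by apply: contra q1 => /eqP /(pq 1%N); rewrite expr1 => ->.
    by apply: contra q3 => /eqP /pv ->.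
  apply: (jordan_block Hr3 (tW_tchar Wi Ht4) W4 _ qN d3_le).
  rewrite tW_al // Eji Ea (proj1 Ht4) //; last exact: inXMn.
  rewrite (tcharMn _ Ht4 Xi) t4i t4j.
  by rewrite -exprM -[(2 * 3)%N]/(5.+1) exprS mulKf // E5.
apply: done3 => //.
- by apply: contra q3 => /eqP /pq ->.
- by apply: contra n5 => /eqP /pv ->.
- by apply: contra q2 => /eqP /pq ->.
- by apply: contra n1 => /eqP /pv ->.
by apply: contra qm => /eqP /pp ->.
Qed.
End RankTwo.
End AffineHeckeAlgebra.

Lemma cplx_sqrt (q : cplx) : exists c, c * c = q.
Proof.
have [|c] := @cplx_root ('X^2 - q%:P); first by rewrite size_XnsubC.
by rewrite rootE hornerD hornerN hornerC hornerXn subr_eq0 => /eqP <-; exists c; rewrite expr2.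
Qed.

Lemma group_algebra_transport (n : nat) (R : rootsys n) (A B : algType cplx) (e : Wel R -> B) :
  is_group_algebra e -> alg_isomorphic A B -> exists e' : Wel R -> A, is_group_algebra e'.
Proof.
move=> [[free sp] eM] [phi [[psi K1 K2] pD pZ pM p1]].
have sD x y : psi (x + y) = psi x + psi y by rewrite -{1}(K2 x) -{1}(K2 y) -pD K1.
have sZ k x : psi (k *: x) = k *: psi x by rewrite -{1}(K2 x) -pZ K1.
have sM x y : psi (x * y) = psi x * psi y by rewrite -{1}(K2 x) -{1}(K2 y) -pM K1.
have s0 : psi 0 = 0 by have := sZ 0 0; rewrite !scale0r.
have ssum (s : seq (Wel R)) k : \sum_(i <- s) k i *: psi (e i) = psi (\sum_(i <- s) k i *: e i).
  by elim/big_rec2: _ => [|i x y _ ->]; rewrite ?s0 // sD sZ.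
exists (fun a => psi (e a)); split; last by move=> a b c /eM <-; rewrite sM.
split=> [s k Hs|v].
  by rewrite ssum -s0 => /(can_inj K2); exact: free.
by have [s [k E]] := sp (phi v); exists s, k; rewrite ssum -E K1.
Qed.

Theorem theorem1p2 (n : nat) (R : rootsys n) (f : 'rV[rat]_n) (q : cplx)
  (HR : is_root_system R) (Hred : reduced_rs R) (Hirr : irreducible_rs R)
  (Hrank : (1 < n)%N) (Hpos : positive_system R f)
  (Hq0 : q != 0) (Hq1 : q != 1)
  (HE8 : typeE8 R -> ~ mult_order q 11 /\ ~ mult_order q 13)
  (A B : algType cplx) (T : Wel R -> A) (e : Wel R -> B)
  (HT : is_Hecke f q T) (He : is_group_algebra e) :
  ~ alg_isomorphic A B.
Proof.
move=> /(group_algebra_transport He) [e' He'].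
have [W0s [W0u W0P]] := W0_list HR; have [al Hal] := base_exists HR Hred Hpos W0u W0P.
have D : based R f W0s al by [].
have n0 : (0 < n)%N := ltnW Hrank.
have [c cq] := cplx_sqrt q.
have [i [j [a [b [ij aij aji Hab]]]]] := cartan_pair D Hrank.
case: Hab => [[a1 b1]|[rank2 [b1 Ha]]]; subst b.
  subst a; exact: (simply_laced_contra D Hq0 n0 HT He' cq Hq1 ij aij aji).
exact: (doubly_laced_contra D Hq0 n0 HT He' cq Hq1 aij aji ij rank2 Ha).
Qed.
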